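(* Let $\lambda\vdash n$ have $r$ removable boxes, and for $0\le k\le r$ let $S^\lambda_k=\operatorname{span}\{C_T\mid T\in SYT(\lambda),\ \operatorname{idx}(T)\le k\}\subseteq S^\lambda$, giving a filtration $0=S^\lambda_0\subset S^\lambda_1\subset\cdots\subset S^\lambda_r=S^\lambda$. Then each $S^\lambda_i$ is invariant under $S_{n-1}$ (the subgroup generated by $s_1,\dots,s_{n-2}$), and for every $1\le i\le r$ there is an isomorphism of $S_{n-1}$-modules $S^\lambda_i/S^\lambda_{i-1}\cong S^{\mu_i}$, where $\mu_i\vdash n-1$ is the partition obtained from $\lambda$ by deleting its $i$-th removable box.
   Context: $SYT(\lambda)$ is the set of standard Young tableaux of shape $\lambda$. A box of $\lambda$ is removable if deleting it gives a Young diagram; the removable boxes are numbered $1,\dots,r$ from top to bottom. The index $\operatorname{idx}(T)$ of $T\in SYT(\lambda)$ is the number of the removable box containing $n$. The descent set $D(T)$ is the set of $j\in\{1,\dots,n-1\}$ with $j+1$ strictly below $j$ in $T$. For $v<w$ in Bruhat order let $\overline{\mu}(v,w)$ be the coefficient of $q^{(l(w)-l(v)-1)/2}$ in the Kazhdan–Lusztig polynomial $P_{v,w}(q)$ (zero if not an integer exponent), extended symmetrically and set to $0$ for incomparable pairs. For $T,R\in SYT(\lambda)$ set $\overline{\mu}(T,R)=\overline{\mu}(v,w)$ where $v,w$ correspond under RSK to $(T,Q_0),(R,Q_0)$ for any fixed $Q_0\in SYT(\lambda)$ (independent of $Q_0$). The Specht module $S^\lambda$ is the complex vector space with Kazhdan–Lusztig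 basis $\{C_T\mid T\in SYT(\lambda)\}$ and $S_n$-action given on simple transpositions $s_j=(j,j+1)$ by $s_jC_T=-C_T$ if $j\in D(T)$ and $s_jC_T=C_T+\sum_{R:\,j\in D(R)}\overline{\mu}(T,R)C_R$ if $j\notin D(T)$. $S^{\mu}$ for $\mu\vdash n-1$ is defined the same way as an $S_{n-1}$-module. *)

(* Defs.v *)
(* Conventions.  Permutations of {1, ..., n} are elements of 'S_n, i.e.,      *)
(* permutations of {0, ..., n-1}; accordingly the entries of a standard Young *)
(* tableau of size n are 0, ..., n-1, and the simple transposition s_j is     *)
(* tperm i k with i = j-1 and k = i.+1.                                       *)
(* The product of 'S_n is diagrammatic, (v * s) i = s (v i), and a            *)
(* representation acts on row vectors on the right, so that                   *)
(* u *m rho (v * s) = (u *m rho v) *m rho s: this is a left module for the    *)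
(* usual product of permutations, with w u written u *m rho w.                *)
From HB Require Import structures.
From mathcomp Require Import all_boot all_order all_algebra all_fingroup.
From mathcomp Require Import mxrepresentation.
From mathcomp Require Import zify.

Set Implicit Arguments.
Unset Strict Implicit.
Unset Printing Implicit Defensive.

Import GRing.Theory.

Local Open Scope ring_scope.

Section KazhdanLusztig.

Variable n : nat.
Implicit Types v w x y : 'S_n.

Definition len w : nat :=
  #|[set ij : 'I_n * 'I_n | (ij.1 < ij.2)%N && (w ij.2 < w ij.1)%N]|.

Definition bruhat_step : rel 'S_n := fun v w =>
  (len v < len w)%N && [exists i, exists j, w == (v * tperm i j)%g].

Definition bruhat : rel 'S_n := connect bruhat_step.

Definition bruhat_lt : rel 'S_n := fun v w => bruhat v w && (v != w).

Definition is_simple : pred 'S_n := fun s =>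
  [exists i : 'I_n, exists k : 'I_n, (k == i.+1 :> nat) && (s == tperm i k)].

(* R_{x,w} by the usual recursion along a descent s of w; k bounds len w. *)
Fixpoint Rrec (k : nat) x w : {poly int} :=
  match k, [pick s | is_simple s && (len (w * s)%g < len w)%N] with
  | k'.+1, Some s =>
      if (len (x * s)%g < len x)%N then Rrec k' (x * s)%g (w * s)%g
      else 'X * Rrec k' (x * s)%g (w * s)%g + ('X - 1) * Rrec k' x (w * s)%g
  | _, _ => (x == w)%:R
  end.

Definition Rpol x w : {poly int} := Rrec (len w) x w.

(* For x < w the defining identity                                            *)
(*   q^(l(w)-l(x)) P_{x,w}(1/q) = \sum_(x <= y <= w) R_{x,y} P_{y,w}          *)
(* determines P_{x,w}, of degree at most (l(w)-l(x)-1)/2, as the opposite of  *)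
(* the low degree part of the sum over x < y <= w; see KLpol_unique.          *)
Fixpoint KLrec (k : nat) x w : {poly int} :=
  if x == w then 1 else
  if k is k'.+1 then
    if bruhat x w then
      - take_poly (len w - len x).+1./2
          (\sum_(y | bruhat_lt x y && bruhat y w) Rpol x y * KLrec k' y w)
    else 0
  else 0.

Definition KLpol x w : {poly int} := KLrec (len w) x w.

Definition KL_axioms (P : 'S_n -> 'S_n -> {poly int}) : Prop :=
  [/\ forall x w, ~~ bruhat x w -> P x w = 0,
      forall w, P w w = 1,
      forall x w, bruhat_lt x w ->
        (2 * (size (P x w)).-1 <= (len w - len x).-1)%N &
      forall x w, bruhat x w ->
        \poly_(i < (len w - len x).+1) (P x w)`_(len w - len x - i)
        = \sum_(y | bruhat x y && bruhat y w) Rpol x y * P y w].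

Lemma bruhat_len x w : bruhat x w -> (len x <= len w)%N.
Proof.
case/connectP=> p; elim: p x => [x _ -> //|y p IH x /= /andP[/andP[xy _] yp] ew].
exact: leq_trans (ltnW xy) (IH y yp ew).
Qed.

Lemma bruhat_lt_len x w : bruhat_lt x w -> (len x < len w)%N.
Proof.
case/andP=> /connectP[[|y p] /= ]; first by move=> _ ->; rewrite eqxx.
case/andP=> /andP[xy _] yp ew _; apply: (leq_trans xy).
by apply: bruhat_len; apply/connectP; exists p.
Qed.

Lemma Rpolxx x : Rpol x x = 1.
Proof.
rewrite /Rpol; move: (len x) => k; elim: k x => [|k IH] x /=; first by rewrite eqxx.
by case: pickP => [s /andP[_ ->] // | _]; rewrite eqxx.
Qed.

Lemma KLpol_unique P : KL_axioms P -> P =2 KLpol.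
Proof.
case=> P0 P1 Pdeg Pbar x w; rewrite /KLpol.
suff H k : (len w - len x <= k)%N -> P x w = KLrec k x w by exact/H/leq_subr.
elim: k x => [|k IH] x lek /=;
    (have [->//|neq] := eqVneq x w; case: (boolP (bruhat x w)) => [xw|/P0 //]);
    have xltw : bruhat_lt x w by rewrite /bruhat_lt xw.
  by move: (bruhat_lt_len xltw); rewrite -subn_gt0 ltnNge lek.
have ltxw := bruhat_lt_len xltw.
have Pbarx := Pbar _ _ xw; have szP := Pdeg _ _ xltw.
rewrite [RHS](bigD1 x) /= ?xw ?andbT ?Rpolxx ?mul1r in Pbarx; last exact: connect0.
rewrite (eq_bigl (fun y => bruhat_lt x y && bruhat y w)) in Pbarx; last first.
  by move=> y; rewrite /bruhat_lt andbAC (eq_sym y).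
rewrite (_ : \sum_(y | _) _ =
    \sum_(y | bruhat_lt x y && bruhat y w) Rpol x y * P y w); last first.
  apply: eq_bigr => y /andP[xy _]; congr (_ * _); symmetry; apply: IH.
  by rewrite -ltnS (leq_trans _ lek) // ltn_sub2l // bruhat_lt_len.
move: ltxw Pbarx szP; rewrite -subn_gt0 {lek neq xw xltw}; move: (len w - len x)%N => d d_gt0 Pbarx szP.
move: (\sum_(y | _) _) Pbarx => S Pbarx.
apply/polyP=> i; rewrite coefN coef_take_poly.
have {}szP : (size (P x w) <= d.+1./2)%N.
  rewrite -divn2; move: szP; move: (size _) => m; lia.
case: ltnP => [lti|gei]; last by rewrite oppr0 nth_default // (leq_trans szP).
rewrite -divn2 in lti szP.
have /(congr1 (fun p : {poly int} => p`_i)) := Pbarx.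
rewrite coefD coef_poly (_ : (P x w)`_(d - i) = 0); last first.
  rewrite nth_default //; move: szP lti; move: (size _) => m; lia.
by rewrite if_same => /esym /eqP; rewrite addr_eq0 => /eqP.
Qed.

Definition mubar v w : int :=
  let top_coef x y :=
    if odd (len y - len x) then (KLpol x y)`_((len y - len x).-1./2) else 0 in
  if bruhat_lt v w then top_coef v w
  else if bruhat_lt w v then top_coef w v else 0.

End KazhdanLusztig.

Section YoungTableaux.

Implicit Types (la : seq nat) (t p q : seq (seq nat)).

Definition is_partition (n : nat) la : bool :=
  [&& sorted geq la, 0%N \notin la & sumn la == n].

Definition decr_row la (i : nat) : seq nat := set_nth 0%N la i (nth 0%N la i).-1.

(* Rows whose last box is removable, from top to bottom. *)
Definition removable la : seq nat :=
  [seq i <- iota 0 (size la) | sorted geq (decr_row la i)].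

(* la with its i-th removable box deleted, i = 1, ..., size (removable la). *)
Definition delete_removable la (i : nat) : seq nat :=
  [seq x <- decr_row la (nth 0%N (removable la) i.-1) | x != 0%N].

(* A tableau is the list of its rows, top row first. *)
Definition is_syt (n : nat) la t : bool :=
  [&& shape t == la, perm_eq (flatten t) (iota 0 n), all (sorted ltn) t &
      sorted (fun r1 r2 : seq nat =>
                all (fun c => nth 0%N r1 c < nth 0%N r2 c)%N (iota 0 (size r2))) t].

Definition tab_rows n (t : n.-bseq (n.-bseq 'I_n)) : seq (seq nat) :=
  [seq [seq val x | x <- val r] | r <- val t].

Record SYT (n : nat) la := MkSYT {
  syt_tab : n.-bseq (n.-bseq 'I_n);
  _ : is_syt n la (tab_rows syt_tab) }.

HB.instance Definition _ n la := [isSub for @syt_tab n la].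
HB.instance Definition _ n la := [Finite of SYT n la by <:].

Definition rows n la (T : SYT n la) : seq (seq nat) := tab_rows (syt_tab T).

Definition row_of t (j : nat) : nat := find (fun r => j \in r) t.

(* The number, starting from 1, of the removable box containing the largest   *)
(* entry of T.                                                                *)
Definition idx n la (T : SYT n la) : nat :=
  (index (row_of (rows T) n.-1) (removable la)).+1.

Definition descent n la (T : SYT n la) (j : nat) : bool :=
  (row_of (rows T) j < row_of (rows T) j.+1)%N.

(* Schensted row insertion; also returns the row of the new box. *)
Fixpoint row_insert t (x : nat) : seq (seq nat) * nat :=
  if t is r :: t' then
    let k := find (fun y => x < y)%N r in
    if k == size r then (rcons r x :: t', 0%N)
    else let: (t'', i) := row_insert t' (nth 0%N r k) in
         (set_nth 0%N r k x :: t'', i.+1)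
  else ([:: [:: x]], 0%N).

Definition RSK_step (pq : seq (seq nat) * seq (seq nat)) (x : nat) :=
  let: (p, q) := pq in
  let: (p', i) := row_insert p x in
  (p', set_nth [::] q i (rcons (nth [::] q i) (sumn (shape q)))).

(* The pair (insertion tableau, recording tableau). *)
Definition RSK n (w : 'S_n) : seq (seq nat) * seq (seq nat) :=
  foldl RSK_step ([::], [::]) [seq val (w i) | i <- enum 'I_n].

(* The permutation corresponding to (T, Q); RSK being a bijection, the default *)
(* value is never used.                                                       *)
Definition RSK_inv n la (T Q : SYT n la) : 'S_n :=
  odflt 1%g [pick w : 'S_n | RSK w == (rows T, rows Q)].

(* This does not depend on Q0, which is nevertheless kept as a parameter.      *)
Definition mubar_syt n la (Q0 T S : SYT n la) : int :=
  mubar (RSK_inv T Q0) (RSK_inv S Q0).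

End YoungTableaux.

Section Specht.

Variable F : fieldType.

Definition KLbasis n la (T : SYT n la) : 'rV[F]_#|{: SYT n la}| :=
  delta_mx 0 (enum_rank T).

(* rho is the Specht module of shape la: the representation of 'S_n on the     *)
(* span of the KLbasis T in which the simple transpositions act by the        *)
(* Kazhdan-Lusztig formulas.  As they generate 'S_n, rho is unique; it exists *)
(* since the formulas are those of a left cell module.                        *)
Definition is_specht n la (Q0 : SYT n la)
    (rho : mx_representation F [set: 'S_n] #|{: SYT n la}|) : Prop :=
  forall (i k : 'I_n), k = i.+1 :> nat -> forall T : SYT n la,
    KLbasis T *m rho (tperm i k) =
      if descent T i then - KLbasis T
      else KLbasis T
           + \sum_(S : SYT n la | descent S i) (mubar_syt Q0 T S)%:~R *: KLbasis S.

Definition specht_filt n la (k : nat) : 'M[F]_#|{: SYT n la}| :=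
  (\sum_(T : SYT n la | (idx T <= k)%N) <<KLbasis T>>)%MS.

End Specht.

Section Restriction.

Variable n : nat.

(* The inclusion of 'S_n into 'S_n.+1 as the stabilizer of the last letter. *)
Definition Sembed (w : 'S_n) : 'S_n.+1 := lift_perm ord_max ord_max w.

Lemma Sembed1 : Sembed 1%g = 1%g.
Proof. exact: lift_perm1. Qed.

Lemma SembedM : {morph Sembed : v w / (v * w)%g}.
Proof. by move=> v w; rewrite /Sembed lift_permM. Qed.

Canonical Sembed_morphism := @Morphism _ _ [set: 'S_n] _ (in2W SembedM).

Lemma Sembed_tperm (i j : 'I_n) :
  Sembed (tperm i j) = tperm (lift ord_max i) (lift ord_max j).
Proof.
apply/permP=> x; rewrite /Sembed.
have [y ->|->] := unliftP ord_max x.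
  rewrite lift_perm_lift; have inj := @lift_inj _ (@ord_max n).
  by rewrite -(inj_tperm _ _ _ inj).
by rewrite lift_perm_id tpermD // eq_sym neq_lift.
Qed.

Lemma simple_gen m : <<[set s : 'S_m | is_simple s]>>%g = [set: 'S_m].
Proof.
case: m => [|m]; first by apply/setP=> s; rewrite inE (_ : s = 1%g) ?group1 //; apply/permP=> -[].
apply/eqP; rewrite -subTset -(gen_tperm ord0) gen_subG.
apply/subsetP=> _ /imsetP[j _ ->].
case: j => j ltj; elim: j ltj => [|j IH] ltj.
  by rewrite (_ : Ordinal ltj = ord0) ?tperm1 ?group1 //; apply: val_inj.
have ltj' := ltnW ltj; set a := Ordinal ltj'; set b := Ordinal ltj.
have s_ab : tperm a b \in <<[set s : 'S_m.+1 | is_simple s]>>%g.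
  apply: mem_gen; rewrite inE; apply/existsP; exists a; apply/existsP; exists b.
  by rewrite !eqxx.
have [a0|a0] := eqVneq ord0 a; first by rewrite a0.
have -> : tperm ord0 b = (tperm ord0 a ^ tperm a b)%g.
  by rewrite tpermJ tpermL tpermD // eq_sym.
by rewrite groupJ // IH.
Qed.

Lemma Sembed_gen :
  Sembed @: [set: 'S_n] =
    <<[set tperm ik.1 ik.2 | ik : 'I_n.+1 * 'I_n.+1 &
        (ik.2 == ik.1.+1 :> nat) && (ik.2 < n)%N]>>%g.
Proof.
have -> : Sembed @: [set: 'S_n] = (Sembed_morphism @* [set: 'S_n])%g.
  by rewrite morphimEdom.
rewrite -[X in (_ @* X)%g]simple_gen morphim_gen ?subsetT //; congr <<_>>%g.
rewrite morphimE setTI; apply/setP=> s; apply/imsetP/imsetP.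
  case=> w; rewrite inE => /existsP[i /existsP[k /andP[/eqP ik /eqP ->]]] ->.
  exists (lift ord_max i, lift ord_max k); last exact: Sembed_tperm.
  by rewrite inE /= /bump !(leqNgt n) !ltn_ord !add0n -ik eqxx.
case=> -[i k]; rewrite inE /= => /andP[/eqP ik ltk] ->.
have lti : (i < n)%N by rewrite ltnW // -ik.
exists (tperm (Ordinal lti) (Ordinal ltk)).
  rewrite inE; apply/existsP; exists (Ordinal lti); apply/existsP.
  by exists (Ordinal ltk); rewrite eqxx andbT; apply/eqP.
by rewrite /= Sembed_tperm; congr tperm; apply: val_inj;
   rewrite /= /bump leqNgt ?lti ?ltk.
Qed.

Variables (F : fieldType) (d : nat).
Variable rho : mx_representation F [set: 'S_n.+1] d.

Lemma res_mx_repr : mx_repr [set: 'S_n] (fun w => rho (Sembed w)).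
Proof.
split=> [|v w _ _]; first by rewrite Sembed1 repr_mx1.
by rewrite SembedM repr_mxM ?inE.
Qed.

Definition res_repr : mx_representation F [set: 'S_n] d :=
  MxRepresentation res_mx_repr.

End Restriction.

(* Main.v *)
(* The coefficient of C_R in s_j C_T is the number mu(v, w) of two permutations
   in the same left cell.  Knuth moves on the positions commute with the action
   on values and preserve these numbers (star operations), so that Q0 may be
   ignored and v, w may be taken to be the row reading words of T, R.  In the
   reading word of T the largest letter n is the further to the right, the
   smaller idx T, and it moves to the left when one goes up in Bruhat order.  If
   s = s_j is a descent of w and not of v, then mu(v, w) <> 0 implies w < v or
   w = v s; for j < n-1 neither increases idx, whence the invariance.

   The permutations with n in a given position form a coset of S_{n-1}; it is
   convex for Bruhat order, and its R- and Kazhdan-Lusztig polynomials are those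
   of S_{n-1}.  Deleting n from the tableaux of index i, and from their reading
   words, thus identifies the coefficients on the i-th subquotient with those of
   the Specht module of mu_i. *)
Require Import Defs.
From HB Require Import structures.
From mathcomp Require Import all_boot all_order all_algebra all_fingroup.
From mathcomp Require Import mxrepresentation complex reals.
From mathcomp Require Import zify ring.

Set Implicit Arguments.
Unset Strict Implicit.
Unset Printing Implicit Defensive.

Import GRing.Theory.

(** * Schensted insertion and Knuth moves *)

(** The numbers [mubar v w] come from polynomials defined through R-polynomials, with an arbitrary
    choice of descents. Whatever is needed about them (P_{xs,w} = P_{x,w} for a descent s of w, the
    formula for C_w C_s, the comparison with a coset) follows from one uniqueness principle: a
    bar-invariant family within the degree bound is the Kazhdan-Lusztig family. Invariance under
    star operations is then linear algebra at q = 1: left and right multiplications commute, and in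
    a well chosen entry of the two products one term survives on each side.

    Independence of Q0 is a question of connectivity. A recording tableau is encoded by the rows of
    its successive boxes, a lattice word, on which a Knuth move of the permutation acts as a dual
    Knuth move. One family of these moves connects all lattice words of a given content, and the
    positions concerned are read off the recording word, so that two permutations of a cell can be
    moved together. What is transported is [Rcoef], not [mubar]: it contains just the numbers with j
    a descent of R and not of T, and its diagonal carries the descents along. *)

Section Insertion.

Implicit Types (r : seq nat) (t : seq (seq nat)) (x y z a b c e : nat) (o : option nat).

(* Insertion into a single row; the second component is the letter bumped to
   the next row, if any. *)
Definition insR r x : seq nat * option nat :=
  let k := find (fun y => x < y) r in
  if k == size r then (rcons r x, None) else (set_nth 0 r k x, Some (nth 0 r k)).

(** The recording tableau is kept as the word of the rows of the new boxes, on which Knuth moves act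
    locally; [recording] turns this word into a tableau. *)
Fixpoint ins t (xs : seq nat) : seq (seq nat) * seq nat :=
  if xs is x :: xs' then
    let: (t1, i) := row_insert t x in let: (t2, s) := ins t1 xs' in (t2, i :: s)
  else (t, [::]).

Fixpoint insrow r (xs : seq nat) : seq nat * seq (option nat) :=
  if xs is x :: xs' then
    let: (r1, o) := insR r x in let: (r2, s) := insrow r1 xs' in (r2, o :: s)
  else (r, [::]).

(* The rows of the new boxes of r :: t, from the letters os bumped out of r and
   the rows s of the boxes created in t. *)
Fixpoint merge_rows (os : seq (option nat)) (s : seq nat) : seq nat :=
  match os, s with
  | None :: os', _ => 0 :: merge_rows os' s
  | Some _ :: os', i :: s' => i.+1 :: merge_rows os' s'
  | _, _ => [::]
  end.

Lemma row_insert_cons r t x : row_insert (r :: t) x =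
  match insR r x with
  | (r', None) => (r' :: t, 0)
  | (r', Some p) => (r' :: (row_insert t p).1, (row_insert t p).2.+1)
  end.
Proof. by rewrite /insR /=; case: ifP => // _; case: row_insert. Qed.

(** The letters bumped out of the first row form, in order, the word inserted into the remaining
    rows. All inductions on rows below rest on this. *)
Lemma ins_cons r t xs : ins (r :: t) xs =
  let: (r', os) := insrow r xs in
  ((r' :: (ins t (pmap id os)).1), merge_rows os (ins t (pmap id os)).2).
Proof.
elim: xs r t => //= x xs IH r t; rewrite -[X in let: (_, _) := X in _]/(row_insert (r :: t) x).
rewrite row_insert_cons; case: (insR r x) => r1 [p|].
  rewrite IH; case: (insrow r1 xs) => r2 os /=.
  by case: (row_insert t p) => t1 i /=; case: (ins t1 _).
by rewrite IH; case: (insrow r1 xs).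
Qed.

Lemma ins_nil x xs : ins [::] (x :: xs) = ins [:: [::]] (x :: xs).
Proof. by []. Qed.

Lemma ins_cat t xs ys : ins t (xs ++ ys) =
  ((ins (ins t xs).1 ys).1, (ins t xs).2 ++ (ins (ins t xs).1 ys).2).
Proof.
elim: xs t => [|x xs IH] t /=; first by case: ins.
by case: row_insert => t1 i; rewrite IH; case: (ins t1 xs).
Qed.

Lemma size_ins t xs : size (ins t xs).2 = size xs.
Proof.
by elim: xs t => //= x xs IH t; case: row_insert => t1 i; have := IH t1; case: (ins t1 xs) => ? ? /= ->.
Qed.

(* Inserting x into a row with set of entries S bumps o; the new set of entries
   is upd S x o. *)
Definition is_out (S : pred nat) x o : Prop :=
  if o is Some p then [/\ S p, x < p & forall e, S e ==> ((e < x) || (p <= e))]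
  else forall e, S e ==> (e < x).

Definition upd (S : pred nat) x o : pred nat :=
  fun e => (e == x) || (S e && (if o is Some p then e != p else true)).

Lemma insRP r x : sorted ltn r -> x \notin r ->
  [/\ sorted ltn (insR r x).1, is_out (mem r) x (insR r x).2 &
      (insR r x).1 =i upd (mem r) x (insR r x).2].
Proof.
move=> sr xr; rewrite /insR; case: eqVneq => [/eqP|]; rewrite -?has_find.
  rewrite eqn_leq find_size /= leqNgt -has_find -all_predC => /allP hall.
  have lt e : e \in r -> e < x.
    move=> er; have /= := hall e er; rewrite -leqNgt leq_eqVlt => /orP[/eqP ex|//].
    by rewrite -ex er in xr.
  split=> [||e] /=.
  - rewrite (sorted_pairwise ltn_trans) -cats1 pairwise_cat allrel1r -(sorted_pairwise ltn_trans).
    by rewrite sr andbT; apply/allP => e /lt.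
  - by move=> e; apply/implyP/lt.
  - by rewrite mem_rcons inE [RHS]unfold_in /= andbT.
move=> neq; have hs : has (fun y => x < y) r by rewrite has_find ltn_neqAle neq find_size.
rewrite set_nthE -has_find hs /=; move: sr xr.
case: (split_find_nth 0 hs) => p s1 s2 xp /hasPn hs1 {r hs neq}.
rewrite cat_rcons !(sorted_pairwise ltn_trans) !pairwise_cat !allrel_consr !pairwise_cons.
case/and3P=> /andP[/allP s1p s12] ps1 /andP[/allP ps2 pw2].
rewrite mem_cat inE !negb_or => /and3P[xs1 xp' xs2].
have lt1 e : e \in s1 -> e < x.
  by move=> es; move: (hs1 e es); rewrite -leqNgt leq_eqVlt => /orP[/eqP ex|//]; rewrite -ex es in xs1.
have lt2 e : e \in s2 -> p < e by move/ps2.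
split=> [||e].
- rewrite s12 ps1 pw2 !andbT; apply/andP; split; apply/allP => e; first exact: lt1.
  by move/lt2; apply: ltn_trans.
- split=> [|//|e]; first by rewrite mem_cat mem_head orbT.
  apply/implyP; rewrite mem_cat inE => /or3P[/lt1-> //|/eqP->|/lt2/ltnW->]; by rewrite ?leqnn orbT.
- rewrite [RHS]unfold_in /= !mem_cat !inE; have := lt2 e; have := s1p e.
  case: eqVneq => //= [->|nx]; first by rewrite orbT.
  case: (e \in s1) => [/(_ isT) lt _|_ lt] /=; first by rewrite neq_ltn lt.
  have [->|//] := eqVneq e p; last by rewrite andbT.
  by rewrite andbF; apply/negP=> /lt2; rewrite ltnn.
Qed.

(** A row is determined by its set of entries, so a row insertion can be identified by checking
    [is_out] and [upd] alone, without computing positions. *)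
Lemma insR_uniq r x r' o : sorted ltn r -> x \notin r -> sorted ltn r' ->
  is_out (mem r) x o -> r' =i upd (mem r) x o -> insR r x = (r', o).
Proof.
move=> sr xr sr' ox er'; have [s1 o1 e1] := insRP sr xr.
have eo : (insR r x).2 = o.
  move: o1 ox; case: (insR r x).2 => [p|]; case: (o) => [q|] //=.
  - case=> rp xp hp [rq xq hq]; congr Some; apply/eqP; rewrite eqn_leq.
    by move: (hp q) (hq p); rewrite rp rq /=; lia.
  - by case=> rp xp _ /(_ p); rewrite rp /=; lia.
  - by move=> h [rq xq _]; move: (h q); rewrite rq /=; lia.
rewrite [LHS]surjective_pairing eo; congr (_, _).
apply: (irr_sorted_eq ltn_trans ltnn) => // e.
by rewrite e1 eo er'.
Qed.

Lemma is_out_uniq (S S' : pred nat) x o o' : S =1 S' -> is_out S x o -> is_out S' x o' -> o = o'.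
Proof.
move=> eS; case: o o' => [p|] [q|] //=.
- case=> Sp xp hp [Sq xq hq]; congr Some; apply/eqP; rewrite eqn_leq.
  by move: (hp q) (hq p) Sp Sq; rewrite !eS; lia.
- by case=> Sp xp _ /(_ p); rewrite -eS Sp /=; lia.
- by move=> h [Sq xq _]; move: (h q); rewrite eS Sq /=; lia.
Qed.

(* The effect on the letters bumped from a row of a Knuth move on three letters
   inserted into it: again a Knuth move, except that it disappears or becomes a
   dual Knuth move on row indices when a letter stays at the end of the row. *)
Inductive knuth_out : seq (option nat) -> seq (option nat) -> Prop :=
| KnuthXZY a b c of a < b & b < c :
    knuth_out [:: Some a; Some c; Some b] [:: Some c; Some a; Some b]
| KnuthYZX a b c of a < b & b < c :
    knuth_out [:: Some b; Some c; Some a] [:: Some b; Some a; Some c]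
| KnuthN2 a b of a < b : knuth_out [:: Some a; None; Some b] [:: None; Some a; Some b]
| KnuthN13 a : knuth_out [:: None; None; Some a] [:: None; Some a; None]
| KnuthN3 a b of a < b : knuth_out [:: Some b; None; Some a] [:: Some b; Some a; None].

Definition outs3 (S : pred nat) a b c oa ob oc : Prop :=
  [/\ is_out S a oa, is_out (upd S a oa) b ob & is_out (upd (upd S a oa) b ob) c oc].

Lemma outs3_xzy (S : pred nat) x y z o1 o2 o3 : x < y -> y < z ->
  ~~ S x -> ~~ S y -> ~~ S z -> outs3 S x z y o1 o2 o3 ->
  exists o1' o2' o3', outs3 S z x y o1' o2' o3' /\
    knuth_out [:: o1; o2; o3] [:: o1'; o2'; o3'].
Proof.
move=> xy yz Sx Sy Sz [] h1 h2 h3; rewrite /outs3.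
(* The last letter y comes after the larger letter z, so it bumps some m. *)
case: o3 h3 => [m|] h3; last by move: (h3 z); rewrite /upd eqxx /=; lia.
have [m_in ym hm] := h3.
have mz : m <= z by move: (hm z); rewrite /upd eqxx /=; lia.
case: o1 h1 h2 h3 m_in hm => [p [Sp xp hp]|h1] h2 h3 m_in hm; last first.
  have o2N : o2 = None.
    by case: o2 h2 {h3 m_in hm} => // q [qS zq _]; move: (h1 q) qS; rewrite /upd; lia.
  rewrite {}o2N in h2 h3 m_in hm *.
  have em : m = z by move: (h1 m) m_in; rewrite /upd; lia.
  rewrite {}em in h3 m_in hm mz ym *; exists None, (Some z), None; split=> //.
  - split; first by move=> e; move: (h1 e); lia.
      by split; [rewrite /upd eqxx|lia|move=> e; move: (h1 e); rewrite /upd; lia].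
    by move=> e; move: (h1 e); rewrite /upd; lia.
  - exact: KnuthN13.
(* If p < z, then x and z act on different places and their outputs are exchanged. If z < p, then z,
   inserted first, takes the place of p and is in turn bumped by x. *)
have [pz|zp|pz] := ltngtP p z; last by rewrite -pz Sp in Sz.
  case: o2 h2 h3 m_in hm => [q [q_in zq hq]|h2] h3 m_in hm.
    exists (Some q), (Some p), (Some m); split=> //.
    - split.
      + by split=> //; [move: q_in|move=> e; move: (hq e)]; rewrite /upd; lia.
      + split=> //; first by rewrite /upd; lia.
        by move=> e; move: (hp e); rewrite /upd; lia.
      + split=> //; first by move: m_in; rewrite /upd; lia.
        by move=> e; move: (hm e); rewrite /upd; lia.
    - by apply: KnuthXZY; [move: m_in (hp m); rewrite /upd; lia|lia].
  exists None, (Some p), (Some m); split=> //.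
  - split.
    + by move=> e; move: (h2 e); rewrite /upd; lia.
    + split=> //; first by rewrite /upd; lia.
      by move=> e; move: (hp e); rewrite /upd; lia.
    + split=> //; first by move: m_in; rewrite /upd; lia.
      by move=> e; move: (hm e); rewrite /upd; lia.
  - by apply: KnuthN2; move: m_in (hp m); rewrite /upd; lia.
have em : m = z by move: (hp m) m_in; rewrite /upd; lia.
rewrite {}em in h3 m_in hm mz ym *.
case: o2 h2 h3 m_in hm => [q [q_in zq hq]|h2] h3 m_in hm.
  have pq : p < q by move: (hp q) q_in; rewrite /upd; lia.
  exists (Some p), (Some z), (Some q); split=> //.
  - split.
    + by split=> //; move=> e; move: (hp e); rewrite /upd; lia.
    + split=> //; first by rewrite /upd; lia.
        by lia.
      by move=> e; move: (hp e); rewrite /upd; lia.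
    + split=> //; first by move: q_in; rewrite /upd; lia.
        by lia.
      by move=> e; move: (hp e) (hq e); rewrite /upd; lia.
  - exact: KnuthYZX.
exists (Some p), (Some z), None; split=> //.
- split.
  + by split=> //; move=> e; move: (hp e); rewrite /upd; lia.
  + split=> //; first by rewrite /upd; lia.
      by lia.
    by move=> e; move: (hp e); rewrite /upd; lia.
  + by move=> e; move: (hp e) (h2 e); rewrite /upd; lia.
- exact: KnuthN3.
Qed.

Lemma outs3_yzx (S : pred nat) x y z o1 o2 o3 : x < y -> y < z ->
  ~~ S x -> ~~ S y -> ~~ S z -> outs3 S y z x o1 o2 o3 ->
  exists o1' o2' o3', outs3 S y x z o1' o2' o3' /\
    knuth_out [:: o1; o2; o3] [:: o1'; o2'; o3'].
Proof.
move=> xy yz Sx Sy Sz [] h1 h2 h3; rewrite /outs3.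
case: o3 h3 => [m|] h3; last by move: (h3 z); rewrite /upd eqxx /=; lia.
have [m_in xm hm] := h3.
have my : m <= y.
  by move: (hm y); rewrite /upd; case: (o2) h2 => [q [_ zq _]|_]; rewrite eqxx /=; lia.
case: o1 h1 h2 h3 m_in hm => [p [Sp yp hp]|h1] h2 h3 m_in hm; last first.
  have o2N : o2 = None.
    by case: o2 h2 {h3 m_in hm} => // q [qS zq _]; move: (h1 q) qS; rewrite /upd; lia.
  rewrite {}o2N in h2 h3 m_in hm *.
  exists None, (Some m), None; split=> //.
  - split=> //.
      by split=> //; [move: m_in|move=> e; move: (hm e)]; rewrite /upd; lia.
    by move=> e; move: (h1 e); rewrite /upd; lia.
  - exact: KnuthN13.
case: o2 h2 h3 m_in hm => [q [q_in zq hq]|h2] h3 m_in hm.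
  have pq : p < q by move: (hp q) q_in; rewrite /upd; lia.
  exists (Some p), (Some m), (Some q); split=> //.
  - split=> //.
    + by split=> //; [move: m_in|move=> e; move: (hm e)]; rewrite /upd; lia.
    + split=> //; first by move: q_in; rewrite /upd; lia.
      by move=> e; move: (hq e); rewrite /upd; lia.
  - by apply: KnuthYZX => //; lia.
exists (Some p), (Some m), None; split=> //.
- split=> //.
  + by split=> //; [move: m_in|move=> e; move: (hm e)]; rewrite /upd; lia.
  + by move=> e; move: (h2 e); rewrite /upd; lia.
- by apply: KnuthN3; lia.
Qed.

Lemma eq_is_out (S S' : pred nat) x o : S =1 S' -> is_out S x o -> is_out S' x o.
Proof.
move=> eS; case: o => [p [Sp xp hp]|h] /=; last by move=> e; rewrite -eS.
by split; rewrite -?eS // => e; rewrite -eS.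
Qed.

Lemma eq_upd (S S' : pred nat) x o : S =1 S' -> upd S x o =1 upd S' x o.
Proof. by move=> eS e; rewrite /upd eS. Qed.

Lemma outs3_uniq (S : pred nat) a b c o1 o2 o3 o1' o2' o3' :
  outs3 S a b c o1 o2 o3 -> outs3 S a b c o1' o2' o3' ->
  [:: o1; o2; o3] = [:: o1'; o2'; o3'].
Proof.
case=> a1 a2 a3 [b1 b2 b3]; have e1 := is_out_uniq (frefl S) a1 b1; rewrite -e1 in b2 b3 *.
have e2 := is_out_uniq (frefl _) a2 b2; rewrite -e2 in b3 *.
by rewrite (is_out_uniq (frefl _) a3 b3).
Qed.

Lemma insR_perm r x : sorted ltn r -> x \notin r ->
  perm_eq ((insR r x).1 ++ pmap id [:: (insR r x).2]) (x :: r).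
Proof.
move=> sr xr; have [s1 o1 e1] := insRP sr xr.
have ur := sorted_uniq ltn_trans ltnn sr; have u1 := sorted_uniq ltn_trans ltnn s1.
case: (insR r x) s1 o1 e1 u1 => r1 [p|] /= s1 o1 e1 u1.
  have [rp xp _] := o1; have px : (p == x) = false by rewrite gtn_eqF.
  apply: uniq_perm; rewrite /= ?xr ?ur //.
    by rewrite cat_uniq u1 /= orbF andbT e1 unfold_in /= eqxx andbF px.
  move=> e; rewrite mem_cat inE e1 unfold_in /= !inE; have [->|] := eqVneq e p.
    by rewrite px /= andbF rp.
  by rewrite andbT orbF.
rewrite cats0; apply: uniq_perm; rewrite /= ?xr ?ur //.
by move=> e; rewrite e1 unfold_in /= andbT inE.
Qed.

Definition good t (xs : seq nat) := all (sorted ltn) t && uniq (xs ++ flatten t).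

Lemma good_step r t xs : good (r :: t) xs ->
  [/\ sorted ltn (insrow r xs).1,
      perm_eq ((insrow r xs).1 ++ pmap id (insrow r xs).2) (xs ++ r) &
      good t (pmap id (insrow r xs).2)].
Proof.
rewrite /good /= => /andP[/andP[sr st] u].
suff [s1 p1] : sorted ltn (insrow r xs).1 /\
    perm_eq ((insrow r xs).1 ++ pmap id (insrow r xs).2) (xs ++ r).
  split=> //; rewrite st /=.
  have p2 : perm_eq ((insrow r xs).1 ++ (pmap id (insrow r xs).2 ++ flatten t)) (xs ++ r ++ flatten t).
    by rewrite catA [X in perm_eq _ X]catA perm_cat2r.
  by move: u; rewrite -(perm_uniq p2) cat_uniq => /and3P[].
elim: xs r sr u => [|x xs IH] r sr /= u; first by rewrite cats0.
have xr : x \notin r.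
  by case/andP: u => + _; rewrite !mem_cat; apply: contra => ->; rewrite orbT.
have [s1 _ _] := insRP sr xr; have := insR_perm sr xr.
case: (insR r x) s1 => r1 o /= s1 p1.
have u1 : uniq (xs ++ r1 ++ flatten t).
  have p2 : perm_eq ((x :: r) ++ (xs ++ flatten t)) (x :: xs ++ r ++ flatten t).
    by rewrite /= perm_cons !catA perm_cat2r perm_catC.
  have p3 : perm_eq (pmap id [:: o] ++ (xs ++ r1 ++ flatten t)) (x :: xs ++ r ++ flatten t).
    rewrite perm_sym; apply: perm_trans (_ : perm_eq ((x :: r) ++ (xs ++ flatten t)) _).
      by rewrite perm_sym.
    rewrite -(perm_cat2r (xs ++ flatten t)) perm_sym in p1; apply: perm_trans p1 _.
    rewrite -catA perm_catCA perm_cat2l perm_catCA; exact: perm_refl.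
  by move: u; rewrite -/(uniq (x :: _)) -(perm_uniq p3) cat_uniq => /and3P[].
have [s2 p2] := IH r1 s1 u1; case: (insrow r1 xs) s2 p2 => r2 os /= s2 p2; split=> //.
have eo : pmap id (o :: os) = pmap id [:: o] ++ pmap id os by case: (o).
rewrite -[oapp _ _ _]/(pmap id (o :: os)) eo perm_catCA.
apply: perm_trans (_ : perm_eq (pmap id [:: o] ++ (xs ++ r1)) _); first by rewrite perm_cat2l.
rewrite perm_catCA perm_sym -[x :: xs ++ r]/([:: x] ++ xs ++ r) perm_catCA perm_cat2l.
by rewrite perm_sym perm_catC.
Qed.

Lemma insrow_outs3 r a b c : sorted ltn r -> uniq ([:: a; b; c] ++ r) ->
  exists oa ob oc, (insrow r [:: a; b; c]).2 = [:: oa; ob; oc] /\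
    outs3 (mem r) a b c oa ob oc.
Proof.
move=> sr /= /and4P[]; rewrite !inE !negb_or => /and3P[ab ac ar] /andP[bc br] cr _.
have [s1 o1 e1] := insRP sr ar; case: (insR r a) s1 o1 e1 => r1 oa /= s1 o1 e1.
have br1 : b \notin r1 by rewrite e1 unfold_in /= negb_or eq_sym ab (negbTE br).
have cr1 : c \notin r1 by rewrite e1 unfold_in /= negb_or eq_sym ac (negbTE cr).
have [s2 o2 e2] := insRP s1 br1; case: (insR r1 b) s2 o2 e2 => r2 ob /= s2 o2 e2.
have cr2 : c \notin r2 by rewrite e2 unfold_in /= negb_or eq_sym bc (negbTE cr1).
have [s3 o3 e3] := insRP s2 cr2; case: (insR r2 c) s3 o3 e3 => r3 oc /= s3 o3 e3.
exists oa, ob, oc; split=> //; split=> //; first exact: eq_is_out o2.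
by apply: eq_is_out o3 => e; rewrite [LHS]e2; apply: eq_upd e.
Qed.

(** Row bumping lemma: the letters bumped out of a row come in the same order as those inserted, so
    the two bumping paths do not cross. [ins2_gt] is the opposite case. *)
Lemma ins2_lt t a b : good t [:: a; b] -> a < b ->
  nth 0 (ins t [:: a; b]).2 1 <= nth 0 (ins t [:: a; b]).2 0.
Proof.
elim: t a b => [|r t IH] a b g ab; first by rewrite /= ltnNge (ltnW ab).
have [_ _] := good_step g; have /andP[/andP[sr _] u] := g; rewrite ins_cons /=.
move: u; rewrite /= inE !mem_cat !negb_or => /and3P[/and3P[nab ar _] /andP[br _] _].
have [s1 o1 e1] := insRP sr ar; case: (insR r a) s1 o1 e1 => r1 oa /= s1 o1 e1.
have br1 : b \notin r1 by rewrite e1 unfold_in /= negb_or eq_sym nab (negbTE br).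
have [s2 o2 e2] := insRP s1 br1; case: (insR r1 b) s2 o2 e2 => r2 ob /= s2 o2 e2.
case: oa ob o1 o2 e1 e2 => [p|] [q|] /= o1 o2 e1 e2 g'.
- have pq : p < q.
    have [rp ap hp] := o1; have [rq bq hq] := o2.
    by move: rq (hp q) ab bq; rewrite e1 unfold_in /=; clear; lia.
  by have := IH p q g' pq; rewrite /=; case: (row_insert t p) => t1 i /=; case: (row_insert t1 q) => t2 j /=; rewrite ?ltnS.
- by case: (row_insert t p).
- by have [rq bq hq] := o2; move: rq (o1 q) ab bq; rewrite e1 unfold_in /=; clear; lia.
- by [].
Qed.

Lemma ins2_gt t a b : good t [:: a; b] -> b < a ->
  nth 0 (ins t [:: a; b]).2 0 < nth 0 (ins t [:: a; b]).2 1.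
Proof.
elim: t a b => [|r t IH] a b g ab; first by rewrite /= ab.
have [_ _] := good_step g; have /andP[/andP[sr _] u] := g; rewrite ins_cons /=.
move: u; rewrite /= inE !mem_cat !negb_or => /and3P[/and3P[nab ar _] /andP[br _] _].
have [s1 o1 e1] := insRP sr ar; case: (insR r a) s1 o1 e1 => r1 oa /= s1 o1 e1.
have br1 : b \notin r1 by rewrite e1 unfold_in /= negb_or eq_sym nab (negbTE br).
have ar1 : a \in r1 by rewrite e1 unfold_in /= eqxx.
have [s2 o2 e2] := insRP s1 br1; case: (insR r1 b) s2 o2 e2 => r2 ob /= s2 o2 e2.
case: oa ob o1 o2 e1 e2 => [p|] [q|] /= o1 o2 e1 e2 g'.
- have pq : q < p.
    have [rp ap hp] := o1; have [rq bq hq] := o2.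
    by move: (hq a) ab ap; rewrite ar1; clear; lia.
  by have := IH p q g' pq; rewrite /=; case: (row_insert t p) => t1 i /=; case: (row_insert t1 q) => t2 j /=; rewrite ?ltnS.
- by move: (o2 a) ab; rewrite ar1 /=; clear; lia.
- by case: (row_insert t q).
- by move: (o2 a) ab; rewrite ar1 /=; clear; lia.
Qed.

(** The final row and the bumped letters together rearrange the old row and the word, so the bumped
    letters determine the row as a set. *)
Lemma insrow_sorted_eq r t xs ys : good (r :: t) xs -> good (r :: t) ys -> perm_eq xs ys ->
  perm_eq (pmap id (insrow r xs).2) (pmap id (insrow r ys).2) ->
  (insrow r xs).1 = (insrow r ys).1.
Proof.
move=> /good_step[s1 p1 _] /good_step[s2 p2 _] pxy pos.
apply: (irr_sorted_eq ltn_trans ltnn) => //; apply: perm_mem.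
rewrite -(perm_cat2r (pmap id (insrow r ys).2)); apply: perm_trans (_ : perm_eq (xs ++ r) _).
  by apply: perm_trans p1; rewrite perm_cat2l perm_sym.
by rewrite perm_sym; apply: perm_trans p2 _; rewrite perm_cat2r perm_sym.
Qed.

Lemma good_perm t xs ys : perm_eq xs ys -> good t xs = good t ys.
Proof. by move=> p; rewrite /good; congr (_ && _); apply: perm_uniq; rewrite perm_cat2r. Qed.

Lemma perm3 a b c : (perm_eq [:: a; b; c] [:: a; c; b]) * (perm_eq [:: a; b; c] [:: b; a; c])
  * (perm_eq [:: a; b; c] [:: b; c; a]) * (perm_eq [:: a; b; c] [:: c; a; b]).
Proof. by do !split; apply/seq.permP => P /=; clear; lia. Qed.

(** The dual Knuth relation on the rows of three new boxes: in the cases of interest j <= i and j <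
    k, and the rows exchanged are those of the largest and smallest, the median staying next to
    them. *)
Definition swap_rows i j k := if i < k then [:: i; k; j] else [:: j; i; k].

Lemma ins_knuth_out r t xs ys : good (r :: t) xs -> good (r :: t) ys -> perm_eq xs ys ->
  knuth_out (insrow r xs).2 (insrow r ys).2 ->
  (forall x y z, x < y -> y < z -> good t [:: x; y; z] ->
    let f a b c := ins t [:: a; b; c] in
    exists i j k, [/\ (f x z y).2 = [:: i; j; k], (f z x y).2 = swap_rows i j k &
                    (f z x y).1 = (f x z y).1]) ->
  (forall x y z, x < y -> y < z -> good t [:: x; y; z] ->
    let f a b c := ins t [:: a; b; c] in
    exists i j k, [/\ (f y z x).2 = [:: i; j; k], (f y x z).2 = swap_rows i j k &
                    (f y x z).1 = (f y z x).1]) ->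
  exists i j k, [/\ (ins (r :: t) xs).2 = [:: i; j; k],
    (ins (r :: t) ys).2 = swap_rows i j k &
    (ins (r :: t) ys).1 = (ins (r :: t) xs).1].
Proof.
move=> gx gy pxy ko K1 K2; have [_ px gx'] := good_step gx; have [_ py gy'] := good_step gy.
have pos : perm_eq (pmap id (insrow r xs).2) (pmap id (insrow r ys).2).
  by case: ko => * /=; rewrite ?perm3 // perm_sym perm3.
have er := insrow_sorted_eq gx gy pxy pos.
rewrite !ins_cons; move: er gx' gy' ko.
case: (insrow r xs) => r1 os1 /=; case: (insrow r ys) => _ os2 /= <- g1 g2 ko.
have sw i j k : swap_rows i.+1 j.+1 k.+1 = map S (swap_rows i j k).
  by rewrite /swap_rows ltnS; case: ifP.
case: ko g1 g2 => [a b c ab bc|a b c ab bc|a b ab|a|a b ab] /= g1 g2.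
- have [|i [j [k []]]] := K1 a b c ab bc.
    by rewrite (good_perm _ (perm3 a b c).1.1.1).
  rewrite /= => -> -> ->; exists i.+1, j.+1, k.+1; split=> //.
  by rewrite sw /swap_rows; case: ifP.
- have [|i [j [k []]]] := K2 a b c ab bc.
    by rewrite (good_perm _ (perm3 a b c).1.2).
  rewrite /= => -> -> ->; exists i.+1, j.+1, k.+1; split=> //.
  by rewrite sw /swap_rows; case: ifP.
(* The middle letter stays at the end of the row, with new box in row 0, and the word passed on is
   unchanged. The row bumping lemma then tells which pair of rows is exchanged. *)
- have := ins2_lt g1 ab; rewrite /=; case: (row_insert t a) => t1 i /=.
  case: (row_insert t1 b) => t2 j /= ji; exists i.+1, 0, j.+1; split=> //.
  by rewrite /swap_rows ltnS ltnNge ji.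
- by case: (row_insert t a) => t1 i /=; exists 0, 0, i.+1.
- have := ins2_gt g1 ab; rewrite /=; case: (row_insert t b) => t1 i /=.
  case: (row_insert t1 a) => t2 j /= ij; exists i.+1, 0, j.+1; split=> //.
  by rewrite /swap_rows ltnS ij.
Qed.

(** Both kinds of Knuth moves are treated in one induction, since a move of the first kind on a row
    may become one of the second kind on the next row. *)
Lemma ins_knuth t x y z : x < y -> y < z -> good t [:: x; y; z] ->
  let f a b c := ins t [:: a; b; c] in
  (exists i j k, [/\ (f x z y).2 = [:: i; j; k], (f z x y).2 = swap_rows i j k &
                  (f z x y).1 = (f x z y).1]) /\
  (exists i j k, [/\ (f y z x).2 = [:: i; j; k], (f y x z).2 = swap_rows i j k &
                  (f y x z).1 = (f y z x).1]).
Proof.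
elim: t x y z => [|r t IH] x y z xy yz g f.
  have xz := ltn_trans xy yz.
  have E := (xy, yz, xz, ltnNge y x, ltnNge z y, ltnNge z x, ltnW xy, ltnW yz, ltnW xz).
  by split; rewrite /f /= ?E /= ?E /=; [exists 0, 0, 1 | exists 0, 0, 1].
have K1 a b c ab bc g' := proj1 (IH a b c ab bc g').
have K2 a b c ab bc g' := proj2 (IH a b c ab bc g').
have sr : sorted ltn r by case/andP: g => /andP[].
have ur : uniq ([:: x; y; z] ++ r).
  have : uniq (([:: x; y; z] ++ r) ++ flatten t) by rewrite -catA; case/andP: g.
  by rewrite cat_uniq => /andP[].
have [Sx Sy Sz] : [/\ ~~ mem r x, ~~ mem r y & ~~ mem r z].
  by move: ur; rewrite /= !inE !negb_or => /and4P[/and3P[_ _ ->] /andP[_ ->] -> _].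
have pu s : perm_eq [:: x; y; z] s -> uniq (s ++ r).
  by move=> p; rewrite -(@perm_uniq _ ([:: x; y; z] ++ r)) // perm_cat2r.
split; apply: ins_knuth_out K1 K2 => //.
- by rewrite -(good_perm _ (perm3 x y z).1.1.1).
- by rewrite -(good_perm _ (perm3 x y z).2).
- exact: (perm3 x z y).1.1.2.
- have [o1 [o2 [o3 [-> h]]]] := insrow_outs3 sr (pu _ (perm3 x y z).1.1.1).
  have [o1' [o2' [o3' [h' ko]]]] := outs3_xzy xy yz Sx Sy Sz h.
  have [p1 [p2 [p3 [-> h'']]]] := insrow_outs3 sr (pu _ (perm3 x y z).2).
  by rewrite (outs3_uniq h'' h').
- by rewrite -(good_perm _ (perm3 x y z).1.2).
- by rewrite -(good_perm _ (perm3 x y z).1.1.2).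
- exact: (perm3 y z x).1.1.1.
- have [o1 [o2 [o3 [-> h]]]] := insrow_outs3 sr (pu _ (perm3 x y z).1.2).
  have [o1' [o2' [o3' [h' ko]]]] := outs3_yzx xy yz Sx Sy Sz h.
  have [p1 [p2 [p3 [-> h'']]]] := insrow_outs3 sr (pu _ (perm3 x y z).1.1.2).
  by rewrite (outs3_uniq h'' h').
Qed.

End Insertion.

(** * Row reading words and the injectivity of insertion *)

Section RowWord.

Implicit Types (r : seq nat) (t : seq (seq nat)) (x y z a b c e : nat) (la : seq nat).

(** Each letter of [xs] replaces the entry of [ys] in the same column, and the surplus letters are
    appended; [s] is the part of the row already overwritten. *)
Lemma insrow_over s ys xs : size ys <= size xs -> sorted ltn (s ++ xs) -> sorted ltn (s ++ ys) ->
  (forall i, i < size ys -> nth 0 xs i < nth 0 ys i) ->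
  insrow (s ++ ys) xs = (s ++ xs, map Some ys ++ nseq (size xs - size ys) None).
Proof.
elim: xs s ys => [|x xs IH] s ys /=; first by case: ys.
move=> szle; rewrite !(sorted_pairwise ltn_trans) !pairwise_cat allrel_consr /=.
case/and4P=> /andP[/allP sx sxs] ps /allP xxs pxs.
case: ys szle => [|y ys] /= szle.
  move=> _ _; rewrite cats0.
  have -> : insR s x = (rcons s x, None).
    apply: insR_uniq; rewrite ?(sorted_pairwise ltn_trans) //.
    - by apply/negP=> /sx; rewrite ltnn.
    - by rewrite -cats1 pairwise_cat allrel1r ps /= !andbT; apply/allP.
    - by move=> e; apply/implyP/sx.
    - by move=> e; rewrite mem_rcons inE [RHS]unfold_in /= andbT.
  have := IH (rcons s x) [::] isT; rewrite cats0 => -> //=.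
  - by rewrite cat_rcons subn0.
  - rewrite cat_rcons (sorted_pairwise ltn_trans) pairwise_cat allrel_consr /= ps pxs sxs.
    by rewrite !andbT; apply/andP; split; apply/allP.
  - by rewrite (sorted_pairwise ltn_trans) -cats1 pairwise_cat allrel1r ps /= !andbT; apply/allP.
rewrite allrel_consr => /and4P[/andP[/allP sy sys] _ /allP yys pys] lt.
have xy : x < y := lt 0 isT.
have -> : insR (s ++ y :: ys) x = (rcons s x ++ ys, Some y).
  apply: insR_uniq.
  - rewrite (sorted_pairwise ltn_trans) pairwise_cat allrel_consr /= ps pys sys !andbT.
    by apply/andP; split; apply/allP.
  - rewrite mem_cat inE !negb_or; apply/and3P; split; first by apply/negP=> /sx; rewrite ltnn.
      by rewrite ltn_eqF.
    by apply/negP=> /yys; rewrite ltnNge ltnW.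
  - rewrite cat_rcons (sorted_pairwise ltn_trans) pairwise_cat allrel_consr /= ps pys sys !andbT.
    by apply/andP; split; apply/allP => // e /yys; apply: ltn_trans.
  - split; rewrite /= ?mem_cat ?mem_head ?orbT // => e; apply/implyP; rewrite mem_cat inE.
    by case/or3P=> [/sx->|/eqP->|/yys/ltnW->]; rewrite ?leqnn ?orbT.
  - move=> e; rewrite mem_cat mem_rcons inE [RHS]unfold_in /= mem_cat inE.
    have [->|ney] := eqVneq e y; last by rewrite andbT -orbA.
    have -> : (y \in s) = false by apply/negP => /sy; rewrite ltnn.
    have -> : (y \in ys) = false by apply/negP => /yys; rewrite ltnn.
    by rewrite andbF !orbF.
rewrite IH //; first by rewrite cat_rcons subSS.
- rewrite cat_rcons (sorted_pairwise ltn_trans) pairwise_cat allrel_consr /= ps pxs sxs.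
  by rewrite !andbT; apply/andP; split; apply/allP.
- rewrite cat_rcons (sorted_pairwise ltn_trans) pairwise_cat allrel_consr /= ps pys sys !andbT.
  by apply/andP; split; apply/allP => // e /yys; apply: ltn_trans.
- by move=> i; have := lt i.+1.
Qed.

(* The rows of the new boxes when the top row, respectively all the rows from
   bottom to top, of a tableau of shape la are inserted: the new boxes end in
   columns from left to right. *)
Fixpoint row_steps la : seq nat :=
  if la is l :: la' then map S (row_steps la') ++ nseq (l - head 0 la') 0 else [::].

Fixpoint word_steps la : seq nat :=
  if la is l :: la' then word_steps la' ++ row_steps la else [::].

Definition rowword t : seq nat := flatten (rev t).

Definition colrel (r1 r2 : seq nat) := all (fun c => nth 0 r1 c < nth 0 r2 c) (iota 0 (size r2)).

Definition tab t := [&& all (sorted ltn) t, sorted colrel t, sorted geq (shape t) & [::] \notin t].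

Lemma rowword_cons r t : rowword (r :: t) = rowword t ++ r.
Proof. by rewrite /rowword rev_cons flatten_rcons. Qed.

Lemma tab_cons r t : tab (r :: t) -> tab t.
Proof.
case/and4P=> /= /andP[_ s1] s2 s3; rewrite inE negb_or => /andP[_ n].
by rewrite /tab s1 (path_sorted s2) (path_sorted s3).
Qed.

Lemma size_row_steps la : sorted geq la -> size (row_steps la) = head 0 la.
Proof.
elim: la => //= l la IH s; rewrite size_cat size_map size_nseq IH ?(path_sorted s) //.
by case: la s {IH} => [|l' la] /=; [rewrite subn0|case/andP=> le _; rewrite subnKC].
Qed.

Lemma merge_rows_Some (r : seq nat) m s : size s = size r ->
  merge_rows (map Some r ++ nseq m None) s = map S s ++ nseq m 0.
Proof.
elim: r s => [|x r IH] [|i s] //=; last by case=> /IH->.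
by move=> _; elim: m => //= m ->.
Qed.

(** Inserting [r] bumps the whole first row of [t], which bumps the whole second row, and so on:
    every row moves down by one. *)
Lemma ins_row r t : tab (r :: t) -> ins t r = (r :: t, row_steps (shape (r :: t))).
Proof.
have pmN m : pmap id (nseq m None) = [::] :> seq nat by elim: m.
elim: t r => [|r' t IH] r tabt; have /and4P[/= /andP[sr st] sc ss] := tabt.
  rewrite inE eq_sym => nr; have [x [xs er]] : exists x xs, r = x :: xs.
    by case: (r) nr => // x xs _; exists x, xs.
  rewrite [in LHS]er ins_nil -er ins_cons -[X in insrow X _]/([::] ++ [::]) insrow_over //=.
  by rewrite !subn0 pmN /=; congr (_, _); elim: (size r) => //= m ->.
have {ss} /andP[sz _] := ss; have {sc} /andP[cr _] := sc => _.
rewrite ins_cons -[X in insrow X _]cat0s insrow_over //; last first.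
- by move=> i ir'; have /allP/(_ i) := cr; rewrite mem_iota => /(_ ir').
- by case/andP: st.
rewrite pmap_cat; have -> : pmap id [seq Some i | i <- r'] = r' by elim: (r') => //= a s ->.
rewrite pmN cats0 (IH r' (tab_cons tabt)) /=; congr (_, _).
apply: merge_rows_Some; rewrite -[X in size X = _]/(row_steps (shape (r' :: t))).
by rewrite size_row_steps //; case/and4P: (tab_cons tabt).
Qed.

Lemma ins_rowword t : tab t -> ins [::] (rowword t) = (t, word_steps (shape t)).
Proof.
elim: t => [//|r t IH] tabt; rewrite rowword_cons ins_cat (IH (tab_cons tabt)) /=.
by rewrite ins_row.
Qed.

Lemma insR_inj r1 r2 x1 x2 r p : sorted ltn r1 -> sorted ltn r2 -> x1 \notin r1 -> x2 \notin r2 ->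
  insR r1 x1 = (r, Some p) -> insR r2 x2 = (r, Some p) -> r1 = r2 /\ x1 = x2.
Proof.
move=> s1 s2 n1 n2 i1 i2; have := insRP s1 n1; have := insRP s2 n2; rewrite i1 i2 /=.
case=> sr [rp2 xp2 h2] e2 [_ [rp1 xp1 h1] e1].
have x1r : x1 \in r by rewrite e1 unfold_in /= eqxx.
have x2r : x2 \in r by rewrite e2 unfold_in /= eqxx.
have ex : x1 = x2.
  apply/eqP; move: x1r x2r; rewrite [in X in X -> _]e2 [in X in _ -> X -> _]e1 !unfold_in /=.
  have [//|ne] := eqVneq x1 x2; rewrite /= => /andP[a1 _] /andP[a2 _].
  move: (h2 x1) (h1 x2); rewrite a1 a2 /= => b1 b2.
  by move: b1 b2 xp1 xp2 ne; clear; lia.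
split=> //; apply: (irr_sorted_eq ltn_trans ltnn) => // e.
have : upd (mem r2) x2 (Some p) e = upd (mem r1) x1 (Some p) e by rewrite -[LHS]e2 -[RHS]e1.
rewrite /upd /= ex.
have [->|nex] := eqVneq e p; first by rewrite rp1 rp2.
rewrite !andbT; have [-> _|//] := eqVneq e x2.
by rewrite (negbTE n2) -ex (negbTE n1).
Qed.

Lemma insR_None r x r' : insR r x = (r', None) -> r' = rcons r x.
Proof. by rewrite /insR; case: ifP => // _ []. Qed.

Lemma insR_neq0 r x : (insR r x).1 != [::].
Proof.
rewrite /insR; case: ifP => _ /=; rewrite -size_eq0 ?size_rcons // size_set_nth.
by rewrite -lt0n leq_max.
Qed.

(** Reverse bumping: in the row of the new box the last letter was appended; in a row above it, the
    bumped letter, recovered from the rows below, determines the letter that replaced it. *)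
Lemma row_insert_inj t1 t2 x1 x2 : good t1 [:: x1] -> good t2 [:: x2] ->
  [::] \notin t1 -> [::] \notin t2 -> row_insert t1 x1 = row_insert t2 x2 ->
  t1 = t2 /\ x1 = x2.
Proof.
elim: t1 t2 x1 x2 => [|r1 t1 IH] [|r2 t2] x1 x2 g1 g2; rewrite ?inE ?negb_or.
- by move=> _ _ [].
- move=> _ /andP[n2 _]; rewrite row_insert_cons; case e: (insR r2 x2) => [r [p|]] //= [er].
  by move: n2; have := congr1 size (insR_None e); rewrite -er size_rcons => -[]; case: (r2).
- move=> /andP[n1 _] _; rewrite row_insert_cons; case e: (insR r1 x1) => [r [p|]] //= [er].
  by move: n1; have := congr1 size (insR_None e); rewrite er size_rcons => -[]; case: (r1).
move=> /andP[_ n1] /andP[_ n2]; rewrite !row_insert_cons.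
have [s1 x1r] : sorted ltn r1 /\ x1 \notin r1.
  by case/andP: g1 => /andP[-> _] /=; rewrite mem_cat negb_or => /andP[/andP[-> _] _].
have [s2 x2r] : sorted ltn r2 /\ x2 \notin r2.
  by case/andP: g2 => /andP[-> _] /=; rewrite mem_cat negb_or => /andP[/andP[-> _] _].
have [_ _] := good_step g1; have [_ _] := good_step g2; rewrite /=.
case e1: (insR r1 x1) => [r1' [p1|]]; case e2: (insR r2 x2) => [r2' [p2|]] //= g2' g1'; last first.
  case=> er ->; move: er; rewrite (insR_None e1) (insR_None e2).
  by move=> /rcons_inj[-> ->].
case=> er et ei; have [-> ep] : t1 = t2 /\ p1 = p2.
  by apply: IH => //; rewrite [LHS]surjective_pairing et ei -surjective_pairing.
rewrite er ep in e1.
by have [-> ->] := insR_inj s1 s2 x1r x2r e1 e2.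
Qed.

Lemma row_insert_perm t x : good t [:: x] -> all (sorted ltn) (row_insert t x).1 /\
  perm_eq (flatten (row_insert t x).1) (x :: flatten t).
Proof.
elim: t x => [//|r t IH] x g; have [] := good_step g; rewrite row_insert_cons /=.
have st : all (sorted ltn) t by case/andP: g => /andP[].
case: (insR r x) => r' [p|] /= s1 p1 g'; last first.
  by rewrite s1 st; split=> //; rewrite -cat_cons perm_cat2r -[r']cats0.
have [s2 p2] := IH p g'; rewrite s1 s2; split=> //.
apply: perm_trans (_ : perm_eq (r' ++ (p :: flatten t)) _); first by rewrite perm_cat2l.
by rewrite -[p :: _]/([:: p] ++ flatten t) catA -cat_cons perm_cat2r.
Qed.

Lemma row_insert_good t x xs : good t (x :: xs) -> [::] \notin t ->
  good (row_insert t x).1 xs /\ [::] \notin (row_insert t x).1.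
Proof.
move=> g n; have g1 : good t [:: x].
  move: g; rewrite /good /= => /andP[-> /andP[]].
  by rewrite mem_cat negb_or cat_uniq => /andP[_ ->] /and3P[_ _ ->].
have [s1 p1] := row_insert_perm g1; rewrite /good s1; split.
  have p2 : perm_eq (xs ++ flatten (row_insert t x).1) (x :: xs ++ flatten t).
    apply: perm_trans (_ : perm_eq (xs ++ x :: flatten t) _); first by rewrite perm_cat2l.
    by rewrite -[x :: flatten t]/([:: x] ++ flatten t) perm_catCA.
  by rewrite (perm_uniq p2); case/andP: g.
elim: t x n {g g1 s1 p1} => [//|r t IH] x; rewrite inE negb_or => /andP[_ n].
rewrite row_insert_cons; have := insR_neq0 r x; case: (insR r x) => r' [p|] /=.
  by rewrite inE negb_or eq_sym => ->; exact: IH.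
by rewrite inE negb_or eq_sym n => ->.
Qed.

(** The injectivity half of the RSK correspondence: the insertions are undone from the last to the
    first. *)
Lemma ins_inj t t' xs ys : size xs = size ys -> good t xs -> good t' ys ->
  [::] \notin t -> [::] \notin t' -> ins t xs = ins t' ys -> t = t' /\ xs = ys.
Proof.
elim: xs ys t t' => [|x xs IH] [|y ys] t t' //=; first by move=> _ _ _ _ _ [].
case=> sz g g' n n'; have [g1 n1] := row_insert_good g n; have [g1' n1'] := row_insert_good g' n'.
case e : (row_insert t x) g1 n1 => [t1 i] /= g1 n1.
case e' : (row_insert t' y) g1' n1' => [t1' i'] /= g1' n1'.
case ei : (ins t1 xs) => [u is_]; case ei' : (ins t1' ys) => [u' is'] [eu eii eis].
have [et exs] : t1 = t1' /\ xs = ys by apply: IH; rewrite // ei ei' eu eis.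
have [-> ->] : t = t' /\ x = y.
  apply: row_insert_inj => //; last by rewrite e e' et eii.
  - by move: g; rewrite /good /= => /andP[-> /andP[]]; rewrite mem_cat negb_or cat_uniq => /andP[_ ->] /and3P[_ _ ->].
  - by move: g'; rewrite /good /= => /andP[-> /andP[]]; rewrite mem_cat negb_or cat_uniq => /andP[_ ->] /and3P[_ _ ->].
by rewrite exs.
Qed.

End RowWord.

(** * Recording tableaux and Yamanouchi words *)

Section Recording.

Implicit Types (t q : seq (seq nat)) (ys zs la : seq nat) (i j k r : nat).

(** [sumn (shape q)] is the number of boxes so far, hence the next entry when counting from 0. *)
Definition record q i := set_nth [::] q i (rcons (nth [::] q i) (sumn (shape q))).

Definition recording ys := foldl record [::] ys.

Lemma RSK_foldl p q xs :
  foldl RSK_step (p, q) xs = ((ins p xs).1, foldl record q (ins p xs).2).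
Proof.
elim: xs p q => //= x xs IH p q.
by case: row_insert => p1 i; rewrite IH; case: (ins p1 xs).
Qed.

Lemma sumn_shape_record q i : sumn (shape (record q i)) = (sumn (shape q)).+1.
Proof.
have -> : shape (record q i) = set_nth 0 (shape q) i (nth 0 (shape q) i).+1.
  rewrite /record; move: (sumn (shape q)) => m.
  elim: q i => [|r q IH] [|i] //=; rewrite ?size_rcons //; last by rewrite -IH.
  by elim: i => //= i [->].
rewrite sumn_set_nth; case: ltnP => h; first by rewrite muln1 mul0n addn0 addnS -addSn addnK.
by rewrite nth_default // muln0 mul0n addn0 subn0 addn1.
Qed.

Lemma recording_rcons ys i : recording (rcons ys i) = record (recording ys) i.
Proof. by rewrite /recording -cats1 foldl_cat. Qed.

Lemma sumn_shape_recording ys : sumn (shape (recording ys)) = size ys.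
Proof.
elim/last_ind: ys => // ys i IH.
by rewrite recording_rcons sumn_shape_record IH size_rcons.
Qed.

Lemma nth_recording ys r :
  nth [::] (recording ys) r = [seq j <- iota 0 (size ys) | nth 0 ys j == r].
Proof.
elim/last_ind: ys => [|ys i IH]; first by rewrite nth_nil.
rewrite recording_rcons /record nth_set_nth /= size_rcons -addn1 iotaD filter_cat /= add0n.
rewrite nth_rcons ltnn eqxx sumn_shape_recording eq_sym.
have -> : [seq j <- iota 0 (size ys) | nth 0 (rcons ys i) j == r] =
          [seq j <- iota 0 (size ys) | nth 0 ys j == r].
  by apply: eq_in_filter => j; rewrite mem_iota /= nth_rcons => ->.
by rewrite -IH; case: eqVneq => [->|_]; rewrite ?cats1 ?cats0.
Qed.

Lemma size_recording ys k : (size (recording ys) <= k) = all (fun y => y < k) ys.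
Proof.
elim/last_ind: ys => // ys i IH.
by rewrite recording_rcons /record size_set_nth geq_max IH all_rcons.
Qed.

Lemma recording_inj ys zs : size ys = size zs -> recording ys = recording zs -> ys = zs.
Proof.
move=> sz e; apply: (@eq_from_nth _ 0) => // j jlt.
have : j \in nth [::] (recording zs) (nth 0 ys j).
  by rewrite -e nth_recording mem_filter eqxx mem_iota.
by rewrite nth_recording mem_filter => /andP[/eqP->].
Qed.

(* The Yamanouchi word of a tableau. *)
Definition yam (n : nat) t := [seq row_of t j | j <- iota 0 n].

Lemma row_ofE t r j : uniq (flatten t) -> r < size t -> j \in nth [::] t r -> row_of t j = r.
Proof.
rewrite /row_of; elim: t r => // s t IH [|r] /=; first by move=> _ _ ->.
rewrite cat_uniq => /and3P[_ /hasPn h u] lt jr.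
have -> : (j \in s) = false.
  by apply/negbTE/h/flattenP; exists (nth [::] t r) => //; rewrite mem_nth.
by rewrite (IH r).
Qed.

Lemma row_of_lt t j : j \in flatten t -> row_of t j < size t /\ j \in nth [::] t (row_of t j).
Proof.
move=> /flattenP[s st js]; have h : has (fun r : seq nat => j \in r) t by apply/hasP; exists s.
by rewrite -has_find; split=> //; apply: (nth_find [::] h).
Qed.

Section Syt.

Variables (n : nat) (la : seq nat) (t : seq (seq nat)).
Hypotheses (la_n : is_partition n la) (syt_t : is_syt n la t).

Lemma syt_shape : shape t = la.
Proof. by case/and4P: syt_t => /eqP. Qed.

Lemma syt_perm : perm_eq (flatten t) (iota 0 n).
Proof. by case/and4P: syt_t. Qed.

Lemma syt_uniq : uniq (flatten t).
Proof. by rewrite (perm_uniq syt_perm) iota_uniq. Qed.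

Lemma syt_mem j : (j \in flatten t) = (j < n).
Proof. by rewrite (perm_mem syt_perm) mem_iota. Qed.

Lemma syt_sorted r : sorted ltn (nth [::] t r).
Proof.
case/and4P: syt_t => _ _ /allP s _; have [lt|ge] := ltnP r (size t); last by rewrite nth_default.
by apply: s; rewrite mem_nth.
Qed.

Lemma syt_tab : tab t.
Proof.
case/and4P: syt_t => /eqP sh _ s1 s2; rewrite /tab s1 s2 sh.
case/and3P: la_n => -> n0 _ /=; apply: contra n0 => h.
by rewrite -sh; apply/mapP; exists [::].
Qed.

Lemma syt_size r : size (nth [::] t r) = nth 0 la r.
Proof.
rewrite -syt_shape; have [lt|ge] := ltnP r (size t); first by rewrite (nth_map [::]).
by rewrite !nth_default ?size_map.
Qed.

Lemma syt_row_of j r : (j \in nth [::] t r) = (j < n) && (row_of t j == r).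
Proof.
apply/idP/andP=> [jr|[jn /eqP <-]]; last by have := row_of_lt; move=> /(_ t j); rewrite syt_mem => /(_ jn)[].
have lt : r < size t by rewrite ltnNge; apply: contraTN jr => ge; rewrite nth_default.
rewrite (row_ofE syt_uniq lt jr) eqxx -syt_mem; split=> //.
by apply/flattenP; exists (nth [::] t r) => //; rewrite mem_nth.
Qed.

Lemma recording_yam : recording (yam n t) = t.
Proof.
have sz : size (recording (yam n t)) = size t.
  apply/eqP; rewrite eqn_leq size_recording; apply/andP; split.
    apply/allP => y /mapP[j]; rewrite mem_iota -syt_mem => jt ->.
    by case: (row_of_lt jt).
  rewrite leqNgt; apply/negP => lt; set m := size _ in lt.
  have /and4P[_ _ _ ne] := syt_tab.
  have : nth [::] t m != [::] by apply: contra ne => /eqP <-; rewrite mem_nth.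
  case e : (nth [::] t m) => [//|j s] _.
  have : j \in nth [::] t m by rewrite e mem_head.
  rewrite syt_row_of => /andP[jn /eqP rj].
  have := size_recording (yam n t) m; rewrite leqnn => /esym/allP h.
  have /h : row_of t j \in yam n t by rewrite map_f // mem_iota.
  by rewrite rj ltnn.
apply: (@eq_from_nth _ [::]) => // r _.
rewrite nth_recording size_map size_iota; apply: (irr_sorted_eq ltn_trans ltnn).
- exact: (sorted_filter ltn_trans _ (iota_ltn_sorted _ _)).
- exact: syt_sorted.
move=> j; rewrite mem_filter mem_iota syt_row_of andbC add0n /=.
by case: ltnP => //= jn; rewrite (nth_map 0) ?size_iota // nth_iota.
Qed.

End Syt.

(** Lattice (Yamanouchi) words: the content of every prefix is a partition. *)
Definition lattice ys := forall k r, count_mem r.+1 (take k ys) <= count_mem r (take k ys).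

Lemma lattice_take ys k : lattice ys -> lattice (take k ys).
Proof. by move=> l j r; rewrite -take_min; apply: l. Qed.

Lemma lattice_rcons ys y : lattice (rcons ys y) <->
  lattice ys /\ forall r, count_mem r.+1 (rcons ys y) <= count_mem r (rcons ys y).
Proof.
split=> [l|[l h] k r].
  split=> [|r]; last by have := l (size (rcons ys y)) r; rewrite take_size.
  by have := @lattice_take _ (size ys) l; rewrite -cats1 take_size_cat.
have [lt|ge] := leqP k (size ys); first by rewrite -cats1 takel_cat //; apply: l.
by rewrite take_oversize ?size_rcons //; apply: h.
Qed.

Lemma lattice_nseq ys y m : lattice ys -> 
  (forall r, count_mem r.+1 ys + (y == r.+1) * m <= count_mem r ys) -> lattice (ys ++ nseq m y).
Proof.
move=> l h; elim: m h => [|m IH] h; first by rewrite cats0.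
rewrite -[m.+1]addn1 nseqD /= catA cats1; apply/lattice_rcons; split.
  by apply: IH => r; apply: leq_trans (h r); rewrite leq_add2l leq_mul2l leqnSn orbT.
move=> r; have := h r; rewrite -!cats1 !count_cat !count_nseq /= !addn0 mulnS.
by case: eqP; case: eqP => /=; lia.
Qed.

(* Only one of the two families of Knuth relations is needed. *)
Inductive dualK : seq nat -> seq nat -> Prop :=
| dualK_refl ys : dualK ys ys
| dualK_trans zs ys xs : dualK ys zs -> dualK zs xs -> dualK ys xs
| dualK_sym ys zs : dualK ys zs -> dualK zs ys
| dualK_step A B i j k of j <= i & i < k : dualK (A ++ [:: i; j; k] ++ B) (A ++ [:: i; k; j] ++ B).

Lemma dualK_rcons ys zs y : dualK ys zs -> dualK (rcons ys y) (rcons zs y).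
Proof.
elim=> {ys zs} [ys|zs ys xs _ h1 _ h2|ys zs _ h|A B i j k ji ik].
- exact: dualK_refl.
- exact: dualK_trans h1 h2.
- exact: dualK_sym.
- by rewrite -!cats1 -!catA; apply: dualK_step.
Qed.

(** The word 0...0 1...1 2...2 ... that fills the rows one after the other. *)
Lemma lattice_exists (f : nat -> nat) m : (forall r, f r.+1 <= f r) ->
  exists ys, lattice ys /\ forall r, count_mem r ys = (r < m) * f r.
Proof.
move=> fd; elim: m => [|m [ys [l c]]]; first by exists [::].
exists (ys ++ nseq (f m) m); split.
  apply: lattice_nseq => // r; rewrite !c; have := fd r.
  by case: (ltngtP m r.+1) => [h|h|->]; rewrite /= ?ltnSn ?ltnn; [have : r < m = false by lia|have : r < m by lia|]; move=> *; nia.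
move=> r; rewrite count_cat c count_nseq /= eq_sym ltnS [r <= m]leq_eqVlt.
by case: eqVneq => [->|_]; rewrite ?ltnn /= ?mul0n ?addn0.
Qed.

Lemma count_rcons1 ys y r : count_mem r (rcons ys y) = count_mem r ys + (y == r).
Proof. by rewrite -cats1 count_cat /= addn0. Qed.

(** Induction on the length. Words with the same last letter are handled by their prefixes. If the
    last letters are a < c.+1, the induction hypothesis brings the words to the forms u c (c+1) a
    and u c a (c+1), with u a lattice word, and these differ by one move. *)
Lemma dualK_lattice ys zs : lattice ys -> lattice zs -> perm_eq ys zs -> dualK ys zs.
Proof.
have [N] := ubnP (size ys); elim: N ys zs => // N IH ys zs.
case/lastP: ys => [|ys a] ltN ly lz p.
  by rewrite perm_sym in p; rewrite (perm_small_eq _ p) //; exact: dualK_refl.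
case/lastP: zs lz p => [|zs b] lz p.
  by have := perm_size p; rewrite size_rcons.
wlog ab : ys zs a b ly lz p ltN / a <= b.
  move=> W; case: (leqP a b) => [|/ltnW] h; first exact: W.
  apply/dualK_sym/W => //; first by rewrite perm_sym.
  by rewrite -(perm_size p).
have [ly' cy] := (lattice_rcons ys a).1 ly; have [lz' cz] := (lattice_rcons zs b).1 lz.
move: ltN; rewrite size_rcons ltnS => ltN.
have szy : size zs = size ys by have := perm_size p; rewrite !size_rcons => -[].
have [eab|nab] := eqVneq a b.
  rewrite -eab in p *; apply/dualK_rcons/IH => //.
  by rewrite -(perm_cons a) -(perm_rcons a ys) perm_sym -(perm_rcons a zs) perm_sym.
have {ab nab} ab : a < b by rewrite ltn_neqAle nab.
have pc r : count_mem r ys + (a == r) = count_mem r zs + (b == r).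
  by rewrite -!count_rcons1; move/seq.permP: p => ->.
have yd r : count_mem r.+1 ys <= count_mem r ys by have := ly' (size ys) r; rewrite take_size.
have zd r : count_mem r.+1 zs <= count_mem r zs by have := lz' (size zs) r; rewrite take_size.
have [c eb] : exists c, b = c.+1 by exists b.-1; rewrite prednK // (leq_ltn_trans _ ab).
(* The content of u: the common content without a (already absent from [ys]), c and c.+1. It is a
   partition because [ys] and [zs] are both lattice words. *)
subst b; pose f r := count_mem r ys - (c.+1 == r) - (c == r).
have ac : a <= c by rewrite -ltnS.
have yb : 0 < count_mem c.+1 ys.
  by have := pc c.+1; rewrite eqxx (ltn_eqF ab) addn0 addn1 => ->.
have yc : count_mem c.+1 ys <= count_mem c ys := yd c.
have Ec := (eqxx, ltn_eqF (ltnSn c), gtn_eqF (ltnSn c), ltn_eqF (leqnSn c.+1), ltn_eqF ab).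
have fd r : f r.+1 <= f r.
  rewrite /f; have [<-|n1] := eqVneq c.+1 r.
    move: (zd c.+1) (pc c.+1) (pc c.+2) yb; rewrite !Ec (ltn_eqF (leqW ab)) (ltn_eqF (ltnSn c.+1)).
    by rewrite ?addn0 ?subn0 addn1 => h -> -> _; rewrite subn1.
  have [<-|n2] := eqVneq c r.
    by rewrite !Ec !subn0; apply: leq_sub.
  by rewrite !subn0 (leq_trans _ (yd r)) // (leq_trans (leq_subr _ _)) ?leq_subr.
have fE r : f r + (c == r) + (c.+1 == r) = count_mem r ys.
  rewrite /f; have [<-|n1] := eqVneq c.+1 r; first by rewrite !Ec !subn0 addn0 subnK.
  have [<-|n2] := eqVneq c r; last by rewrite !subn0 !addn0.
  by rewrite subn0 addn0 subnK // (leq_trans yb).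
pose m := (\max_(y <- ys) y).+1.
have fm r : m <= r -> f r = 0.
  move=> mr; have : count_mem r ys = 0; last by rewrite /f => ->.
  apply/count_memPn/negP => ry; move: mr; rewrite leqNgt ltnS => /negP; apply.
  exact: (@leq_bigmax_seq _ ys xpredT id r ry isT).
have [u [lu cu]] := lattice_exists m fd.
have {}cu r : count_mem r u = f r.
  by rewrite cu; case: ltnP => [_|/fm->]; rewrite ?mul1n.
have luc : lattice (rcons u c).
  apply/lattice_rcons; split=> // r; rewrite !count_rcons1 !cu.
  have kE i : f i + (c == i) = count_mem i ys - (c.+1 == i) by rewrite -fE addnK.
  rewrite !kE; have [<-|n1] := eqVneq c.+1 r; last first.
    by rewrite subn0 (leq_trans _ (yd r)) // leq_subr.
  move: (zd c.+1) (pc c.+1) (pc c.+2) yb; rewrite !Ec (ltn_eqF (leqW ab)) (ltn_eqF (ltnSn c.+1)).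
  by rewrite ?addn0 ?subn0 addn1 => h -> -> _; rewrite subn1.
have perm_u y xs : (forall r, f r + (c == r) + (y == r) = count_mem r xs) ->
    perm_eq xs (rcons (rcons u c) y).
  move=> h; apply/allP => r _; rewrite /= !count_rcons1 cu; apply/eqP.
  by rewrite -h.
have p1 : perm_eq ys (rcons (rcons u c) c.+1) by apply: perm_u.
have p2 : perm_eq zs (rcons (rcons u c) a).
  by apply: perm_u => r; move: (fE r) (pc r); clear; lia.
have l1 : lattice (rcons (rcons u c) c.+1).
  by apply/lattice_rcons; split=> // r; have /seq.permP e := p1; rewrite -!e.
have l2 : lattice (rcons (rcons u c) a).
  by apply/lattice_rcons; split=> // r; have /seq.permP e := p2; rewrite -!e.
apply: dualK_trans (dualK_rcons a (IH _ _ ltN ly' l1 p1)) _.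
rewrite -szy in ltN; apply: dualK_trans (dualK_sym (dualK_rcons c.+1 (IH _ _ ltN lz' l2 p2))).
(* The move applies to the triple c, a, c.+1 because a <= c < c.+1. *)
have := @dualK_step u [::] c a c.+1 ac (ltnSn c); rewrite -!cats1 -!catA /=.
exact: dualK_sym.
Qed.

Section SytLattice.

Variables (n : nat) (la : seq nat) (t : seq (seq nat)).
Hypotheses (la_n : is_partition n la) (syt_t : is_syt n la t).

Lemma count_yam k r : k <= n ->
  count_mem r (take k (yam n t)) = count (fun j => j < k) (nth [::] t r).
Proof.
move=> kn; rewrite -map_take take_iota (minn_idPl kn) count_map -!size_filter.
apply/perm_size/uniq_perm; rewrite ?filter_uniq ?iota_uniq //.
  exact: (sorted_uniq ltn_trans ltnn (syt_sorted syt_t r)).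
move=> j; rewrite !mem_filter mem_iota (syt_row_of syt_t) /= add0n andbC.
by case: ltnP => //= jk; rewrite (leq_trans jk kn).
Qed.

Lemma count_colrel (r1 r2 : seq nat) k : size r2 <= size r1 ->
  (forall c, c < size r2 -> nth 0 r1 c < nth 0 r2 c) ->
  count (fun j => j < k) r2 <= count (fun j => j < k) r1.
Proof.
elim: r2 r1 => [|y r2 IH] [|x r1] //=; rewrite ltnS => sz h; apply: leq_add.
  by have := h 0 isT; rewrite /=; case: (ltnP y k) => // yk xy; rewrite (ltn_trans xy yk).
by apply: IH => // c cr; exact: (h c.+1).
Qed.

(** The entries below k in two consecutive rows are compared column by column. *)
Lemma lattice_yam : lattice (yam n t).
Proof.
move=> k r; wlog kn : k / k <= n.
  move=> W; case: (leqP k n) => [|/ltnW h]; first exact: W.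
  by have := W n (leqnn n); rewrite !take_oversize ?size_map ?size_iota.
rewrite !count_yam //; have /and4P[_ sc ss _] := syt_tab la_n syt_t.
have [lt|ge] := ltnP r.+1 (size t); last by rewrite (nth_default _ ge).
apply: count_colrel.
  move/(sortedP 0)/(_ r): ss; rewrite size_map => /(_ lt).
  by rewrite !(nth_map [::]) // ltnW.
move=> c lc; move/(sortedP [::])/(_ r lt)/allP: sc => /(_ c).
by rewrite mem_iota lc => /(_ isT).
Qed.

Lemma count_yam_all r : count_mem r (yam n t) = nth 0 la r.
Proof.
have := @count_yam n r (leqnn n); rewrite take_oversize ?size_map ?size_iota // => ->.
rewrite -(syt_size syt_t r); apply/eqP; rewrite -all_count; apply/allP => j.
by rewrite (syt_row_of syt_t) => /andP[].
Qed.

End SytLattice.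

Lemma count_row_steps la r : sorted geq la ->
  count_mem r (row_steps la) + nth 0 la r.+1 = nth 0 la r.
Proof.
elim: la r => [|l la IH] r s /=; first by rewrite !nth_nil.
have sl := path_sorted s; rewrite count_cat count_nseq count_map.
have hd : head 0 la <= l by case: (la) s => //= ? ? /andP[].
case: r => [|r] /=.
  by rewrite (@eq_count _ _ pred0) // count_pred0 mul1n add0n -nth0 subnK.
by rewrite mul0n addn0; exact: IH.
Qed.

Lemma count_word_steps la r : sorted geq la -> count_mem r (word_steps la) = nth 0 la r.
Proof.
elim: la r => [|l la IH] r s; first by rewrite nth_nil.
rewrite /= -[map S _ ++ _]/(row_steps (l :: la)) count_cat IH ?(path_sorted s) //.
by have := count_row_steps r s; rewrite /= addnC.
Qed.

Lemma size_word_steps la : sorted geq la -> size (word_steps la) = sumn la.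
Proof.
elim: la => //= l la IH s; rewrite size_cat (IH (path_sorted s)) addnC.
by have := size_row_steps (la := l :: la) s; rewrite /= => ->.
Qed.

(** While the last row is inserted, all steps into row r.+1 together only bring it to the length
    that row r had before. *)
Lemma lattice_word_steps la : sorted geq la -> lattice (word_steps la).
Proof.
elim: la => [//|l la IH] s k r; have sl := path_sorted s.
rewrite [word_steps _]/= -[map S _ ++ _]/(row_steps (l :: la)) take_cat; case: ifP => _; first exact: IH.
set m := k - _; rewrite !count_cat !count_word_steps //.
have := count_row_steps r.+1 s; rewrite /=; move=> e.
have le : count_mem r.+1 (take m (row_steps (l :: la))) <= count_mem r.+1 (row_steps (l :: la)).
  by rewrite -[X in _ <= count_mem _ X](cat_take_drop m) count_cat leq_addr.
by apply: leq_trans (leq_addr _ _); rewrite -e addnC leq_add2r.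
Qed.

Lemma dualK_yam n la t : is_partition n la -> is_syt n la t -> dualK (word_steps la) (yam n t).
Proof.
move=> la_n st; have sl : sorted geq la by case/and3P: la_n.
apply: dualK_lattice; [exact: lattice_word_steps|exact: lattice_yam st|].
apply/allP => r _ /=; apply/eqP.
by rewrite count_word_steps // (count_yam_all st).
Qed.

End Recording.

Local Open Scope ring_scope.

(** * Bruhat order *)

Section Coxeter.

Variable n : nat.
Implicit Types (u v w x y z : 'S_n) (i j k a b : 'I_n).

Lemma tperm_ltE i k a b : k = i.+1 :> nat -> ~~ ((a == i) && (b == k)) ->
  ~~ ((a == k) && (b == i)) -> (tperm i k a < tperm i k b)%N = (a < b)%N.
Proof.
rewrite !permE /= -!val_eqE /= => ik.
by case: (eqVneq (a : nat) i) => ?; case: (eqVneq (a : nat) k) => ?;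
  case: (eqVneq (b : nat) i) => ?; case: (eqVneq (b : nat) k) => ?; lia.
Qed.

Lemma eq_permV w i k : (i == w^-1%g k) = (w i == k).
Proof. by rewrite -[in LHS](inj_eq (@perm_inj _ w)) permKV. Qed.

Lemma len_mul_simple w i k : k = i.+1 :> nat ->
  (w^-1%g i < w^-1%g k)%N -> len (w * tperm i k)%g = (len w).+1.
Proof.
move=> ik lt_ik; rewrite /len.
rewrite (_ : [set _ | _] = (w^-1%g i, w^-1%g k) |:
   [set ij : 'I_n * 'I_n | (ij.1 < ij.2)%N && (w ij.2 < w ij.1)%N]); last first.
  apply/setP=> -[a b]; rewrite !inE /= xpair_eqE !permM.
  rewrite !eq_permV.
  have [/andP[/eqP ai /eqP bk]|n1] := boolP ((w a == i) && (w b == k)).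
    by rewrite ai bk tpermL tpermR -ai -bk !permK in lt_ik *; rewrite lt_ik ai bk; lia.
  have [/andP[/eqP ak /eqP bi]|n2] := boolP ((w a == k) && (w b == i)).
    rewrite ak bi tpermL tpermR -ak -bi !permK in lt_ik *.
    by rewrite (ltnNge a) (ltnW lt_ik).
  by rewrite (tperm_ltE ik) // andbC.
by rewrite cardsU1 inE /= !permKV ik [(i.+1 < i)%N]ltnNge leqnSn andbF /= add1n.
Qed.

Lemma len_mul_simpleN w i k : k = i.+1 :> nat ->
  (w^-1%g k < w^-1%g i)%N -> len w = (len (w * tperm i k)%g).+1.
Proof.
move=> ik lt_ki; rewrite -(len_mul_simple ik); first by rewrite -mulgA tperm2 mulg1.
by rewrite invMg tpermV !permM tpermL tpermR.
Qed.

Lemma ltn_permV w i k : i != k -> (w^-1%g k < w^-1%g i)%N = ~~ (w^-1%g i < w^-1%g k)%N.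
Proof.
move=> ik; rewrite -leqNgt ltn_neqAle val_eqE (inj_eq perm_inj) eq_sym.
by rewrite ik.
Qed.

(** Right multiplication acts on values: a right descent at i means that i.+1 stands to the left of
    i in the word of [w]. This is the form in which descents of tableaux appear. *)
Lemma des_simple w i k : k = i.+1 :> nat ->
  (len (w * tperm i k)%g < len w)%N = (w^-1%g k < w^-1%g i)%N.
Proof.
move=> ik; have neq : i != k by rewrite -val_eqE /= ik; lia.
rewrite ltn_permV //.
have [lt|] := boolP (w^-1%g i < w^-1%g k)%N; first by rewrite (len_mul_simple ik) //; lia.
by rewrite -ltn_permV // => /(len_mul_simpleN ik) e; rewrite [X in (_ < X)%N]e leqnn.
Qed.

Lemma len_inv w : len w^-1%g = len w.
Proof.
pose f (p : 'I_n * 'I_n) := (w p.2, w p.1).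
have f_inj : injective f by move=> [a b] [c d] [/perm_inj-> /perm_inj->].
rewrite /len -[RHS](card_imset _ f_inj); apply: eq_card => -[a b].
rewrite inE /=; apply/andP/imsetP => [[ab ba]|[[c d]]].
  by exists (w^-1%g b, w^-1%g a); rewrite ?inE /f /= !permKV ?ba.
by rewrite inE /= => /andP[cd dc] [-> ->]; rewrite !permK.
Qed.

Lemma len1 : len (1 : 'S_n)%g = 0%N.
Proof.
apply/eqP; rewrite cards_eq0; apply/eqP/setP=> -[a b].
by rewrite !inE /= !perm1; lia.
Qed.

Lemma simpleP s : reflect (exists i k, k = i.+1 :> nat /\ s = tperm i k) (@is_simple n s).
Proof.
apply: (iffP existsP) => [[i /existsP[k /andP[/eqP ik /eqP ->]]]|[i [k [ik ->]]]].
  by exists i, k.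
by exists i; apply/existsP; exists k; rewrite ik !eqxx.
Qed.

Lemma simple2 s : is_simple s -> (s * s = 1 :> 'S_n)%g.
Proof. by case/simpleP=> i [k [_ ->]]; exact: tperm2. Qed.

Lemma simpleV s : is_simple s -> (s^-1 = s :> 'S_n)%g.
Proof. by case/simpleP=> i [k [_ ->]]; exact: tpermV. Qed.

Lemma simpleK w s : is_simple s -> (w * s * s = w)%g.
Proof. by move=> ss; rewrite -mulgA simple2 ?mulg1. Qed.

Definition des w s := (len (w * s)%g < len w)%N.

Lemma len_desN w s : is_simple s -> ~~ des w s -> len (w * s)%g = (len w).+1.
Proof.
case/simpleP=> i [k [ik ->]]; rewrite /des des_simple // ltn_permV ?negbK.
  exact: len_mul_simple.
by rewrite -val_eqE /= ik; lia.
Qed.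

Lemma len_des w s : is_simple s -> des w s -> len w = (len (w * s)%g).+1.
Proof.
case/simpleP=> i [k [ik ->]]; rewrite /des des_simple // => lt.
exact: len_mul_simpleN.
Qed.

Lemma desM w s : is_simple s -> des (w * s)%g s = ~~ des w s.
Proof.
move=> ss; rewrite /des simpleK //; have [d|d] := boolP (des w s).
  by rewrite (len_des ss d); lia.
by rewrite (len_desN ss d); rewrite /des in d; lia.
Qed.

(** Without descents [w^-1] is increasing, hence j <= w^-1 j for all j; both sides have the same sum
    over j, so equality holds throughout. *)
Lemma exists_des w : w != 1%g -> exists2 s, is_simple s & des w s.
Proof.
case: (pickP (fun s => is_simple s && des w s)) => [s /andP[]|nodes /eqP[]]; first by exists s.
apply/invg_inj/permP => a; rewrite invg1 perm1.
have mono (j : 'I_n) : (j <= w^-1%g j)%N.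
  case: j => j lt; elim: j lt => [//|j IH] lt; have lt' := ltnW lt.
  apply: leq_trans (_ : w^-1%g (Ordinal lt') < _)%N; first by rewrite ltnS IH.
  rewrite -[(_ < _)%N]negbK -ltn_permV; last by rewrite -val_eqE /=; lia.
  apply/negP=> h; have /andP[] := nodes (tperm (Ordinal lt') (Ordinal lt)); split.
    by apply/simpleP; exists (Ordinal lt'), (Ordinal lt).
  by rewrite /des des_simple.
have /leqif_sum[_] : forall j : 'I_n, true -> (j <= w^-1%g j ?= iff (j == w^-1%g j))%N.
  by move=> j _; split=> //; rewrite val_eqE.
rewrite [X in (_ == X)](reindex_inj (@perm_inj _ w)) /=.
rewrite [X in (_ == X)](eq_bigr (fun j => j : nat)) => [|j _]; last by rewrite permK.
by rewrite eqxx => /esym/forallP/(_ a)/eqP {2}->.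
Qed.

(** Induction on b: the transposition (a b) is the conjugate of (a b-1) by the simple transposition
    (b-1 b), and the effect of the latter on lengths is known. *)
Lemma len_tperm w a b : (a < b)%N -> (w^-1%g a < w^-1%g b)%N ->
  (len w < len (w * tperm a b)%g)%N.
Proof.
case: b => b ltb; elim: b ltb w => [//|b IH] ltb w; rewrite ltnS /= => leab.
have ltb' := ltnW ltb; pose b' := Ordinal ltb'; pose s := tperm b' (Ordinal ltb).
have [ab|neq_ab] := eqVneq a b'.
  by rewrite ab => h; rewrite len_mul_simple.
have {leab} ltab : (a < b')%N by rewrite ltn_neqAle neq_ab.
set B := Ordinal ltb => wab.
have aB : (a == B) = false by apply/negbTE; rewrite -val_eqE /=; move: ltab => /=; lia.
have bB : b' != B by rewrite -val_eqE /=; lia.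
have sV c : (w * s)^-1%g c = w^-1%g (s c) by rewrite invMg tpermV permM.
have := IH ltb' (w * s)%g ltab; rewrite !sV tpermL tpermD ?(eq_sym b') //; last by rewrite eq_sym aB.
move=> /(_ wab) lt1.
have e : (w * tperm a B = w * s * tperm a b' * s)%g.
  have <- : (tperm a b' ^ s = tperm a B)%g by rewrite tpermJ tpermL tpermD // eq_sym ?aB.
  by rewrite conjgE tpermV !mulgA.
have xV c : (w * s * tperm a b')^-1%g c = w^-1%g (s (tperm a b' c)).
  by rewrite invMg permM tpermV sV.
have ss : is_simple s by apply/simpleP; exists b', B.
have d1 : des w s = (w^-1%g B < w^-1%g b')%N by rewrite /des des_simple.
have d2 : des (w * s * tperm a b')%g s = (w^-1%g b' < w^-1%g a)%N.
  have sB : s B = b' by rewrite tpermR.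
  have sa : s a = a by rewrite tpermD // eq_sym ?aB.
  have tB : tperm a b' B = B by rewrite tpermD ?aB.
  by rewrite /des des_simple // !xV tpermR tB sB sa.
rewrite e; have [h1|h1] := boolP (des w s); have [h2|h2] := boolP (des (w * s * tperm a b')%g s).
- by move: h1 h2 wab; rewrite d1 d2; lia.
- by rewrite (len_desN ss h2) (len_des ss h1) ltnS.
- by move: lt1; rewrite (len_desN ss h1) (len_des ss h2) ltnS.
- by rewrite (len_desN ss h2) ltnS ltnW // -(len_desN ss h1) ltnW.
Qed.

Lemma bruhat_stepP v w :
  reflect (exists a b, [/\ (a < b)%N, (v^-1%g a < v^-1%g b)%N & w = (v * tperm a b)%g])
          (bruhat_step v w).
Proof.
apply: (iffP andP) => [[ltvw /existsP[a /existsP[b /eqP ew]]]|[a [b [ab vab ->]]]]; last first.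
  by rewrite len_tperm //; split=> //; apply/existsP; exists a; apply/existsP; exists b.
wlog ab : a b ew / (a < b)%N.
  move=> IH; have [|lt|/val_inj eab] := ltngtP a b; first exact: IH ew.
    by apply: (IH b a) => //; rewrite tpermC.
  by move: ltvw; rewrite ew eab tperm1 mulg1 ltnn.
exists a, b; split=> //; rewrite -[(_ < _)%N]negbK -ltn_permV; last by rewrite -val_eqE neq_ltn ab.
apply/negP=> h; have := @len_tperm w a b ab; rewrite ew invMg tpermV !permM tpermL tpermR h.
by rewrite -mulgA tperm2 mulg1 -ew => /(_ isT); rewrite ltnNge (ltnW ltvw).
Qed.

Lemma mul_tpermE w a b : (tperm a b * w = w * tperm (w a) (w b))%g.
Proof. by rewrite conjgC tpermJ. Qed.

Lemma bruhat_stepV v w : bruhat_step v w -> bruhat_step v^-1%g w^-1%g.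
Proof.
case/andP=> ltvw /existsP[a /existsP[b /eqP ew]]; rewrite /bruhat_step !len_inv ltvw /=.
apply/existsP; exists (v^-1%g a); apply/existsP; exists (v^-1%g b).
by rewrite ew invMg tpermV mul_tpermE.
Qed.

Lemma bruhatV v w : bruhat v w -> bruhat v^-1%g w^-1%g.
Proof.
case/connectP=> p; elim: p v => [|x p IH] v /=; first by move=> _ ->; exact: connect0.
by case/andP=> /bruhat_stepV/connect1 vx xp ew; apply: connect_trans vx (IH _ xp ew).
Qed.

Lemma bruhat_stepM s v w : is_simple s -> bruhat_step v w ->
  w = (v * s)%g \/ bruhat_step (v * s)%g (w * s)%g.
Proof.
case/simpleP=> i [k [ik ->]] /bruhat_stepP[a [b [ab vab ->]]].
have [/andP[/eqP-> /eqP->]|nab] := boolP ((a == i) && (b == k)); [by left|right].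
apply/bruhat_stepP; exists (tperm i k a), (tperm i k b).
rewrite invMg !permM tpermV !tpermK -!mulgA mul_tpermE; split=> //.
rewrite tperm_ltE //.
by apply/negP=> /andP[/eqP ai /eqP bk]; move: ab; rewrite ai bk ik; lia.
Qed.

(** The lifting property: multiplication by [s] preserves each step of a chain from [x] to [w],
    except a step from v to v s, from which the rest of the chain can be used unchanged. *)
Lemma bruhat_mulr s x w : is_simple s -> bruhat x w ->
  bruhat (x * s)%g w \/ bruhat (x * s)%g (w * s)%g.
Proof.
move=> ss /connectP[p]; elim: p x => [|y p IH] x /=; first by move=> _ ->; right; exact: connect0.
case/andP=> /(bruhat_stepM ss)[<- yp ew|xy yp ew]; first by left; apply/connectP; exists p.
by case: (IH y yp ew) => h; [left|right]; apply: connect_trans (connect1 xy) h.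
Qed.

Lemma bruhat_desr s w : is_simple s -> des w s -> bruhat (w * s)%g w.
Proof.
move=> ss d; apply: connect1; rewrite /bruhat_step; move: d; rewrite /des => ->.
case/simpleP: (ss) => i [k [_ e]]; apply/existsP; exists i; apply/existsP; exists k.
by rewrite -e simpleK.
Qed.

Lemma bruhat_desNr s w : is_simple s -> ~~ des w s -> bruhat w (w * s)%g.
Proof. by move=> ss d; rewrite -[X in bruhat X _](simpleK w ss) bruhat_desr // desM. Qed.

Lemma bruhat_des s x w : is_simple s -> des w s -> bruhat x w -> bruhat (x * s)%g w.
Proof.
move=> ss d /(bruhat_mulr ss)[//|h]; exact: connect_trans h (bruhat_desr ss d).
Qed.

Lemma bruhat_lift s x w : is_simple s -> des w s -> bruhat (x * s)%g (w * s)%g -> bruhat x w.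
Proof.
move=> ss d /(bruhat_mulr ss); rewrite !simpleK // => -[h|//].
exact: connect_trans h (bruhat_desr ss d).
Qed.

Lemma bruhat_desN s x w : is_simple s -> ~~ des w s -> bruhat x w ->
  bruhat (x * s)%g (w * s)%g.
Proof.
move=> ss d /(bruhat_mulr ss)[h|//]; exact: connect_trans h (bruhat_desNr ss d).
Qed.

Lemma bruhat_trans : transitive (@bruhat n).
Proof. exact: connect_trans. Qed.

Lemma bruhat_lt_neq x w : bruhat x w -> x != w -> (len x < len w)%N.
Proof. by move=> xw neq; apply: bruhat_lt_len; rewrite /bruhat_lt xw. Qed.

Lemma bruhat_anti x w : bruhat x w -> bruhat w x -> x = w.
Proof.
move=> xw wx; apply/eqP; apply/negPn/negP=> neq.
by move: (bruhat_lt_neq xw neq) (bruhat_len wx); lia.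
Qed.

Definition ldes t w := (len (t * w)%g < len w)%N.

Lemma ldesV t w : is_simple t -> ldes t w = des w^-1%g t.
Proof. by move=> st; rewrite /ldes /des -len_inv invMg (simpleV st) (len_inv w). Qed.

Lemma ldes_simple w i k : k = i.+1 :> nat -> ldes (tperm i k) w = (w k < w i)%N.
Proof.
move=> ik; rewrite ldesV ?/des ?des_simple ?invgK //.
by apply/simpleP; exists i, k.
Qed.

(** [s] exchanges two neighbouring values; this affects the order of the values at the two positions
    of [t] only if these are the values exchanged. *)
Lemma exchange s t w : is_simple s -> is_simple t -> ldes t (w * s)%g != ldes t w ->
  (t * w = w * s)%g.
Proof.
case/simpleP=> i [k [ik ->]] /simpleP[a [b [ab ->]]].
rewrite !ldes_simple // !permM mul_tpermE => h.
have [/andP[/eqP-> /eqP->] //|n1] := boolP ((w a == i) && (w b == k)).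
have [/andP[/eqP-> /eqP->] //|n2] := boolP ((w a == k) && (w b == i)).
  by rewrite tpermC.
by rewrite tperm_ltE ?eqxx // andbC in h.
Qed.

Lemma exchanger s t w : is_simple s -> is_simple t -> des (t * w)%g s != des w s ->
  (t * w = w * s)%g.
Proof.
move=> ss st; rewrite -[X in _ != des X _]invgK -[X in des X _]invgK -!ldesV // invMg (simpleV st).
move=> /(exchange st ss) /(congr1 (@invg _)).
by rewrite !invMg !invgK (simpleV st) (simpleV ss).
Qed.

End Coxeter.

(** * R-polynomials *)

Section RPolynomials.

Variable n : nat.
Implicit Types (s t u v w x y z : 'S_n) (i j k a b : 'I_n).
Implicit Types f g : 'S_n -> {poly int}.

(** The recursion for R-polynomials as an operator on functions of the first argument: independence
    of the chosen descent becomes a braid or commutation relation between operators. *)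
Definition Rop s f x : {poly int} :=
  if des x s then f (x * s)%g else 'X * f (x * s)%g + ('X - 1) * f x.

Lemma eq_Rop s f g : f =1 g -> Rop s f =1 Rop s g.
Proof. by move=> fg x; rewrite /Rop !fg. Qed.

Lemma Rpol_rec w : w != 1%g ->
  exists s, [/\ is_simple s, des w s & forall x, Rpol x w = Rop s (fun y => Rpol y (w * s)%g) x].
Proof.
move=> w1; rewrite /Rpol; case ek: (len w) => [|k] /=.
  by have [s _] := exists_des w1; rewrite /des ek.
case: pickP => [s /andP[ss d]|nodes]; last first.
  by have [s ss d] := exists_des w1; have := nodes s; rewrite ss; move: d; rewrite /des => ->.
exists s; split=> // x; rewrite /Rop /des.
by have := len_des ss d; rewrite ek => -[->].
Qed.

Lemma Rpol1 x : Rpol x 1%g = (x == 1%g)%:R.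
Proof. by rewrite /Rpol len1. Qed.

Lemma desE x i k : k = i.+1 :> nat -> des x (tperm i k) = (x^-1%g k < x^-1%g i)%N.
Proof. exact: des_simple. Qed.

Lemma succ_neq i k : k = i.+1 :> nat -> i != k.
Proof. by move=> ik; rewrite -val_eqE /= ik; lia. Qed.

Lemma succ2_neq i k (m : 'I_n) : k = i.+1 :> nat -> m = k.+1 :> nat -> i != m.
Proof. by move=> ik km; rewrite -val_eqE /= km ik; lia. Qed.

Lemma tperm_braid x i k (m : 'I_n) : k = i.+1 :> nat -> m = k.+1 :> nat ->
  (x * tperm i k * tperm k m * tperm i k = x * tperm k m * tperm i k * tperm k m)%g.
Proof.
move=> ik km.
have nik := succ_neq ik; have nkm := succ_neq km; have nim := succ2_neq ik km.
have sm : tperm i k m = m by rewrite tpermD.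
have ti : tperm k m i = i by rewrite tpermD // eq_sym.
apply/permP=> a; rewrite !permM; move: (x a) => c.
have E := (sm, ti, tpermL, tpermR).
have [->|ci] := eqVneq c i; first by rewrite !E.
have [->|ck] := eqVneq c k; first by rewrite !E.
have [->|cm] := eqVneq c m; first by rewrite !E.
have sc : tperm i k c = c by rewrite tpermD // eq_sym.
have tc : tperm k m c = c by rewrite tpermD // eq_sym.
by rewrite !(sc, tc).
Qed.

Lemma Rop_braid i k (m : 'I_n) f x : k = i.+1 :> nat -> m = k.+1 :> nat ->
  let s := tperm i k in let t := tperm k m in
  Rop s (Rop t (Rop s f)) x = Rop t (Rop s (Rop t f)) x.
Proof.
move=> ik km s t.
have nik := succ_neq ik; have nkm := succ_neq km; have nim := succ2_neq ik km.
have si : s i = k by rewrite tpermL.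
have sk : s k = i by rewrite tpermR.
have sm : s m = m by rewrite tpermD.
have ti : t i = i by rewrite tpermD // eq_sym.
have tk : t k = m by rewrite tpermL.
have tm : t m = k by rewrite tpermR.
have tss : tperm i k = s by []. have ttt : tperm k m = t by [].
have ss y : (y * s * s = y)%g by rewrite -mulgA tperm2 mulg1.
have tt y : (y * t * t = y)%g by rewrite -mulgA tperm2 mulg1.
have sts := tperm_braid x ik km; rewrite -/s -/t in sts.
have lt y : (y < y)%N = false by rewrite ltnn.
rewrite /Rop !desE // !invMg !tpermV ttt tss !permM !(si, sk, sm, ti, tk, tm) !ss !tt sts.
have inj a b : a != b -> (x^-1%g a : nat) <> x^-1%g b.
  by move=> ab /val_inj /perm_inj e; rewrite e eqxx in ab.
have := inj _ _ nik; have := inj _ _ nim; have := inj _ _ nkm.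
move: (x^-1%g i : nat) (x^-1%g k : nat) (x^-1%g m : nat) => al be ga.
move: (f _) (f _) (f _) (f _) (f _) (f _) => f1 f2 f3 f4 f5 f6.
(* Only the relative order of the positions of the three values matters, and each of the six orders
   is a polynomial identity. *)
case: (ltngtP al be) => // ?; case: (ltngtP al ga) => // ?; case: (ltngtP be ga) => // ? _ _ _; try lia; ring.
Qed.

Lemma Rop_comm i k a b f x : k = i.+1 :> nat -> b = a.+1 :> nat ->
  i != a -> k != a -> i != b ->
  Rop (tperm i k) (Rop (tperm a b) f) x = Rop (tperm a b) (Rop (tperm i k) f) x.
Proof.
move=> ik ab ia ka ib.
have kb : k != b by rewrite -val_eqE /= ik ab eqSS.
have st : commute (tperm i k) (tperm a b).
  by rewrite /commute mul_tpermE !tpermD // eq_sym.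
have e1 : (x * tperm i k * tperm a b = x * tperm a b * tperm i k)%g.
  by rewrite -!mulgA st.
rewrite /Rop !desE // !invMg !tpermV !permM !e1.
have sa : tperm i k a = a by rewrite tpermD.
have sb : tperm i k b = b by rewrite tpermD.
have ti : tperm a b i = i by rewrite tpermD // eq_sym.
have tk : tperm a b k = k by rewrite tpermD // eq_sym.
rewrite !(sa, sb, ti, tk).
by case: ifP => h1; case: ifP => h2; ring.
Qed.

(** [Rrec] uses whichever descent is picked; here any descent will do. Two descents of [w] commute
    or are adjacent; unfolding the recursion two or three times on each side leads to the same
    shorter element, and [Rop_comm] or [Rop_braid] concludes. *)
Lemma Rpol_des s x w : is_simple s -> des w s ->
  Rpol x w = Rop s (fun y => Rpol y (w * s)%g) x.
Proof.
move=> ss; have [N] := ubnP (len w); elim: N s x w ss => // N IH s x w ss ltN d.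
have w1 : w != 1%g by apply: contraTneq d => ->; rewrite /des len1.
have [s0 [ss0 d0 rec0]] := Rpol_rec w1; rewrite rec0.
have IH' s' u z : is_simple s' -> des u s' -> (len u < len w)%N ->
    Rpol z u = Rop s' (fun y => Rpol y (u * s')%g) z.
  by move=> ss' d' lt; apply: IH => //; apply: leq_trans lt _; rewrite -ltnS.
move: (d) (d0); case/simpleP: (ss) => i [k [ik es]]; case/simpleP: (ss0) => a [b [ab es0]].
rewrite es es0 !desE //.
have lw0 := len_des ss0 d0; have lw := len_des ss d.
have comm_case : i != a -> k != a -> i != b ->
    (w^-1%g k < w^-1%g i)%N -> (w^-1%g b < w^-1%g a)%N -> 
  Rop (tperm a b) (fun y => Rpol y (w * tperm a b)%g) x =
  Rop (tperm i k) (fun y => Rpol y (w * tperm i k)%g) x.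
  move=> ia ka ib wki wba.
  have kb : k != b by rewrite -val_eqE /= ik ab eqSS.
  rewrite (@eq_Rop _ _ (Rop s (fun y => Rpol y (w * s0 * s)%g))); last first.
    move=> y; rewrite -es0; apply: IH'; rewrite ?lw0 // es desE // es0 invMg !permM tpermV !tpermD //.
    by rewrite eq_sym. by rewrite eq_sym. by rewrite eq_sym. by rewrite eq_sym.
  rewrite [RHS](@eq_Rop _ _ (Rop s0 (fun y => Rpol y (w * s * s0)%g))); last first.
    by move=> y; rewrite -es; apply: IH'; rewrite ?lw // es0 desE // es invMg !permM tpermV !tpermD.
  have ew : (w * s0 * s = w * s * s0)%g.
    by rewrite -!mulgA es es0 mul_tpermE !tpermD // eq_sym.
  by rewrite ew es es0; symmetry; apply: Rop_comm.
have braid_case i' k' (m : 'I_n) : k' = i'.+1 :> nat -> m = k'.+1 :> nat ->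
    (w^-1%g k' < w^-1%g i')%N -> (w^-1%g m < w^-1%g k')%N -> 
  Rop (tperm i' k') (fun y => Rpol y (w * tperm i' k')%g) x =
  Rop (tperm k' m) (fun y => Rpol y (w * tperm k' m)%g) x.
  move=> ik' km wki wmk; set s' := tperm i' k'; set t' := tperm k' m.
  have nik := succ_neq ik'; have nkm := succ_neq km; have nim := succ2_neq ik' km.
  have ss' : is_simple s' by apply/simpleP; exists i', k'.
  have st' : is_simple t' by apply/simpleP; exists k', m.
  have ds : des w s' by rewrite desE.
  have dt : des w t' by rewrite desE.
  have sm : s' m = m by rewrite tpermD.
  have ti : t' i' = i' by rewrite tpermD // eq_sym.
  have si : s' i' = k' by rewrite tpermL.
  have sk : s' k' = i' by rewrite tpermR.
  have tk : t' k' = m by rewrite tpermL.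
  have tm : t' m = k' by rewrite tpermR.
  have sV : (s'^-1 = s')%g by rewrite tpermV.
  have tV : (t'^-1 = t')%g by rewrite tpermV.
  have dst : des (w * s')%g t'.
    by rewrite desE // invMg sV !permM sm sk; exact: ltn_trans wmk wki.
  have dsts : des (w * s' * t')%g s'.
    by rewrite desE // invMg tV invMg sV !permM tk ti sm si.
  have dts : des (w * t')%g s'.
    by rewrite desE // invMg tV !permM tk ti; exact: ltn_trans wmk wki.
  have dtst : des (w * t' * s')%g t'.
    by rewrite desE // invMg sV invMg tV !permM sm sk tm ti.
  have l1 := len_des ss' ds; have l2 := len_des st' dt.
  have l3 := len_des st' dst; have l4 := len_des ss' dts.
  rewrite (@eq_Rop _ _ (Rop t' (Rop s' (fun y => Rpol y (w * s' * t' * s')%g)))); last first.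
    move=> y; rewrite (IH' t') //.
    by apply: eq_Rop => {}y; apply: IH' => //; rewrite l1 l3 ltnS.
  rewrite [RHS](@eq_Rop _ _ (Rop s' (Rop t' (fun y => Rpol y (w * t' * s' * t')%g)))); last first.
    move=> y; rewrite (IH' s') //.
    by apply: eq_Rop => {}y; apply: IH' => //; rewrite l2 l4 ltnS.
  by rewrite -(tperm_braid w ik' km) Rop_braid.
move=> wki wba; have [ia|ia] := eqVneq i a.
  have -> : k = b by apply: val_inj; rewrite /= ik ab ia.
  by rewrite ia.
have [ka|ka] := eqVneq k a.
  by move: ik wki; rewrite ka => ik' wki'; symmetry; exact: braid_case.
have [ib|ib] := eqVneq i b; last exact: comm_case.
by move: ik wki; rewrite ib => ik' wki'; exact: braid_case.
Qed.

Definition Lop t f x : {poly int} :=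
  if ldes t x then f (t * x)%g else 'X * f (t * x)%g + ('X - 1) * f x.

Lemma eq_Lop t f g : f =1 g -> Lop t f =1 Lop t g.
Proof. by move=> fg x; rewrite /Lop !fg. Qed.

Lemma ldesM t w : is_simple t -> ldes t (t * w)%g = ~~ ldes t w.
Proof. by move=> st; rewrite !ldesV // invMg (simpleV st) desM. Qed.

Lemma Rop_Lop_comm s t f x : is_simple s -> is_simple t ->
  Rop s (Lop t f) x = Lop t (Rop s f) x.
Proof.
move=> ss st; rewrite /Rop /Lop mulgA.
have [e|ne] := eqVneq (t * x)%g (x * s)%g.
  have h1 : ldes t (x * s)%g = ~~ ldes t x by rewrite -e ldesM.
  have h2 : des (t * x)%g s = ~~ des x s by rewrite e desM.
  have h3 : ldes t x = des x s by rewrite /ldes e.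
  by rewrite h1 h2 h3 e; case: (des x s) => /=; ring.
have -> : ldes t (x * s)%g = ldes t x.
  by apply: contraNeq ne => /(exchange ss st)->.
have -> : des (t * x)%g s = des x s.
  by apply: contraNeq ne => /(exchanger ss st)->.
by case: ifP => h1; case: ifP => h2; ring.
Qed.

Lemma len_mull_leS t w : is_simple t -> (len (t * w)%g <= (len w).+1)%N.
Proof.
move=> st; rewrite -len_inv invMg (simpleV st).
have [d|d] := boolP (des w^-1%g t); last by rewrite (len_desN st d) len_inv.
by rewrite -(len_inv w); apply/leqW/ltnW.
Qed.

(** The recursion on the left. It follows by induction from the one on the right, as left and right
    operators commute. *)
Lemma Rpol_ldes t x w : is_simple t -> ldes t w ->
  Rpol x w = Lop t (fun y => Rpol y (t * w)%g) x.
Proof.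
move=> st; have [N] := ubnP (len w); elim: N x w => // N IH x w ltN d.
have w1 : w != 1%g by apply: contraTneq d => ->; rewrite ldesV // invg1 /des len1.
(* The induction needs a right descent s with t w <> w s, so that t stays a left descent of w s. If
   a descent s violates this, a descent of w s is one of w as well and works, unless w s = 1 and w =
   t. *)
have [[s [ss ds nts]]|wt] : (exists s, [/\ is_simple s, des w s & (t * w != w * s)%g]) \/ w = t.
- have [s ss ds] := exists_des w1.
  have [tws|] := eqVneq (t * w)%g (w * s)%g; last by left; exists s.
  have [u1|u1] := eqVneq (w * s)%g 1%g.
    by right; rewrite -(simpleV st); apply: (mulgI t); rewrite tws u1 mulgV.
  left; have [s' ss' ds'] := exists_des u1; exists s'; split=> //.
    rewrite /des -[X in (len (X * _)%g < _)%N](mulKg t) (simpleV st) tws -!mulgA.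
    apply: leq_ltn_trans (len_mull_leS _ st) _.
    by rewrite mulgA -(len_des ss' ds') (len_des ss ds).
  by rewrite tws; apply: contraTneq ds' => /mulgI <-; rewrite desM // ds.
- have dts : des (t * w)%g s.
    by apply: contraNT nts => h; rewrite (exchanger ss st) // ds (negbTE h).
  have dtws : ldes t (w * s)%g.
    by apply: contraNT nts => h; rewrite (exchange ss st) // d (negbTE h).
  rewrite (Rpol_des _ ss ds) (@eq_Rop _ _ (Lop t (fun y => Rpol y (t * (w * s))%g))); last first.
    by move=> y; apply: IH => //; move: ds; rewrite /des; lia.
  by rewrite Rop_Lop_comm //; apply: eq_Lop => y; rewrite mulgA [RHS](Rpol_des _ ss dts).
rewrite wt in d *; have tt : (t * t = 1)%g := simple2 st.
have dt : des t t by move: d; rewrite /des /ldes.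
rewrite (Rpol_des _ st dt) /Rop /Lop tt !Rpol1.
have -> : (t * x == 1)%g = (x * t == 1)%g.
  by rewrite -!eq_invg_mul (simpleV st) eq_invg_sym (simpleV st) eq_sym.
have [->|xt] := eqVneq x t; first by rewrite dt d.
have -> : (x * t == 1)%g = false.
  by apply: contraNF xt; rewrite -eq_invg_mul eq_invg_sym (simpleV st) eq_sym.
have [->|x1] := eqVneq x 1%g; first by rewrite ldesV // invg1.
by rewrite !mulr0 addr0 !if_same.
Qed.

Lemma RpolV x w : Rpol x^-1%g w^-1%g = Rpol x w.
Proof.
have [N] := ubnP (len w); elim: N x w => // N IH x w ltN.
have [->|w1] := eqVneq w 1%g; first by rewrite invg1 !Rpol1 invg_eq1.
have [s ss ds] := exists_des w1.
have ds' : ldes s w^-1%g by rewrite ldesV ?invgK.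
rewrite (Rpol_des _ ss ds) (Rpol_ldes _ ss ds') /Rop /Lop.
have lt : (len (w * s)%g < N)%N by apply: leq_trans ds _; rewrite -ltnS.
have eV y : (s * y^-1 = (y * s)^-1)%g by rewrite invMg (simpleV ss).
by rewrite ldesV // invgK !eV !IH.
Qed.

Lemma Rpol_bruhat x w : ~~ bruhat x w -> Rpol x w = 0.
Proof.
have [N] := ubnP (len w); elim: N x w => // N IH x w ltN.
have [->|w1] := eqVneq w 1%g.
  by rewrite Rpol1; case: eqP => [->|//]; rewrite /bruhat connect0.
have [s ss ds] := exists_des w1; rewrite (Rpol_des _ ss ds) /Rop => nxw.
have lt : (len (w * s)%g < N)%N by apply: leq_trans ds _; rewrite -ltnS.
have h1 : ~~ bruhat (x * s)%g (w * s)%g by apply: contra nxw; exact: bruhat_lift.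
have h2 : ~~ bruhat x (w * s)%g.
  by apply: contra nxw => h; exact: connect_trans h (bruhat_desr ss ds).
by rewrite !IH // !mulr0 addr0 if_same.
Qed.

End RPolynomials.

Lemma double_half_succ d : ((d.+1)./2.*2 = d + odd d)%N.
Proof. by have := odd_double_half d.+1; rewrite oddS; case: odd => /=; lia. Qed.

(** * Inversion formula for R-polynomials *)

Section Inversion.

Variable n : nat.
Implicit Types (s t u v w x y z : 'S_n) (i j k a b : 'I_n).

Lemma sum_pairs (V : nmodType) s (F : 'S_n -> V) : is_simple s ->
  \sum_y F y = \sum_(y | ~~ des y s) (F y + F (y * s)%g).
Proof.
move=> ss; rewrite (bigID (fun y => des y s)) /= addrC big_split /=; congr (_ + _).
rewrite (reindex_inj (mulIg s)) /=; apply: eq_bigl => y.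
by rewrite desM.
Qed.

(** The induction step of the inversion formula: grouping z with z s moves the operator [Rop s] from
    [g] to the first argument of the R-polynomials. *)
Lemma Rpol_sum_Rop s x (g : 'S_n -> {poly int}) : is_simple s ->
  let T h y := \sum_z (-1) ^+ len z * Rpol y z * h z in
  T (Rop s g) x = if des x s then - T g (x * s)%g + ('X - 1) * T g x
                  else - ('X * T g (x * s)%g).
Proof.
move=> ss T; rewrite /T !(sum_pairs _ ss) /=.
case: ifP => dx; rewrite -?sumrN ?mulr_sumr -?sumrN -?big_split /=; apply: eq_bigr => y dy.
  have dys : des (y * s)%g s by rewrite desM.
  rewrite (len_desN ss dy) exprS mulN1r [Rop s g y]/Rop [Rop s g _]/Rop dys (negbTE dy) simpleK //.
  have -> : Rpol x (y * s)%g = Rpol (x * s)%g y.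
    by rewrite (Rpol_des _ ss dys) /Rop dx simpleK.
  have -> : Rpol (x * s)%g (y * s)%g = 'X * Rpol x y + ('X - 1) * Rpol (x * s)%g y.
    by rewrite (Rpol_des _ ss dys) /Rop desM // dx !simpleK.
  by move: ((-1) ^+ len y) => e; ring.
have dys : des (y * s)%g s by rewrite desM.
rewrite (len_desN ss dy) exprS mulN1r [Rop s g y]/Rop [Rop s g _]/Rop dys (negbTE dy) simpleK //.
have -> : Rpol (x * s)%g (y * s)%g = Rpol x y.
  by rewrite (Rpol_des _ ss dys) /Rop desM // dx !simpleK.
have -> : Rpol x (y * s)%g = 'X * Rpol (x * s)%g y + ('X - 1) * Rpol x y.
  by rewrite (Rpol_des _ ss dys) /Rop dx simpleK.
by move: ((-1) ^+ len y) => e; ring.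
Qed.

Lemma Rpol_inversion x z :
  \sum_y (-1) ^+ len y * Rpol x y * Rpol y z = (-1) ^+ len x * (x == z)%:R.
Proof.
have [N] := ubnP (len z); elim: N x z => // N IH x z ltN.
have [->|z1] := eqVneq z 1%g.
  rewrite (bigD1 1%g) //= big1 => [|y /negbTE y1]; last by rewrite Rpol1 y1 mulr0.
  rewrite !Rpol1 len1 eqxx addr0 mulr1 mul1r; case: eqP => [->|_]; last by rewrite mulr0.
  by rewrite len1 mulr1.
have [s ss ds] := exists_des z1.
have lt : (len (z * s)%g < N)%N by apply: leq_trans ds _; rewrite -ltnS.
under eq_bigr => y _ do rewrite (Rpol_des y ss ds).
rewrite (Rpol_sum_Rop x _ ss) !IH // (inj_eq (mulIg s)).
have [dx|dx] := boolP (des x s).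
  have -> : (x == (z * s)%g) = false.
    by apply: contraTF dx => /eqP->; rewrite desM // ds.
  by rewrite !mulr0 addr0 (len_des ss dx) exprS mulN1r mulNr.
have -> : (x == z) = false by apply: contraNF dx => /eqP->.
by rewrite !mulr0 oppr0.
Qed.

End Inversion.

(** * Kazhdan-Lusztig polynomials *)

(* Two specialisations of the variable, at an element and at its inverse: they *)
(* express the bar involution without Laurent polynomials.                     *)
Section Bar.

Variables (K : fieldType) (ev evb : {rmorphism {poly int} -> K}).
Hypothesis evbX : evb 'X = (ev 'X)^-1.
Hypothesis ev_inj : injective ev.

Let Q := ev 'X.

Lemma evX_neq0 : Q != 0.
Proof. by rewrite /Q -(rmorph0 ev) (inj_eq ev_inj) polyX_eq0. Qed.

Lemma evC (c : int) : ev c%:P = c%:~R.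
Proof. by rewrite -[c in LHS]intz !rmorph_int. Qed.

Lemma evbC (c : int) : evb c%:P = c%:~R.
Proof. by rewrite -[c in LHS]intz !rmorph_int. Qed.

Lemma poly_size_leE (m : nat) (S : {poly int}) : (size S <= m)%N -> S = \poly_(i < m) S`_i.
Proof.
move=> szS; apply/polyP=> i; rewrite coef_poly; case: ltnP => // h.
by rewrite nth_default // (leq_trans szS).
Qed.

Lemma evb_poly d (S : {poly int}) : (size S <= d.+1)%N ->
  evb S * Q ^+ d = ev (\poly_(i < d.+1) S`_(d - i)).
Proof.
move/poly_size_leE=> eS; rewrite [in LHS]eS !poly_def !rmorph_sum /= mulr_suml.
rewrite [RHS](reindex_inj rev_ord_inj) /=; apply: eq_bigr => -[i /= lti] _.
rewrite -!mul_polyC !rmorphM /= !rmorphXn /= evC evbC evbX -/Q subSS subKn // -mulrA.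
congr (_ * _); rewrite -{1}(subnKC (_ : i <= d)%N) // exprD mulrA -exprMn.
by rewrite mulVf ?evX_neq0 // expr1n mul1r.
Qed.

(** The identity read coefficient by coefficient: [S] has degree at most d and [r] is its reversal.
    Multiplication by a high power of q gives an identity of polynomials. *)
Lemma evb_coef d (S r : {poly int}) : evb S * Q ^+ d = ev r ->
  (forall i, r`_i = if (i <= d)%N then S`_(d - i) else 0) /\
  (forall j, (d < j)%N -> S`_j = 0).
Proof.
move=> e; pose m := maxn d (size S).
have dm : (d <= m)%N by rewrite leq_maxl.
have szS : (size S <= m.+1)%N by rewrite leqW // leq_maxr.
have /ev_inj eqp : ev (\poly_(i < m.+1) S`_(m - i)) = ev (r * 'X^(m - d)).
  rewrite -evb_poly // rmorphM rmorphXn -e -mulrA -exprD.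
  by rewrite subnKC.
have eqc i : (if (i < m.+1)%N then S`_(m - i) else 0) =
             (if (i < m - d)%N then 0 else r`_(i - (m - d))).
  by rewrite -coefMXn -eqp coef_poly.
split=> [i|j dj].
  have := eqc (i + (m - d))%N; rewrite [X in _ = (if X then _ else _)]ltnNge leq_addl /= addnK => <-.
  rewrite ltnS; have -> : (i + (m - d) <= m)%N = (i <= d)%N by lia.
  by case: leqP => // h; congr (_`_ _); lia.
have [jm|mj] := leqP j m; last by rewrite nth_default // (leq_trans _ (ltnW mj)) // leq_maxr.
have := eqc (m - j)%N; rewrite ltnS leq_subr subKn // => ->.
by rewrite ifT //; lia.
Qed.

Variable n : nat.
Implicit Types (s t u v w x y z : 'S_n).

(** The bar involution multiplies R_{x,w} by (-1)^(l(x)+l(w)) q^(l(x)-l(w)); here without negative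
    powers. *)
Lemma evb_Rpol x w :
  evb (Rpol x w) * Q ^+ len w = (-1) ^+ (len x + len w) * Q ^+ len x * ev (Rpol x w).
Proof.
have Q0 := evX_neq0.
have [N] := ubnP (len w); elim: N x w => // N IH x w ltN.
have [->|w1] := eqVneq w 1%g.
  rewrite !Rpol1 len1 addn0 mulr1; case: eqP => [->|_]; last by rewrite !rmorph0 mulr0.
  by rewrite !rmorph1 len1 !mulr1.
have [s ss ds] := exists_des w1.
have lt : (len (w * s)%g < N)%N by apply: leq_trans ds _; rewrite -ltnS.
have e1 := IH (x * s)%g (w * s)%g lt; have e2 := IH x (w * s)%g lt.
rewrite !(Rpol_des _ ss ds) /Rop (len_des ss ds); case: ifP => [dx|/negbT dx].
  rewrite (len_des ss dx) exprS mulrCA e1 addSn addnS !exprS.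
  by move: ((-1) ^+ _) => e; ring.
move: e1 e2; rewrite (len_desN ss dx) addSn addnS.
rewrite !rmorphD !rmorphM !rmorphD /= !rmorphN !rmorph1 /= evbX -/Q !exprS => e1 e2.
move: Q0 e1 e2; move: Q (evb _) (evb _) (ev _) (ev _) (Q ^+ _) (Q ^+ _) ((-1) ^+ _).
move=> q b1 b2 r1 r2 ql qx e q0 e1 e2.
transitivity (b2 * qx + (1 - q) * (b1 * qx)); first by field.
by rewrite e1 e2; ring.
Qed.

Lemma KLrec_fuel k k' x w : (len w - len x <= k)%N -> (len w - len x <= k')%N ->
  KLrec k x w = KLrec k' x w.
Proof.
elim: k k' x => [|k IH] [|k'] x //=.
- rewrite leqn0 => /eqP d0 _; case: eqVneq => // neq; case: ifP => // xw.
  by have := bruhat_lt_neq xw neq; rewrite -subn_gt0 d0.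
- move=> _; rewrite leqn0 => /eqP d0; case: eqVneq => // neq; case: ifP => // xw.
  by have := bruhat_lt_neq xw neq; rewrite -subn_gt0 d0.
move=> lek lek'; case: eqVneq => // neq; case: ifP => // xw; congr (- take_poly _ _).
apply: eq_bigr => y /andP[xy yw]; congr (_ * _); have := bruhat_lt_len xy => lt.
have := bruhat_len yw => le.
by apply: IH; [move: lek|move: lek']; move: lt le; clear; lia.
Qed.

Lemma KLpol_unfold x w : KLpol x w =
  if x == w then 1 else if bruhat x w then
    - take_poly (len w - len x).+1./2
          (\sum_(y | bruhat_lt x y && bruhat y w) Rpol x y * KLpol y w)
  else 0.
Proof.
by rewrite /KLpol (@KLrec_fuel _ (len w).+1) ?leq_subr ?leqW ?leq_subr.
Qed.

Lemma KLpolxx w : KLpol w w = 1.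
Proof. by rewrite KLpol_unfold eqxx. Qed.

Lemma KLpol_bruhat x w : ~~ bruhat x w -> KLpol x w = 0.
Proof.
rewrite KLpol_unfold => /negbTE h; rewrite h; case: eqP => // e.
by move: h; rewrite e /bruhat connect0.
Qed.

Lemma size_KLpol x w : x != w -> (size (KLpol x w) <= (len w - len x).+1./2)%N.
Proof.
rewrite KLpol_unfold => /negbTE->; case: ifP => _; last by rewrite size_poly0.
by rewrite size_polyN size_take_poly.
Qed.

(* The bar identity for KLpol: antisymmetry of the sum over y > x, which      *)
(* follows from the inversion formula for the R-polynomials, shows that its   *)
(* low and high degree parts determine each other.                            *)
Lemma evb_KLpol x w :
  evb (KLpol x w) * Q ^+ len w = Q ^+ len x * \sum_y ev (Rpol x y) * ev (KLpol y w).
Proof.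
have Q0 := evX_neq0.
have [N] := ubnP (len w - len x); elim: N x => // N IH x ltN.
have [xw|nxw] := boolP (bruhat x w); last first.
  rewrite KLpol_bruhat // rmorph0 mul0r big1 ?mulr0 // => y _.
  have [xy|/Rpol_bruhat->] := boolP (bruhat x y); last by rewrite rmorph0 mul0r.
  rewrite KLpol_bruhat ?rmorph0 ?mulr0 //; apply: contra nxw; exact: bruhat_trans.
have [->|neq] := eqVneq x w.
  rewrite (bigD1 w) //= big1 => [|y ny].
    by rewrite Rpolxx KLpolxx !rmorph1 !mul1r addr0 mulr1.
  have [wy|/Rpol_bruhat->] := boolP (bruhat w y); last by rewrite rmorph0 mul0r.
  rewrite (KLpol_bruhat (x := y)) ?rmorph0 ?mulr0 //; apply: contra ny => yw.
  by rewrite (bruhat_anti yw wy).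
have lt := bruhat_lt_neq xw neq.
pose S := \sum_(y | bruhat_lt x y && bruhat y w) Rpol x y * KLpol y w.
have eS : S = \sum_(y | y != x) Rpol x y * KLpol y w.
  rewrite /S [RHS](bigID (fun y => bruhat x y && bruhat y w)) /= [X in _ + X]big1 ?addr0 => [|y].
    by apply: eq_bigl => y; rewrite /bruhat_lt eq_sym andbA andbAC [_ && (_ != _)]andbC andbA.
  by rewrite negb_and => /andP[_ /orP[/Rpol_bruhat->|/KLpol_bruhat->]]; rewrite ?mul0r ?mulr0.
pose d := (len w - len x)%N.
have anti : evb S * Q ^+ d = ev (- S).
  apply: (mulIf (expf_neq0 (len x) Q0)); rewrite -mulrA -exprD subnK; last exact: ltnW.
  rewrite eS rmorph_sum /= mulr_suml.
  transitivity (Q ^+ len x * \sum_(y | y != x) \sum_z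
      (-1) ^+ (len x + len y) * ev (Rpol x y) * ev (Rpol y z) * ev (KLpol z w)).
    rewrite mulr_sumr; apply: eq_bigr => y neqy.
    have [xy|/Rpol_bruhat->] := boolP (bruhat x y); last first.
      by rewrite mul0r rmorph0 mul0r big1 ?mulr0 // => z _; rewrite rmorph0 mulr0 !mul0r.
    have lty : (len x < len y)%N by apply: bruhat_lt_neq; rewrite // eq_sym.
    rewrite rmorphM /= -mulrA IH; last by move: ltN lt lty; clear; lia.
    rewrite mulrA evb_Rpol mulr_sumr mulr_sumr; apply: eq_bigr => z _.
    by move: ((-1) ^+ _) => e; ring.
  rewrite [RHS]mulrC rmorphN; congr (_ * _).
  (* The full double sum is evaluated in two ways: by the inversion formula it is P_{x,w}, while its
     terms with y = x alone give P_{x,w} + S. The remaining terms therefore sum to -S. *)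
  have := erefl (\sum_y \sum_z
      (-1) ^+ (len x + len y) * ev (Rpol x y) * ev (Rpol y z) * ev (KLpol z w)).
  rewrite {1}exchange_big /= (eq_bigr (fun z => (x == z)%:R * ev (KLpol z w))); last first.
    move=> z _; rewrite -mulr_suml; congr (_ * _).
    have := congr1 ev (Rpol_inversion x z); rewrite rmorph_sum rmorphM /= rmorph_nat.
    move=> /(congr1 (fun c => (-1) ^+ len x * c)); rewrite rmorphXn rmorphN rmorph1 mulrA -exprMn.
    rewrite mulrNN mulr1 expr1n mul1r => <-; rewrite mulr_sumr; apply: eq_bigr => y _.
    rewrite !rmorphM rmorphXn rmorphN rmorph1 exprD; ring.
  rewrite (bigD1 x) //= eqxx mul1r big1 => [|z /negbTE nz]; last by rewrite eq_sym nz mul0r.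
  rewrite [RHS](bigD1 x) //= [X in _ = X + _](bigD1 x) //=.
  rewrite -signr_odd oddD addbb !mul1r Rpolxx rmorph1 !mul1r addr0 -addrA.
  move=> /eqP; rewrite -[X in X == _]addr0 (inj_eq (addrI _)) eq_sym addrC addr_eq0 => /eqP->.
  congr (- _); rewrite rmorph_sum /=; apply: eq_bigr => z _.
  by rewrite rmorphM mul1r.
set h := (d.+1)./2; pose T := take_poly h S.
have eP : KLpol x w = - T by rewrite KLpol_unfold (negbTE neq) xw.
have -> : \sum_y ev (Rpol x y) * ev (KLpol y w) = ev (S - T).
  rewrite (bigD1 x) //= Rpolxx rmorph1 mul1r eP addrC rmorphD /= eS rmorph_sum.
  by congr (_ + _); apply: eq_bigr => y _; rewrite rmorphM.
rewrite eP -[len w](subnK (ltnW lt)) -/d exprD mulrA mulrC; congr (_ * _).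
have hd : (h.*2 = d + odd d)%N := double_half_succ d.
have szT : (size (- T) <= d.+1)%N.
  by rewrite size_polyN (leq_trans (size_take_poly _ _)) //; move: hd; clear; case: odd; lia.
rewrite evb_poly //; congr (ev _); have [cS hS] := evb_coef anti.
apply/polyP=> i; rewrite coef_poly coefB !coefN !coef_take_poly ltnS.
have := cS i; rewrite coefN; have [id_ cSi|di _] := leqP i d; last first.
  by rewrite hS // if_same subr0.
have [ih|hi] := ltnP i h; have [dih|hdi] := ltnP (d - i) h.
- by move: id_ ih dih hd; clear; case: odd; lia.
- by rewrite subrr oppr0.
- by rewrite subr0 -cSi opprK.
(* The middle coefficient, for even d, equals its own opposite and vanishes. *)
have edi : (d - i)%N = i by move: id_ hi hdi hd; clear; case: odd; lia.
rewrite oppr0 subr0; move: cSi; rewrite edi => e.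
by move: e; move: (S`_i) => c; clear; lia.
Qed.

End Bar.

Section MubarBasics.

Variable n : nat.
Implicit Types (s v w x z : 'S_n).

(* The coefficients of C_w C_s, in the unnormalised Kazhdan-Lusztig basis, with
   the lower terms subtracted. *)
Definition KLmul s w x :=
  (if des x s then KLpol (x * s)%g w + 'X * KLpol x w
   else 'X * KLpol (x * s)%g w + KLpol x w)
  - \sum_(z | des z s && bruhat_lt z w)
      (mubar z w)%:P * 'X^((len w - len z).+1./2) * KLpol x z.

Lemma mubar_lt v w : bruhat_lt v w ->
  mubar v w = if odd (len w - len v) then (KLpol v w)`_((len w - len v).-1./2) else 0.
Proof. by rewrite /mubar => ->. Qed.

Lemma mubar_sym v w : mubar v w = mubar w v.
Proof.
rewrite /mubar; have [vw|] := boolP (bruhat_lt v w); have [wv|] := boolP (bruhat_lt w v) => //.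
by move: (bruhat_lt_len vw) (bruhat_lt_len wv); lia.
Qed.

End MubarBasics.

(** * Uniqueness of bar-invariant families and the product formula *)

Section Multiplication.

Variables (K : fieldType) (ev evb : {rmorphism {poly int} -> K}).
Hypothesis evbX : evb 'X = (ev 'X)^-1.
Hypothesis ev_inj : injective ev.

Let Q := ev 'X.
Let Q0 : Q != 0 := evX_neq0 ev_inj.

Variable n : nat.
Implicit Types (s t u v w x y z : 'S_n).

(** Bar invariance makes [g] symmetric about degree d/2, with d = b - a, whereas its degree is less
    than d/2. *)
Lemma bar_small0 a b (g : {poly int}) : (a <= b)%N ->
  (size g <= (b - a).+1./2)%N -> evb g * Q ^+ b = Q ^+ a * ev g -> g = 0.
Proof.
move=> ab szg; rewrite -{1}(subnK ab) exprD mulrA [RHS]mulrC => /(mulIf (expf_neq0 a Q0)).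
move: szg; move: (b - a)%N => d szg /(evb_coef evbX ev_inj)[cg _].
apply/polyP=> i; rewrite coef0; have hd := double_half_succ d.
have [le|lt] := leqP (d.+1)./2 i; first by rewrite nth_default // (leq_trans szg).
rewrite cg; case: leqP => // id_; rewrite nth_default // (leq_trans szg) //.
by move: hd lt id_; clear; case: odd; lia.
Qed.

Lemma Rpol_xs x y s : is_simple s -> ~~ des x s -> ~~ des y s ->
  (Rpol (x * s)%g (y * s)%g = Rpol x y) *
  (Rpol x (y * s)%g = 'X * Rpol (x * s)%g y + ('X - 1) * Rpol x y).
Proof.
move=> ss dx dy; have dys : des (y * s)%g s by rewrite desM.
by split; rewrite (Rpol_des _ ss dys) /Rop ?desM // ?dx ?(negbTE dx) !simpleK.
Qed.

(** Descending induction on x: given the equality for larger elements, the difference of the two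
    polynomials is bar-invariant and of too small a degree. *)
Lemma KLpol_des s x w : is_simple s -> des w s -> KLpol (x * s)%g w = KLpol x w.
Proof.
move=> ss dw; wlog dx : x / ~~ des x s.
  move=> IH; have [dx|/IH//] := boolP (des x s).
  by rewrite -[in RHS](simpleK x ss) -IH // desM // dx.
have [N] := ubnP (len w - len x); elim: N x dx => // N IH x dx ltN.
have [xw|nxw] := boolP (bruhat x w); last first.
  rewrite !KLpol_bruhat //; apply: contra nxw => h.
  by rewrite -(simpleK x ss); exact: bruhat_des.
have neq : x != w by apply: contraNneq dx => ->.
have lt := bruhat_lt_neq xw neq.
pose g := KLpol x w - KLpol (x * s)%g w.
suff : g = 0 by move/eqP; rewrite subr_eq0 => /eqP.
have C y : bruhat x y -> ~~ des y s -> y != x -> KLpol (y * s)%g w = KLpol y w.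
  move=> xy dy ny; have [yw|nyw] := boolP (bruhat y w); last first.
    rewrite !KLpol_bruhat //; apply: contra nyw => h.
    by rewrite -(simpleK y ss); exact: bruhat_des.
  have lxy : (len x < len y)%N by apply: bruhat_lt_neq; rewrite // eq_sym.
  by apply: IH => //; move: (bruhat_len yw) ltN lxy; clear; lia.
have lxs := len_desN ss dx.
apply: (@bar_small0 (len x) (len w)); first exact: ltnW.
  rewrite (leq_trans (size_polyD _ _)) // size_polyN geq_max size_KLpol // andTb.
  have [->|nxs] := eqVneq (x * s)%g w.
    by rewrite KLpolxx size_poly1 half_gt0 ltnS subn_gt0.
  by apply: leq_trans (size_KLpol nxs) _; rewrite half_leq // ltnS leq_sub2l // lxs.
have bx := evb_KLpol evbX ev_inj x w; have bxs := evb_KLpol evbX ev_inj (x * s)%g w.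
rewrite rmorphB /= mulrBl bx bxs lxs exprS -/Q.
suff -> : \sum_y ev (Rpol x y) * ev (KLpol y w) =
    Q * (\sum_y ev (Rpol (x * s)%g y) * ev (KLpol y w)) + ev g by ring.
rewrite !(sum_pairs _ ss) mulr_sumr.
rewrite (bigD1 x) //= [X in _ = X + _](bigD1 x) //=.
rewrite (Rpol_bruhat (x := (x * s)%g) (w := x)); last first.
  by apply/negP=> /bruhat_len; rewrite lxs ltnn.
rewrite rmorph0 mul0r add0r.
have [e1 e2] := Rpol_xs ss dx dx; rewrite e1 e2 (Rpol_bruhat (x := (x * s)%g) (w := x)); last first.
  by apply/negP=> /bruhat_len; rewrite lxs ltnn.
rewrite Rpolxx mulr0 add0r mulr1 rmorph1 mul1r mul1r rmorphB /= rmorph1.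
set U := \sum_(y | _) _; set V := \sum_(y | _) _.
have -> : U = V.
  apply: eq_bigr => y /andP[dy ny]; have [-> ->] := Rpol_xs ss dx dy.
  have [xy|nxy] := boolP (bruhat x y); last first.
    have -> : Rpol (x * s)%g y = 0.
      apply: Rpol_bruhat; apply: contra nxy; exact: bruhat_trans (bruhat_desNr ss dx).
    by rewrite (Rpol_bruhat nxy) !(mulr0, addr0, rmorph0, mul0r).
  by rewrite C // !rmorphD !rmorphM rmorphB /= rmorph1 -/Q; ring.
by rewrite /g rmorphB /= -/Q; ring.
Qed.

(** The uniqueness principle behind the product formula, the symmetry under inversion and the
    comparison with cosets. Downwards from w, the difference at x is bar-invariant and small. *)
Lemma KLpol_char w (f : 'S_n -> {poly int}) :
  (forall x, ~~ bruhat x w -> f x = 0) -> f w = 1 ->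
  (forall x, bruhat_lt x w -> (size (f x) <= (len w - len x).+1./2)%N) ->
  (forall x, evb (f x) * Q ^+ len w = Q ^+ len x * \sum_y ev (Rpol x y) * ev (f y)) ->
  f =1 (fun x => KLpol x w).
Proof.
move=> f0 f1 fd fb x; have [N] := ubnP (len w - len x); elim: N x => // N IH x ltN.
have [xw|nxw] := boolP (bruhat x w); last by rewrite f0 // KLpol_bruhat.
have [->|neq] := eqVneq x w; first by rewrite f1 KLpolxx.
have lt := bruhat_lt_neq xw neq.
apply/eqP; rewrite -subr_eq0; apply/eqP.
apply: (@bar_small0 (len x) (len w)); first exact: ltnW.
  rewrite (leq_trans (size_polyD _ _)) // size_polyN geq_max size_KLpol // fd //.
  by rewrite /bruhat_lt xw.
rewrite rmorphB mulrBl fb (evb_KLpol evbX ev_inj) -mulrBr; congr (_ * _).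
rewrite -sumrB (bigD1 x) //= big1 => [|y ny]; first by rewrite addr0 Rpolxx rmorph1 !mul1r rmorphB.
have [xy|/Rpol_bruhat->] := boolP (bruhat x y); last by rewrite rmorph0 !mul0r subrr.
have [yw|nyw] := boolP (bruhat y w); last by rewrite f0 // KLpol_bruhat // rmorph0 mulr0 subrr.
have lxy : (len x < len y)%N by apply: bruhat_lt_neq; rewrite // eq_sym.
by rewrite IH ?subrr //; move: (bruhat_len yw) ltN lxy; clear; lia.
Qed.

Lemma KLmul_xs s w x : is_simple s -> KLmul s w (x * s)%g = KLmul s w x.
Proof.
move=> ss; rewrite /KLmul desM // simpleK //; congr (_ - _).
  by case: (des x s) => /=; rewrite addrC.
by apply: eq_bigr => z /andP[dz _]; rewrite KLpol_des.
Qed.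

(** The unreduced product of the basis elements of [w] and [s] is bar-invariant: after pairing z
    with z s this follows from the recursion for R-polynomials. *)
Lemma evb_KLmul_main s w x : is_simple s -> ~~ des w s ->
  let M y := if des y s then KLpol (y * s)%g w + 'X * KLpol y w
             else 'X * KLpol (y * s)%g w + KLpol y w in
  evb (M x) * Q ^+ (len w).+1 = Q ^+ len x * \sum_y ev (Rpol x y) * ev (M y).
Proof.
move=> ss dw M.
have Mxs y : M (y * s)%g = M y.
  by rewrite /M desM // simpleK //; case: (des y s) => /=; rewrite addrC.
have bar_up y : ~~ des y s ->
    evb (M y) * Q ^+ (len w).+1 = Q ^+ len y * \sum_z ev (Rpol y z) * ev (M z).
  move=> dy; have bx := evb_KLpol evbX ev_inj y w.
  have bxs := evb_KLpol evbX ev_inj (y * s)%g w.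
  rewrite {1}/M (negbTE dy) rmorphD rmorphM evbX -/Q exprS.
  transitivity (evb (KLpol (y * s)%g w) * Q ^+ len w + Q * (evb (KLpol y w) * Q ^+ len w)).
    by move: Q Q0 => q q0; field.
  rewrite bx bxs (len_desN ss dy) exprS -/Q.
  suff -> : \sum_z ev (Rpol y z) * ev (M z) =
      Q * (\sum_z ev (Rpol (y * s)%g z) * ev (KLpol z w)
           + \sum_z ev (Rpol y z) * ev (KLpol z w)) by ring.
  rewrite !(sum_pairs _ ss) -big_split mulr_sumr; apply: eq_bigr => z dz /=.
  have [-> ->] := Rpol_xs ss dy dz.
  rewrite Mxs /M (negbTE dz) !rmorphD !rmorphM rmorphB rmorph1 /= -/Q; ring.
have [dx|dx] := boolP (des x s); last exact: bar_up.
pose y := (x * s)%g; have dy : ~~ des y s by rewrite desM // dx.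
have ex : x = (y * s)%g by rewrite simpleK.
rewrite ex Mxs bar_up // (len_desN ss dy) exprSr -mulrA; congr (_ * _).
rewrite !(sum_pairs _ ss) mulr_sumr; apply: eq_bigr => z dz.
have [-> ->] := Rpol_xs ss dy dz.
rewrite Mxs !rmorphD !rmorphM rmorphB rmorph1 /= -/Q; ring.
Qed.

(** By [KLpol_char] it remains to bound degrees. For a descent s of x the bound can fail only in the
    top coefficient of 'X * P_{x,w}, which is [mubar x w]; the term z = x of the sum removes it. *)
Lemma KLpol_mul s w x : is_simple s -> ~~ des w s -> KLpol x (w * s)%g = KLmul s w x.
Proof.
move=> ss dw; have lws := len_desN ss dw.
have dws : des (w * s)%g s by rewrite desM.
have bws := bruhat_desNr ss dw.
have MS1 : KLmul s w (w * s)%g = 1.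
  rewrite /KLmul dws simpleK // KLpolxx (KLpol_bruhat (x := (w * s)%g)); last first.
    by apply/negP=> /bruhat_len; rewrite lws ltnn.
  rewrite mulr0 addr0 big1 ?subr0 // => z /andP[_ /bruhat_lt_len zw].
  rewrite (KLpol_bruhat (x := (w * s)%g)) ?mulr0 //.
  by apply/negP=> /bruhat_len; rewrite lws; move: zw; clear; lia.
symmetry; apply: (@KLpol_char (w * s)%g (KLmul s w)) => {x} //.
- move=> x nx; rewrite /KLmul.
  have -> : KLpol (x * s)%g w = 0.
    apply: KLpol_bruhat; apply: contra nx => h.
    by rewrite -(simpleK x ss); exact: bruhat_desN.
  have nxw : ~~ bruhat x w by apply: contra nx => h; exact: bruhat_trans h bws.
  rewrite (KLpol_bruhat nxw) !mulr0 addr0 if_same big1 ?subrr // => z /and3P[_ zw _].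
  by rewrite KLpol_bruhat ?mulr0 //; apply: contra nxw => h; exact: bruhat_trans h zw.
- have sizeM x : des x s -> bruhat_lt x (w * s)%g ->
      (size (KLmul s w x) <= (len (w * s)%g - len x).+1./2)%N.
    move=> dx /andP[xws nx]; have lx := len_des ss dx.
    have ltx := bruhat_lt_neq xws nx.
    have nxw : x != w by apply: contraTneq dx => ->.
    have nxs : (x * s)%g != w by apply: contraNneq nx => <-; rewrite simpleK.
    have odE z : mubar z w != 0 -> bruhat_lt z w -> odd (len w - len z).
      by move=> + zw; rewrite mubar_lt //; case: odd; rewrite ?eqxx.
    rewrite /KLmul dx (bigID (pred1 x)).
    set S1 := \sum_(z | _ && pred1 x z) _; set S2 := \sum_(z | _ && ~~ _) _.
    rewrite (_ : _ - _ = KLpol (x * s)%g w + ('X * KLpol x w - S1) - S2);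
      last by rewrite -[X in _ - X]/(S1 + S2) opprD !addrA.
    rewrite (leq_trans (size_polyD _ _)) // size_polyN geq_max; apply/andP; split.
      rewrite (leq_trans (size_polyD _ _)) // geq_max; apply/andP; split.
        apply: leq_trans (size_KLpol nxs) _; apply: half_leq.
        by move: lws lx ltx; clear; lia.
      apply/leq_sizeP => i hi; rewrite /S1 coefB coefXM.
      have sz := size_KLpol nxw.
      have hd := double_half_succ (len (w * s)%g - len x).
      have hd' := double_half_succ (len w - len x).
      rewrite ifN; last by move: hi ltx; clear; case: i => //; case: (len x); lia.
      have [xw|nxw'] := boolP (bruhat x w); last first.
        rewrite KLpol_bruhat // coef0 big1 ?coef0 ?subr0 // => z /andP[/andP[_ /andP[zw _]] /eqP zx].
        by move: nxw'; rewrite -zx zw.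
      have ltxw : bruhat_lt x w by rewrite /bruhat_lt xw.
      have lxw := bruhat_lt_len ltxw.
      rewrite (big_pred1 x) => [|z]; last first.
        by have [->|nzx] := eqVneq z x; rewrite /= ?dx ?ltxw ?eqxx // (negbTE nzx) andbF.
      rewrite KLpolxx mulr1 coefCM coefXn mubar_lt //.
      have [ei|ne] := eqVneq i ((len w - len x).+1./2).
        case: ifP => od; rewrite ?mul0r ?mulr1 ?subr0 ei.
          rewrite (_ : (len w - len x).-1./2 = ((len w - len x).+1./2).-1) ?subrr //.
          by move: lxw od; clear; lia.
        have eD : (len (w * s)%g - len x = (len w - len x).+1)%N by rewrite lws subSn // ltnW.
        by exfalso; move: hi hd hd'; rewrite ei eD od [odd _.+1]/= od; clear; lia.
      rewrite mulr0 subr0 nth_default // (leq_trans sz) //.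
      by move: ne hi hd hd' lxw lws; clear; case: odd; case: odd; lia.
    rewrite /S2; apply: (big_ind (fun p : {poly int} => (size p <= _)%N)) => [|p r sp sr|z].
    - by rewrite size_poly0.
    - by rewrite (leq_trans (size_polyD _ _)) // geq_max sp.
    move=> /andP[/andP[dz zw] nzx]; have ltz := bruhat_lt_len zw.
    have [->|nmu] := eqVneq (mubar z w) 0; first by rewrite !mul0r size_poly0.
    have od := odE _ nmu zw.
    have [xz|/KLpol_bruhat->] := boolP (bruhat x z); last by rewrite mulr0 size_poly0.
    rewrite -mulrA mul_polyC (leq_trans (size_scale_leq _ _)) //.
    have [->|nP] := eqVneq (KLpol x z) 0; first by rewrite mulr0 size_poly0.
    rewrite mulrC size_mulXn //.
    have ltxz : (len x < len z)%N by apply: bruhat_lt_neq; rewrite // eq_sym.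
    have sz : x != z by rewrite eq_sym.
    apply: leq_trans (_ : (len w - len z).+1./2 + (len z - len x).+1./2 <= _)%N.
      by rewrite leq_add2l size_KLpol.
    have := double_half_succ (len w - len z); have := double_half_succ (len z - len x).
    have := double_half_succ (len (w * s)%g - len x).
    by rewrite lws od; move: ltz ltxz; clear; case: odd; case: odd; lia.
  move=> x xws; have [dx|dx] := boolP (des x s); first exact: sizeM.
  case/andP: xws => xws nx; have lx := len_desN ss dx.
  rewrite -KLmul_xs //; have [->|nxw] := eqVneq x w.
    by rewrite MS1 size_poly1 lws subSnn.
  apply: leq_trans (sizeM _ _ _) _; first by rewrite desM.
    by rewrite /bruhat_lt (inj_eq (mulIg s)) nxw bruhat_des.
  by apply/half_leq; rewrite lx; clear; lia.
move=> x; rewrite lws rmorphB mulrBl evb_KLmul_main //.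
under [X in _ = _ * X]eq_bigr => y _ do rewrite rmorphB mulrBr.
rewrite sumrB mulrBr; congr (_ - _).
rewrite rmorph_sum mulr_suml.
under [X in _ = _ * X]eq_bigr => y _ do rewrite rmorph_sum mulr_sumr.
rewrite exchange_big mulr_sumr; apply: eq_bigr => z /andP[_ zw] /=.
have ltz := bruhat_lt_len zw.
have [-> | nmu] := eqVneq (mubar z w) 0.
  rewrite !mul0r rmorph0 mul0r big1 ?mulr0 // => y _.
  by rewrite !mul0r rmorph0 mulr0.
have od : odd (len w - len z).
  by move: nmu; rewrite mubar_lt //; case: odd; rewrite ?eqxx.
(* As l(w) - l(z) is odd, 2 e = l(w) + 1 - l(z) exactly, so the factor q^e makes the term
   bar-invariant with respect to l(w) + 1. *)
set e := ((len w - len z).+1./2)%N.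
have ee : ((len w).+1 = e + (e + len z))%N.
  have := double_half_succ (len w - len z); rewrite od -/e -addnn.
  by move: e ltz => e; clear; lia.
have bz := evb_KLpol evbX ev_inj x z.
rewrite !rmorphM !rmorphXn evbX (evbC evb) ee !exprD -/Q.
transitivity (Q ^+ e * (mubar z w)%:~R * (evb (KLpol x z) * Q ^+ len z)).
  rewrite !exprVn; move: (expf_neq0 e Q0); move: (Q ^+ e) => qe qe0; field; exact: qe0.
rewrite bz mulrCA; congr (_ * _); rewrite mulr_sumr; apply: eq_bigr => y _.
by rewrite !rmorphM !rmorphXn (evC ev) -/Q -/e; ring.
Qed.

End Multiplication.

(** The field of fractions of Z[q], with the inclusion and the specialisation q -> 1/q. *)
Lemma exists_bar : exists (K : fieldType) (ev evb : {rmorphism {poly int} -> K}),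
  evb 'X = (ev 'X)^-1 /\ injective ev.
Proof.
pose K : fieldType := {fraction {poly int}}.
pose q : K := tofrac ('X : {poly int}).
exists K, (@tofrac {poly int} : {rmorphism {poly int} -> K}).
exists (horner_eval q^-1 \o map_poly (intr : int -> K)).
split; first by rewrite /= map_polyX /horner_eval hornerX.
by move=> f g /eqP; rewrite tofrac_eq => /eqP.
Qed.

(** * Edge coefficients, commuting multiplications at q = 1, star operations *)

Section Mubar.

Variable n : nat.
Implicit Types (r s t u v w x y z : 'S_n).

Lemma KLpol_mulr s x w : is_simple s -> des w s -> KLpol (x * s)%g w = KLpol x w.
Proof. by have [K [ev [evb [e1 e2]]]] := exists_bar; exact: KLpol_des e1 e2 n s x w. Qed.

Lemma KLpol_rec s w x : is_simple s -> ~~ des w s -> KLpol x (w * s)%g = KLmul s w x.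
Proof. by have [K [ev [evb [e1 e2]]]] := exists_bar; exact: KLpol_mul e1 e2 n s w x. Qed.

Lemma bruhat_ltV v w : bruhat_lt v^-1%g w^-1%g = bruhat_lt v w.
Proof.
rewrite /bruhat_lt (inj_eq invg_inj); congr (_ && _).
by apply/idP/idP => /bruhatV //; rewrite !invgK.
Qed.

Lemma KLpolV x w : KLpol x^-1%g w^-1%g = KLpol x w.
Proof.
have [K [ev [evb [e1 e2]]]] := exists_bar.
apply: (KLpol_char e1 e2 (f := fun x => KLpol x^-1%g w^-1%g)) => {x} [x nx||x xw|x].
- by apply: KLpol_bruhat; apply: contra nx => /bruhatV; rewrite !invgK.
- by rewrite KLpolxx.
- have /andP[_ neq] := xw.
  by have := @size_KLpol n x^-1%g w^-1%g; rewrite (inj_eq invg_inj) !len_inv; exact.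
have := evb_KLpol e1 e2 x^-1%g w^-1%g; rewrite !len_inv => ->; congr (_ * _).
rewrite (reindex_inj invg_inj) /=; apply: eq_bigr => y _.
by rewrite RpolV.
Qed.

Lemma mubarV v w : mubar v^-1%g w^-1%g = mubar v w.
Proof. by rewrite /mubar !bruhat_ltV !len_inv !KLpolV. Qed.

Lemma mubar_neq0 v w : mubar v w != 0 -> bruhat_lt v w \/ bruhat_lt w v.
Proof.
by rewrite /mubar; case: ifP => [|_]; [left|case: ifP; [right|rewrite eqxx]].
Qed.

(** P_{v,w} = P_{vs,w}, and the degree bound for the shorter interval from v s to w excludes the top
    coefficient, unless v s = w. *)
Lemma mubar_des s v w : is_simple s -> des w s -> ~~ des v s -> bruhat_lt v w ->
  mubar v w != 0 -> w = (v * s)%g.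
Proof.
move=> ss dw dv vw; rewrite mubar_lt //; case: ifP => od; last by rewrite eqxx.
apply: contraNeq => neq; have lt := bruhat_lt_len vw.
rewrite -(KLpol_mulr v ss dw) nth_default //.
apply: leq_trans (size_KLpol _) _; first by rewrite eq_sym.
rewrite (len_desN ss dv); move: od; rewrite -(subnSK lt) /= uphalf_half => /negbTE->.
by [].
Qed.

Lemma mubar_step s v : is_simple s -> ~~ des v s -> mubar v (v * s)%g = 1.
Proof.
move=> ss dv; have lv := len_desN ss dv.
have neq : v != (v * s)%g by apply/eqP=> e; move: lv; rewrite -e; lia.
rewrite mubar_lt; last by rewrite /bruhat_lt bruhat_desNr.
by rewrite lv subSnn /= -(KLpol_mulr v ss) ?desM // KLpolxx coef1.
Qed.

Lemma mubar_ldes t v w : is_simple t -> ldes t w -> ~~ ldes t v -> bruhat_lt v w ->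
  mubar v w != 0 -> w = (t * v)%g.
Proof.
move=> st; rewrite !ldesV // -bruhat_ltV -mubarV => dw dv vw mu.
by apply: invg_inj; rewrite (mubar_des st dw dv vw mu) invMg (simpleV st).
Qed.

Lemma mubar_lstep t v : is_simple t -> ~~ ldes t v -> mubar v (t * v)%g = 1.
Proof.
by move=> st; rewrite ldesV // -mubarV invMg (simpleV st); exact: mubar_step.
Qed.

(** The coefficient of x in the Kazhdan-Lusztig basis element of w of the integral group ring. *)
Definition KL1 x w : int := (KLpol x w).[1].

Lemma KL1V x w : KL1 x^-1%g w^-1%g = KL1 x w.
Proof. by rewrite /KL1 KLpolV. Qed.

(* The matrix of right multiplication by 1 + s in the Kazhdan-Lusztig basis,  *)
(* at q = 1.                                                                  *)
Definition Rcoef s v w : int :=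
  if des v s then (v == w)%:R *+ 2 else (des w s)%:R * mubar v w.

Definition Lcoef t v w : int :=
  if ldes t v then (v == w)%:R *+ 2 else (ldes t w)%:R * mubar v w.

(** The product formula at q = 1. Its leading term is the only contribution from above v, since
    [mubar_des] leaves only v s there. *)
Lemma KL1_Rcoef s x v : is_simple s ->
  KL1 (x * s)%g v + KL1 x v = \sum_w Rcoef s v w * KL1 x w.
Proof.
move=> ss; have [dv|dv] := boolP (des v s).
  under eq_bigr => w _ do rewrite /Rcoef dv.
  rewrite (bigD1 v) //= big1 => [|w nw]; last by rewrite eq_sym (negbTE nw) mul0rn mul0r.
  by rewrite eqxx addr0 /KL1 KLpol_mulr // mulrnAl mul1r mulr2n.
under eq_bigr => w _ do rewrite /Rcoef (negbTE dv).
have := congr1 (fun p => p.[1]) (KLpol_rec x ss dv); rewrite /KLmul hornerD hornerN horner_sum.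
rewrite -/(KL1 _ _) => /eqP; rewrite eq_sym subr_eq => /eqP e.
transitivity (KL1 x (v * s)%g + \sum_(z | des z s && bruhat_lt z v) mubar z v * KL1 x z).
  transitivity (if des x s then KLpol (x * s)%g v + 'X * KLpol x v
                else 'X * KLpol (x * s)%g v + KLpol x v).[1].
    by case: ifP; rewrite /KL1 !hornerE.
  rewrite e; congr (_ + _); apply: eq_bigr => z _.
  by rewrite !hornerE expr1n mulr1.
rewrite [RHS](bigD1 (v * s)%g) //= desM // dv mul1r mubar_step // mul1r; congr (_ + _).
rewrite [RHS](bigID (fun z => des z s && bruhat_lt z v)) /= [X in _ + X]big1 ?addr0 => [|z].
  rewrite [RHS](eq_bigl (fun z => des z s && bruhat_lt z v)) => [|z].
    by apply: eq_bigr => z /andP[-> _]; rewrite mul1r mubar_sym.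
  have [->|//] := eqVneq z (v * s)%g.
  apply/esym/negbTE; rewrite negb_and orbC; apply/orP; left.
  by apply/negP=> /bruhat_lt_len; rewrite (len_desN ss dv); lia.
case/andP=> nz; rewrite negb_and; case: (boolP (des z s)) => [dz|_ _]; last by rewrite !mul0r.
rewrite /= => nzv; rewrite mul1r; have [->|mu] := eqVneq (mubar v z) 0; first by rewrite mul0r.
case: (mubar_neq0 mu) => [vz|zv]; last by rewrite zv in nzv.
by rewrite (mubar_des ss dz dv vz mu) eqxx in nz.
Qed.

Lemma LcoefE t v w : is_simple t -> Lcoef t v w = Rcoef t v^-1%g w^-1%g.
Proof. by move=> st; rewrite /Lcoef /Rcoef !ldesV // (inj_eq invg_inj) mubarV. Qed.

Lemma KL1_Lcoef t x v : is_simple t ->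
  KL1 (t * x)%g v + KL1 x v = \sum_w Lcoef t v w * KL1 x w.
Proof.
move=> st; rewrite -(KL1V (t * x)%g) -(KL1V x) invMg (simpleV st) KL1_Rcoef //.
rewrite (reindex_inj invg_inj) /=; apply: eq_bigr => w _.
by rewrite LcoefE // KL1V.
Qed.

Lemma KL1_free (c : 'S_n -> int) : (forall x, \sum_w c w * KL1 x w = 0) -> forall w, c w = 0.
Proof.
move=> c0 w; apply/eqP; apply/negPn/negP=> nc.
have [z ncz maxz] := @arg_maxnP _ w (fun z => c z != 0) (@len n) nc.
move/eqP: (c0 z); rewrite (bigD1 z) //= big1 => [|y ny].
  by rewrite addr0 /KL1 KLpolxx hornerC mulr1 (negbTE ncz).
have [->|ncy] := eqVneq (c y) 0; first by rewrite mul0r.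
rewrite /KL1 KLpol_bruhat ?horner0 ?mulr0 //; apply/negP=> zy.
have := bruhat_lt_neq zy; rewrite eq_sym => /(_ ny); rewrite ltnNge => /negP; apply.
exact: maxz.
Qed.

(** Left and right multiplications of the group ring commute; since the basis is unitriangular,
    coefficients may be compared. *)
Lemma Lcoef_Rcoef_comm s t v w : is_simple s -> is_simple t ->
  \sum_u Lcoef t v u * Rcoef s u w = \sum_u Rcoef s v u * Lcoef t u w.
Proof.
move=> ss st; apply/eqP; rewrite -subr_eq0; apply/eqP; move: w; apply: KL1_free => x.
pose G := KL1 (t * x * s)%g v + KL1 (t * x)%g v + (KL1 (x * s)%g v + KL1 x v).
have G1 : G = \sum_w (\sum_u Lcoef t v u * Rcoef s u w) * KL1 x w.
  transitivity (\sum_u Lcoef t v u * (KL1 (x * s)%g u + KL1 x u)).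
    under eq_bigr do rewrite mulrDr.
    by rewrite big_split /= -!KL1_Lcoef // /G mulgA; ring.
  under eq_bigr => u _ do rewrite KL1_Rcoef // mulr_sumr.
  rewrite exchange_big /=; apply: eq_bigr => w _; rewrite mulr_suml.
  by apply: eq_bigr => u _; rewrite mulrA.
have G2 : G = \sum_w (\sum_u Rcoef s v u * Lcoef t u w) * KL1 x w.
  transitivity (\sum_u Rcoef s v u * (KL1 (t * x)%g u + KL1 x u)).
    under eq_bigr do rewrite mulrDr.
    by rewrite big_split /= -!KL1_Rcoef.
  under eq_bigr => u _ do rewrite KL1_Lcoef // mulr_sumr.
  rewrite exchange_big /=; apply: eq_bigr => w _; rewrite mulr_suml.
  by apply: eq_bigr => u _; rewrite mulrA.
under eq_bigr => w _ do rewrite mulrBl.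
by rewrite sumrB -G1 -G2 subrr.
Qed.

(** Left descents persist along the edges for right multiplication: losing t would force w = u r = t
    u or u = t w = w r, and both contradict the lengths. *)
Lemma mubar_des_ldes r t u w : is_simple r -> is_simple t ->
  ~~ des u r -> des w r -> mubar u w != 0 -> ldes t u -> ldes t w.
Proof.
move=> sr st du dw mu lu; apply/negPn/negP=> lw.
case: (mubar_neq0 mu) => [uw|wu].
  have ew := mubar_des sr dw du uw mu.
  have e : (t * u = u * r)%g by apply: exchange => //; rewrite -ew (negbTE lw) lu.
  by move: lu; rewrite /ldes e (len_desN sr du); lia.
rewrite mubar_sym in mu; have eu := mubar_ldes st lu lw wu mu.
have e : (t * w = w * r)%g by apply: exchanger => //; rewrite -eu (negbTE du) dw.
by move: dw; rewrite /des -e -eu; move: (bruhat_lt_len wu); lia.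
Qed.

Section Star.

Variables s t : 'S_n.
Hypotheses (ss : is_simple s) (st : is_simple t).

Lemma star_unique v u : ldes t v -> ~~ ldes s v -> ldes s u -> ~~ ldes t u ->
  mubar v u != 0 -> u = (s * v)%g \/ u = (t * v)%g.
Proof.
move=> tv sv su tu mu; case: (mubar_neq0 mu) => h; first by left; apply: mubar_ldes mu.
rewrite mubar_sym in mu; right; rewrite (mubar_ldes st tv tu h mu).
by rewrite mulgA (simple2 st) mul1g.
Qed.

Lemma mubar_star v v' : ldes t v -> ~~ ldes s v -> ldes s v' -> ~~ ldes t v' ->
  v' = (s * v)%g \/ v' = (t * v)%g -> mubar v v' = 1.
Proof.
move=> tv sv sv' tv' [->|ev]; first exact: mubar_lstep.
have -> : v = (t * v')%g by rewrite ev mulgA (simple2 st) mul1g.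
by rewrite mubar_sym mubar_lstep.
Qed.

End Star.

(* Star operations (Knuth moves on positions) preserve the W-graph of the     *)
(* commuting action on values: compare the entry (v, w') of the two products  *)
(* in Lcoef_Rcoef_comm.                                                       *)
Lemma Rcoef_star r s t v w v' w' : is_simple r -> is_simple s -> is_simple t ->
  (forall x, ldes t x -> ~~ ldes s x -> ldes s (t * x)%g -> ldes t (s * x)%g) ->
  (forall x, ldes s x -> ~~ ldes t x -> ldes t (s * x)%g -> ldes s (t * x)%g) ->
  ldes t v -> ~~ ldes s v -> ldes s v' -> ~~ ldes t v' -> v' = (s * v)%g \/ v' = (t * v)%g ->
  ldes t w -> ~~ ldes s w -> ldes s w' -> ~~ ldes t w' -> w' = (s * w)%g \/ w' = (t * w)%g ->
  Rcoef r v w = Rcoef r v' w'.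
Proof.
move=> sr ss st Hts Hst tv sv sv' tv' ev tw sw sw' tw' ew.
(* At most one of s x and t x can have s and not t among its left descents; the hypotheses [Hts] and
   [Hst] express this. *)
have uniq1 x y z : ldes t x -> ~~ ldes s x -> ldes s y -> ~~ ldes t y ->
    y = (s * x)%g \/ y = (t * x)%g ->
    ldes s z -> ~~ ldes t z -> z = (s * x)%g \/ z = (t * x)%g -> y = z.
  move=> tx sx sy ty [ey|ey] sz tz [ez|ez]; rewrite ?ey ?ez //.
    by move: ty; rewrite ey Hts // -ez.
  by move: tz; rewrite ez Hts // -ey.
have uniq2 x y z : ldes s x -> ~~ ldes t x -> ldes t y -> ~~ ldes s y ->
    y = (s * x)%g \/ y = (t * x)%g ->
    ldes t z -> ~~ ldes s z -> z = (s * x)%g \/ z = (t * x)%g -> y = z.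
  move=> tx sx sy ty [ey|ey] sz tz [ez|ez]; rewrite ?ey ?ez //.
    by move: tz; rewrite ez Hst // -ey.
  by move: ty; rewrite ey Hst // -ez.
have flip x y : y = (s * x)%g \/ y = (t * x)%g -> x = (s * y)%g \/ x = (t * y)%g.
  by move=> [->|->]; [left|right]; rewrite mulgA (simple2 ss, simple2 st) mul1g.
have := Lcoef_Rcoef_comm v w' sr ss.
(* On this side only u = v' contributes: a term with t among the left descents of u would give t to
   w' as well. *)
rewrite (bigD1 v') //= big1 => [|u nu]; last first.
  rewrite /Lcoef (negbTE sv); case: (boolP (ldes s u)) => [su|]; last by rewrite !mul0r.
  have [->|mu] := eqVneq (mubar v u) 0; first by rewrite mulr0 mul0r.
  have [tu|tu] := boolP (ldes t u); last first.
    by rewrite (uniq1 v u v' tv sv su tu (star_unique ss st tv sv su tu mu)) ?eqxx in nu.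
  rewrite /Rcoef; case: ifP => [du|/negbT du].
    have -> : (u == w') = false by apply: contraNF tw' => /eqP <-.
    by rewrite mul0rn mulr0.
  case: (boolP (des w' r)) => [dw'|]; last by rewrite mul0r mulr0.
  have [->|mu'] := eqVneq (mubar u w') 0; first by rewrite !mulr0.
  by rewrite (mubar_des_ldes sr st du dw' mu' tu) in tw'.
(* Here u inherits t from v, so only the star partner w of w' remains. *)
rewrite (bigD1 w) //= big1 => [|u nu]; last first.
  have [->|Ru] := eqVneq (Rcoef r v u) 0; first by rewrite mul0r.
  have tu : ldes t u.
    move: Ru; rewrite /Rcoef; case: ifP => [_|/negbT dv].
      by have [<-|] := eqVneq v u; rewrite ?mul0rn ?eqxx.
    have [->|mu] := eqVneq (mubar v u) 0; first by rewrite mulr0 eqxx.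
    case: (boolP (des u r)) => [du _|]; last by rewrite mul0r eqxx.
    exact: mubar_des_ldes sr st dv du mu tv.
  rewrite /Lcoef; case: ifP => [su|/negbT su].
    have -> : (u == w') = false by apply: contraNF tw' => /eqP <-.
    by rewrite mul0rn mulr0.
  have [->|mu] := eqVneq (mubar u w') 0; first by rewrite !mulr0.
  have h := star_unique ss st tu su sw' tw' mu.
  by rewrite (uniq2 w' u w) ?eqxx // in nu; exact: flip.
rewrite !addr0 /Lcoef (negbTE sv) (negbTE sw) sv' sw' !mul1r.
by rewrite (mubar_star ss st tv sv sv' tv' ev) (mubar_star ss st tw sw sw' tw' ew) mul1r mulr1 => ->.
Qed.

End Mubar.

(** * Cosets of S_(n-1) *)

Section Parabolic.

Variables (n : nat) (p : 'I_n.+1).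
Implicit Types (s v w x y : 'S_n).

(* As p varies, the images of phi are the cosets phi 1 * Sembed 'S_n: those
   permutations with n in position p. *)
Local Notation phi := (lift_perm p (@ord_max n)).

Lemma phiM v w : phi (v * w)%g = (phi v * Sembed w)%g.
Proof. by rewrite /Sembed lift_permM. Qed.

Lemma phi_inj : injective phi.
Proof.
move=> v w e; apply/permP => a; have := congr1 (fun u : 'S_n.+1 => u (lift p a)) e.
by rewrite !lift_perm_lift => /lift_inj.
Qed.

Lemma Sembed_simple s : is_simple s -> is_simple (Sembed s).
Proof.
case/simpleP=> i [k [ik ->]]; apply/simpleP.
by exists (lift ord_max i), (lift ord_max k); rewrite !lift_max Sembed_tperm.
Qed.

Lemma ltn_lift (a b : 'I_n) : (lift p a < lift p b)%N = (a < b)%N.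
Proof. by rewrite !ltnNge /= leq_bump2. Qed.

Lemma phi_permV w (a : 'I_n) : (phi w)^-1%g (lift ord_max a) = lift p (w^-1%g a).
Proof. by rewrite lift_permV lift_perm_lift. Qed.

Lemma des_phi w s : is_simple s -> des (phi w) (Sembed s) = des w s.
Proof.
case/simpleP=> i [k [ik ->]]; rewrite Sembed_tperm /des !des_simple //.
  by rewrite !phi_permV ltn_lift.
by rewrite !lift_max.
Qed.

Lemma len_phi w : len (phi w) = (len w + len (phi 1%g))%N.
Proof.
have [N] := ubnP (len w); elim: N w => // N IH w ltN.
have [->|w1] := eqVneq w 1%g; first by rewrite len1.
have [s ss d] := exists_des w1.
have lt : (len (w * s)%g < N)%N by apply: leq_trans d _; rewrite -ltnS.
have d' : des (phi w) (Sembed s) by rewrite des_phi.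
rewrite (len_des (Sembed_simple ss) d') -phiM IH // (len_des ss d).
by [].
Qed.

Lemma len_phiB v w : (len (phi v) - len (phi w) = len v - len w)%N.
Proof. by rewrite (len_phi v) (len_phi w) subnDr. Qed.

Lemma bruhat_step_max (v w : 'S_n.+1) : bruhat_step v w ->
  (w^-1%g ord_max <= v^-1%g ord_max)%N.
Proof.
case/bruhat_stepP=> a [b [ab vab ->]]; rewrite invMg tpermV permM.
have [eb|neb] := eqVneq b ord_max; first by rewrite -eb tpermR ltnW.
by rewrite tpermD // -val_eqE neq_ltn (leq_trans ab) // -ltnS ltn_ord.
Qed.

Lemma bruhat_max (v w : 'S_n.+1) : bruhat v w -> (w^-1%g ord_max <= v^-1%g ord_max)%N.
Proof.
case/connectP=> q; elim: q v => [|y q IH] v /=; first by move=> _ ->.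
case/andP=> /bruhat_step_max vy yq ew; exact: leq_trans (IH y yq ew) vy.
Qed.

Lemma phi_surj (y : 'S_n.+1) : y^-1%g ord_max = p -> exists y', y = phi y'.
Proof.
move=> yp; have yp' : y p = ord_max by rewrite -yp permKV.
have inj : injective (fun a : 'I_n => odflt a (unlift ord_max (y (lift p a)))).
  move=> a b; case: unliftP => [c ec|/esym]; last first.
    by rewrite -yp' => /perm_inj /eqP; rewrite (negbTE (neq_lift _ _)).
  case: unliftP => [d ed|/esym]; last first.
    by rewrite -yp' => /perm_inj /eqP; rewrite (negbTE (neq_lift _ _)).
  by move=> /= cd; move: ec; rewrite cd -ed => /perm_inj /lift_inj.
exists (perm inj); apply/permP => a; have [b ->|->] := unliftP p a.
  rewrite lift_perm_lift permE; case: unliftP => [c ->//|/esym].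
  by rewrite -yp' => /perm_inj /eqP; rewrite (negbTE (neq_lift _ _)).
by rewrite lift_perm_id.
Qed.

Lemma phi_max w : (phi w)^-1%g ord_max = p.
Proof. by rewrite lift_permV lift_perm_id. Qed.

Lemma bruhat_interval_phi x w (y : 'S_n.+1) : bruhat (phi x) y -> bruhat y (phi w) ->
  exists y', y = phi y'.
Proof.
move=> /bruhat_max; rewrite phi_max => h1 /bruhat_max; rewrite phi_max => h2.
by apply: phi_surj; apply/val_inj/eqP; rewrite eqn_leq h1.
Qed.

Lemma bruhat_step_phi x w : bruhat_step (phi x) (phi w) = bruhat_step x w.
Proof.
rewrite /bruhat_step (len_phi x) (len_phi w) ltn_add2r.
apply/andP/andP => -[lt /existsP[a /existsP[b /eqP e]]]; split=> //; last first.
  apply/existsP; exists (lift ord_max a); apply/existsP; exists (lift ord_max b).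
  by rewrite e phiM Sembed_tperm.
have nab : a != b.
  by apply: contraTneq lt => ab; move: e; rewrite ab tperm1 mulg1 => /phi_inj ->; rewrite ltnn.
have tmax : tperm a b ord_max = ord_max.
  by have := congr1 (fun u : 'S_n.+1 => u p) e; rewrite permM !lift_perm_id.
have [a' ea|ea] := unliftP ord_max a; last first.
  by move: tmax nab; rewrite ea tpermL => ->; rewrite eqxx.
have [b' eb|eb] := unliftP ord_max b; last first.
  by move: tmax nab; rewrite eb tpermR => ->; rewrite eqxx.
apply/existsP; exists a'; apply/existsP; exists b'; apply/eqP/phi_inj.
by rewrite e phiM Sembed_tperm ea eb.
Qed.

Lemma bruhat_phi x w : bruhat (phi x) (phi w) = bruhat x w.
Proof.
apply/idP/idP=> [|/connectP[q]].
  have [N] := ubnP (len w - len x); elim: N x => // N IH x ltN h.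
  have [->|neq] := eqVneq x w; first exact: connect0.
  case/connectP: (h) => -[|y q] /=; first by move=> _ /phi_inj e; rewrite e eqxx in neq.
  case/andP=> xy yq ew; have yw : bruhat y (phi w) by apply/connectP; exists q.
  have [y' ey] := bruhat_interval_phi (connect1 xy) yw.
  move: xy yw; rewrite ey bruhat_step_phi => xy yw.
  apply: connect_trans (connect1 xy) (IH _ _ yw).
  have /andP[lt _] := xy; have := bruhat_len h.
  rewrite (len_phi x) (len_phi w) leq_add2r => le.
  have := bruhat_len yw; rewrite (len_phi y') (len_phi w) leq_add2r.
  by move: ltN lt; clear; lia.
elim: q x => [|y q IH] x /=; first by move=> _ ->; exact: connect0.
case/andP=> xy yq ew; apply: connect_trans (IH y yq ew); apply: connect1.
by rewrite bruhat_step_phi.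
Qed.

Lemma bruhat_lt_phi x w : bruhat_lt (phi x) (phi w) = bruhat_lt x w.
Proof. by rewrite /bruhat_lt bruhat_phi (inj_eq phi_inj). Qed.

(** [phi] is in general no morphism, but it commutes with right multiplication by S_n, which is all
    that the recursion uses. *)
Lemma Rpol_phi x w : Rpol (phi x) (phi w) = Rpol x w.
Proof.
have [N] := ubnP (len w); elim: N x w => // N IH x w ltN.
have [->|w1] := eqVneq w 1%g.
  have [->|x1] := eqVneq x 1%g; first by rewrite !Rpolxx.
  have nb : ~~ bruhat x 1%g.
    by apply/negP=> b; have := bruhat_lt_neq b x1; rewrite len1.
  by rewrite !Rpol_bruhat // bruhat_phi.
have [s ss d] := exists_des w1.
have lt : (len (w * s)%g < N)%N by apply: leq_trans d _; rewrite -ltnS.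
have ss' := Sembed_simple ss.
have d' : des (phi w) (Sembed s) by rewrite des_phi.
by rewrite (Rpol_des _ ss d) (Rpol_des _ ss' d') /Rop des_phi // -!phiM !IH.
Qed.

(** The restriction to the coset satisfies the conditions of [KLpol_char]: the bar identity sums
    over a Bruhat interval, which stays in the coset by convexity, and the constant shift of lengths
    cancels. *)
Lemma KLpol_phi x w : KLpol (phi x) (phi w) = KLpol x w.
Proof.
have [K [ev [evb [e1 e2]]]] := exists_bar; have Q0 := evX_neq0 e2.
apply: (KLpol_char e1 e2 (f := fun x => KLpol (phi x) (phi w))) => {x} [x nx||x xw|x].
- by rewrite KLpol_bruhat // bruhat_phi.
- by rewrite KLpolxx.
- by have /andP[_ neq] := xw; rewrite -len_phiB size_KLpol // (inj_eq phi_inj).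
have e := evb_KLpol e1 e2 (phi x) (phi w).
rewrite (len_phi x) (len_phi w) !exprD mulrA [RHS]mulrAC in e.
move/(mulIf (expf_neq0 _ Q0)): e => ->; congr (_ * _).
rewrite (bigID (mem (phi @: [set: 'S_n]))) /= [X in _ + X]big1 ?addr0 => [|y ny].
  rewrite big_imset /=; last by move=> v u _ _; exact: phi_inj.
  by apply: eq_big => [y|y _]; rewrite ?inE // Rpol_phi.
have [xy|/Rpol_bruhat->] := boolP (bruhat (phi x) y); last by rewrite rmorph0 mul0r.
have [yw|/KLpol_bruhat->] := boolP (bruhat y (phi w)); last by rewrite rmorph0 mulr0.
have [y' ey] := bruhat_interval_phi xy yw.
by case/negP: ny; rewrite ey imset_f ?inE.
Qed.

Lemma mubar_phi x w : mubar (phi x) (phi w) = mubar x w.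
Proof. by rewrite /mubar !bruhat_lt_phi !KLpol_phi !len_phiB. Qed.

End Parabolic.

(** * Independence of the recording tableau *)

Section Words.

Local Open Scope nat_scope.

Variable n : nat.
Implicit Types (v w : 'S_n) (t : seq (seq nat)) (ys zs xs : seq nat).

Definition word w : seq nat := [seq val (w i) | i <- enum 'I_n].

Lemma size_word w : size (word w) = n.
Proof. by rewrite size_map size_enum_ord. Qed.

Lemma nth_word w (i : 'I_n) : nth 0 (word w) i = w i.
Proof. by rewrite (nth_map i) ?size_enum_ord // nth_ord_enum. Qed.

Lemma word_inj : injective word.
Proof.
move=> v w e; apply/permP => i; apply: val_inj.
by rewrite /= -!nth_word e.
Qed.

Lemma word_perm w : perm_eq (word w) (iota 0 n).
Proof.
apply: uniq_perm; rewrite ?iota_uniq //.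
  by rewrite map_inj_uniq ?enum_uniq // => i j /val_inj/perm_inj.
move=> x; rewrite mem_iota add0n /=; apply/mapP/idP => [[i _ ->]|lt]; first exact: ltn_ord.
by exists (w^-1%g (Ordinal lt)); rewrite ?mem_enum // permKV.
Qed.

Lemma word_surj xs : perm_eq xs (iota 0 n) -> exists w, word w = xs.
Proof.
move=> p; have sz : size xs = n by rewrite (perm_size p) size_iota.
have lt (i : 'I_n) : nth 0 xs i < n.
  have : nth 0 xs i \in xs by rewrite mem_nth // sz.
  by rewrite (perm_mem p) mem_iota.
have ux : uniq xs by rewrite (perm_uniq p) iota_uniq.
have inj : injective (fun i => Ordinal (lt i)).
  by move=> i j [] /eqP; rewrite nth_uniq ?sz // => /eqP /val_inj.
exists (perm inj); apply: (@eq_from_nth _ 0); rewrite ?size_word ?sz // => i lti.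
by rewrite -(_ : val (Ordinal lti) = i) // nth_word permE.
Qed.

Lemma word_swap w (i k : 'I_n) A B a b : k = i.+1 :> nat -> size A = i ->
  word w = A ++ [:: a, b & B] -> word (tperm i k * w)%g = A ++ [:: b, a & B].
Proof.
move=> ik sA e; apply: (@eq_from_nth _ 0) => [|j].
  by rewrite size_word -(size_word w) e !size_cat.
rewrite size_word => lt; have [J <-] : exists J : 'I_n, val J = j by exists (Ordinal lt).
rewrite nth_word permM [\val J]/=  {j lt}.
have wi : w i = a :> nat by rewrite -nth_word e nth_cat sA ltnn subnn.
have wk : w k = b :> nat.
  by rewrite -nth_word e nth_cat sA ik ltnNge leqnSn /= subSn // subnn.
have [<-|ni] := eqVneq i J.
  by rewrite tpermL wk nth_cat sA ltnn subnn.
have [<-|nk] := eqVneq k J.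
  by rewrite tpermR wi nth_cat sA ik ltnNge leqnSn /= subSn // subnn.
rewrite tpermD // -nth_word e !nth_cat sA /=; case: ltnP => // ij.
move: ni nk; rewrite -!val_eqE /= ik => ni nk.
have : 2 <= J - i by move: ni nk ij; clear; lia.
by case: (J - i) => [|[|m]].
Qed.

Lemma good_word w : good [::] (word w).
Proof. by rewrite /good /= cats0 (perm_uniq (word_perm w)) iota_uniq. Qed.

Lemma ins_good t xs ys : good t (xs ++ ys) -> [::] \notin t ->
  good (ins t xs).1 ys /\ [::] \notin (ins t xs).1.
Proof.
elim: xs t => [|x xs IH] t //= g ne.
have [g1 ne1] := row_insert_good g ne; have [g2 ne2] := IH _ g1 ne1.
by move: g2 ne2; case: (row_insert t x) => t1 i /=; case: (ins t1 xs).
Qed.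

Lemma ins_word_inj v w : ins [::] (word v) = ins [::] (word w) -> v = w.
Proof.
move=> e; apply: word_inj.
have [] // := @ins_inj [::] [::] (word v) (word w) _ (good_word v) (good_word w) isT isT e.
by rewrite !size_word.
Qed.

(* w' is obtained from w by the star operation for the positions P0, P1, P2. *)
Definition starred (P0 P1 P2 : 'I_n) w w' :=
  let s := tperm P0 P1 in let t := tperm P1 P2 in
  [/\ ldes t w, ~~ ldes s w, ldes s w', ~~ ldes t w' &
      w' = (s * w)%g \/ w' = (t * w)%g].

Lemma Rcoef_starred (r : 'S_n) (P0 P1 P2 : 'I_n) v w v' w' : is_simple r ->
  P1 = P0.+1 :> nat -> P2 = P1.+1 :> nat ->
  starred P0 P1 P2 v v' -> starred P0 P1 P2 w w' -> Rcoef r v w = Rcoef r v' w'.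
Proof.
move=> sr e01 e12 [tv sv sv' tv' ev] [tw sw sw' tw' ew].
have ss : is_simple (tperm P0 P1) by apply/simpleP; exists P0, P1.
have st : is_simple (tperm P1 P2) by apply/simpleP; exists P1, P2.
have n01 := succ_neq e01; have n12 := succ_neq e12; have n02 := succ2_neq e01 e12.
have s2 : tperm P0 P1 P2 = P2 by rewrite tpermD.
have t0 : tperm P1 P2 P0 = P0 by rewrite tpermD // eq_sym.
apply: (@Rcoef_star n r (tperm P0 P1) (tperm P1 P2)) => //.
- by move=> x; rewrite !ldes_simple // !permM !tpermL !tpermR s2 t0.
- by move=> x; rewrite !ldes_simple // !permM !tpermL !tpermR s2 t0.
Qed.

Lemma ins_cat3 t0 A xs B : ins t0 (A ++ xs ++ B) =
  let tA := ins t0 A in let tx := ins tA.1 xs in let tB := ins tx.1 B in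
  (tB.1, tA.2 ++ tx.2 ++ tB.2).
Proof. by rewrite !ins_cat. Qed.

(** By the row bumping lemma the order of neighbouring letters can be read off the rows of their
    boxes. *)
Lemma ins3 t a b c i j k : good t [:: a; b; c] -> [::] \notin t ->
  (ins t [:: a; b; c]).2 = [:: i; j; k] ->
  [/\ (a < b) = (j <= i), (b < c) = (k <= j), a != b, b != c & a != c].
Proof.
move=> g ne e; have /andP[st u] := g.
have g2 : good t [:: a; b].
  by rewrite /good st /=; move: u; rewrite /= !inE !negb_or => /and4P[/and3P[-> _ ->] /andP[_ ->] _ ->].
have [ab ac bc] : [/\ a != b, a != c & b != c].
  by move: u; rewrite /= !inE !negb_or => /and4P[/and3P[-> -> _] /andP[-> _]].
have [g3 _] := row_insert_good g ne.
move: (@ins2_lt t a b g2) (@ins2_gt t a b g2) (@ins2_lt _ b c g3) (@ins2_gt _ b c g3) e => /=.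
case: (row_insert t a) => t1 i1 /=; case: (row_insert t1 b) => t2 i2 /=.
case: (row_insert t2 c) => t3 i3 /= l1 h1 l2 h2 [<- <- <-].
split=> //.
  case: (ltngtP a b) ab => // h _; first by rewrite l1.
  by rewrite leqNgt h1.
case: (ltngtP b c) bc => // h _; first by rewrite l2.
by rewrite leqNgt h2.
Qed.

(** A move of recording words, lifted to permutations with the same insertion tableau. *)
Definition star_step (R : 'S_n -> 'S_n -> Prop) A B i j k i' j' k' :=
  forall t w, ins [::] (word w) = (t, A ++ [:: i; j; k] ++ B) ->
  exists w', ins [::] (word w') = (t, A ++ [:: i'; j'; k'] ++ B) /\ R w w'.

Lemma word_cut t w A B i j k : ins [::] (word w) = (t, A ++ [:: i; j; k] ++ B) ->
  exists XA a b c XB, let tA := (ins [::] XA).1 in let tx := ins tA [:: a; b; c] in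
  [/\ word w = XA ++ [:: a; b; c] ++ XB, size XA = size A, [::] \notin tA,
      good tA [:: a; b; c] & 
      [/\ (ins [::] XA).2 = A, tx.2 = [:: i; j; k], (ins tx.1 XB).2 = B & (ins tx.1 XB).1 = t]].
Proof.
move=> e; have sz : size (word w) = size A + 3 + size B.
  by rewrite -(size_ins [::]) e !size_cat /= addnA.
pose XA := take (size A) (word w); pose Y := take 3 (drop (size A) (word w)).
pose XB := drop 3 (drop (size A) (word w)).
have eW : word w = XA ++ Y ++ XB by rewrite !cat_take_drop.
have sA : size XA = size A by rewrite size_takel // sz -addnA leq_addr.
have sY : size Y = 3 by rewrite size_takel // size_drop sz -addnA addKn leq_addr.
move: sY eW; rewrite -/XB; case: Y => [|a [|b [|c [|]]]] // _ eW.
exists XA, a, b, c, XB; have gw := good_word w; rewrite eW in gw e.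
have [gA nA] := ins_good gw isT.
have gabc : good (ins [::] XA).1 [:: a; b; c].
  move: gA; rewrite /good => /andP[-> u]; rewrite andTb; apply: (subseq_uniq _ u).
  by rewrite -catA cat_subseq // suffix_subseq.
move: e; rewrite ins_cat3 /= => -[et /eqP].
rewrite eqseq_cat ?size_ins // => /andP[/eqP eA].
have sx : size (ins (ins [::] XA).1 [:: a; b; c]).2 = 3 by rewrite size_ins.
rewrite -[_ ++ _]/((ins (ins [::] XA).1 [:: a; b; c]).2 ++ _).
rewrite -[[:: i, j, k & B]]/([:: i; j; k] ++ B) eqseq_cat // => /andP[/eqP ex /eqP eB].
by split.
Qed.

Section Star.

Variables P0 P1 P2 : 'I_n.
Hypotheses (e01 : P1 = P0.+1 :> nat) (e12 : P2 = P1.+1 :> nat).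

Let s := tperm P0 P1.
Let t := tperm P1 P2.

Lemma word3 w XA XB a b c : word w = XA ++ [:: a; b; c] ++ XB -> size XA = P0 ->
  [/\ w P0 = a :> nat, w P1 = b :> nat, w P2 = c :> nat,
      word (s * w)%g = XA ++ [:: b; a; c] ++ XB & word (t * w)%g = XA ++ [:: a; c; b] ++ XB].
Proof.
move=> e sA; split.
- by rewrite -nth_word e nth_cat sA ltnn subnn.
- by rewrite -nth_word e nth_cat sA e01 ltnNge leqnSn /= subSn // subnn.
- by rewrite -nth_word e nth_cat sA e12 e01 ltnNge leqW //= -addn2 addKn.
- exact: (word_swap e01 sA).
rewrite (@word_swap w P1 P2 (rcons XA a) XB b c) ?cat_rcons // size_rcons sA e01 //.
Qed.

Lemma starP : [/\ s P2 = P2, t P0 = P0, s P0 = P1 & s P1 = P0] /\ (t P1 = P2 /\ t P2 = P1).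
Proof.
have n01 := succ_neq e01; have n12 := succ_neq e12; have n02 := succ2_neq e01 e12.
by rewrite /s /t !tpermL !tpermR !tpermD // eq_sym.
Qed.

Lemma starred_s w : w P0 < w P2 -> w P2 < w P1 -> starred P0 P1 P2 w (s * w)%g.
Proof.
have [[s2 t0 s0 s1] [t1 t2]] := starP => h1 h2; have h3 := ltn_trans h1 h2.
split; rewrite ?ldes_simple // ?permM ?s0 ?s1 ?s2 //; last by left.
  by rewrite -leqNgt ltnW.
by rewrite -leqNgt ltnW.
Qed.

Lemma starred_t w : w P2 < w P0 -> w P0 < w P1 -> starred P0 P1 P2 w (t * w)%g.
Proof.
have [[s2 t0 s0 s1] [t1 t2]] := starP => h1 h2; have h3 := ltn_trans h1 h2.
split; rewrite ?ldes_simple // ?permM ?t0 ?t1 ?t2 //; last by right.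
  by rewrite -leqNgt ltnW.
by rewrite -leqNgt ltnW.
Qed.

Lemma star_down A B i j k : size A = P0 -> j <= i -> i < k ->
  star_step (starred P0 P1 P2) A B i j k i k j.
Proof.
move=> sA ji ik u w e.
have [XA [a [b [c [XB [eW sXA nA g [eA ex eB et]]]]]]] := word_cut e.
have [lab lbc nab nbc nac] := ins3 g nA ex; rewrite sA in sXA.
have [w0 w1 w2 ws wt] := word3 eW sXA.
have ab : a < b by rewrite lab.
have cb : c < b by rewrite ltn_neqAle eq_sym nbc leqNgt lbc -ltnNge (leq_ltn_trans ji).
have sw : swap_rows i j k = [:: i; k; j] by rewrite /swap_rows ik.
have swE i1 j1 k1 : [:: i; j; k] = [:: i1; j1; k1] -> swap_rows i1 j1 k1 = [:: i; k; j].
  by case=> <- <- <-.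
case: (ltngtP a c) nac => // [ac|ca] _.
  have g' : good (ins [::] XA).1 [:: a; c; b] by rewrite -(good_perm _ (perm3 a b c).1.1.1).
  have [[i1 [j1 [k1 [e0 e1 e2]]]] _] := ins_knuth ac cb g'.
  rewrite ex in e0; rewrite (swE _ _ _ e0) in e1; exists (s * w)%g; split; last first.
    by apply: starred_s; rewrite ?w0 ?w1 ?w2.
  by rewrite ws ins_cat3 /= -/(ins _ [:: b; a; c]) e1 e2 eA eB et.
have g' : good (ins [::] XA).1 [:: c; a; b] by rewrite -(good_perm _ (perm3 a b c).2).
have [_ [i1 [j1 [k1 [e0 e1 e2]]]]] := ins_knuth ca ab g'.
rewrite ex in e0; rewrite (swE _ _ _ e0) in e1; exists (t * w)%g; split; last first.
  by apply: starred_t; rewrite ?w0 ?w1 ?w2.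
by rewrite wt ins_cat3 /= -/(ins _ [:: a; c; b]) e1 e2 eA eB et.
Qed.

Lemma star_up A B i j k : size A = P0 -> j <= i -> i < k ->
  star_step (fun w w' => starred P0 P1 P2 w' w) A B i k j i j k.
Proof.
move=> sA ji ik u w e.
have [XA [a [b [c [XB [eW sXA nA g [eA ex eB et]]]]]]] := word_cut e.
have [lab lbc nab nbc nac] := ins3 g nA ex; rewrite sA in sXA.
have [w0 w1 w2 ws wt] := word3 eW sXA.
have [[s2 t0 s0 s1] [t1 t2]] := starP.
have bc : b < c by rewrite lbc ltnW // (leq_ltn_trans ji).
have ba : b < a by rewrite ltn_neqAle eq_sym nab leqNgt lab -ltnNge.
(* Of the two preimages that [swap_rows] could have, j1 < k1 excludes the one coming from an
   exchange of the first two rows. *)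
have swE i1 j1 k1 : j1 < k1 -> [:: i; k; j] = swap_rows i1 j1 k1 -> [:: i1; j1; k1] = [:: i; j; k].
  move=> jk; rewrite /swap_rows; case: ifP => _ [e1 e2 e3]; first by rewrite e1 e2 e3.
  by move: jk; rewrite -e1 -e3 ltnNge ji.
case: (ltngtP a c) nac => // [ac|ca] _.
  have g' : good (ins [::] XA).1 [:: b; a; c] by rewrite -(good_perm _ (perm3 a b c).1.1.2).
  have [_ [i1 [j1 [k1 [e1 e2 e3]]]]] := ins_knuth ba ac g'.
  have g2 : good (ins [::] XA).1 [:: a; c; b] by rewrite -(good_perm _ (perm3 a b c).1.1.1).
  have [_ cb1 _ _ _] := ins3 g2 nA e1.
  have jk1 : j1 < k1 by rewrite ltnNge -cb1 -leqNgt ltnW.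
  rewrite ex in e2; have eijk := swE _ _ _ jk1 e2; exists (t * w)%g; split; last first.
    have := @starred_t (t * w)%g; rewrite !permM t0 t1 t2 w0 w1 w2 => /(_ ba ac) h.
    by rewrite mulgA tperm2 mul1g in h.
  by rewrite wt ins_cat3 /= -/(ins _ [:: a; c; b]) e1 eijk -e3 eA eB et.
have g' : good (ins [::] XA).1 [:: b; c; a] by rewrite -(good_perm _ (perm3 a b c).1.2).
have [[i1 [j1 [k1 [e1 e2 e3]]]] _] := ins_knuth bc ca g'.
have g2 : good (ins [::] XA).1 [:: b; a; c] by rewrite -(good_perm _ (perm3 a b c).1.1.2).
have [_ cb1 _ _ _] := ins3 g2 nA e1.
have jk1 : j1 < k1 by rewrite ltnNge -cb1 -leqNgt ltnW.
rewrite ex in e2; have eijk := swE _ _ _ jk1 e2; exists (s * w)%g; split; last first.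
  have := @starred_s (s * w)%g; rewrite !permM s0 s1 s2 w0 w1 w2 => /(_ bc ca) h.
  by rewrite mulgA tperm2 mul1g in h.
by rewrite ws ins_cat3 /= -/(ins _ [:: b; a; c]) e1 eijk -e3 eA eB et.
Qed.

End Star.

End Words.

(** * Transport of the W-graph between recording tableaux *)

Section Independence.

Local Open Scope nat_scope.

Variable n : nat.
Implicit Types (v w r : 'S_n) (t : seq (seq nat)) (ys zs xs : seq nat).

(* The W-graphs of the left cells with recording tableaux ys and zs agree. *)
Definition linked ys zs := forall t1 t2 w1 w2,
  ins [::] (word w1) = (t1, ys) -> ins [::] (word w2) = (t2, ys) ->
  exists w1' w2', [/\ ins [::] (word w1') = (t1, zs), ins [::] (word w2') = (t2, zs) &
    forall r, is_simple r -> Rcoef r w1 w2 = Rcoef r w1' w2'].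

(** The positions of the star operation are those of the move in the recording word, hence the same
    for both permutations, and [Rcoef_starred] applies. *)
Lemma dualK_linked ys zs : dualK ys zs -> linked ys zs /\ linked zs ys.
Proof.
elim=> {ys zs} [ys|zs ys xs _ [h1 h1'] _ [h2 h2']|ys zs _ []|A B i j k ji ik] //.
- by split=> t1 t2 w1 w2 e1 e2; exists w1, w2.
- split=> t1 t2 w1 w2 e1 e2.
    have [w3 [w4 [e3 e4 h]]] := h1 _ _ _ _ e1 e2.
    have [w5 [w6 [e5 e6 h']]] := h2 _ _ _ _ e3 e4.
    by exists w5, w6; split=> // r sr; rewrite h // h'.
  have [w3 [w4 [e3 e4 h]]] := h2' _ _ _ _ e1 e2.
  have [w5 [w6 [e5 e6 h']]] := h1' _ _ _ _ e3 e4.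
  by exists w5, w6; split=> // r sr; rewrite h // h'.
have pos i' j' k' t w : ins [::] (word w) = (t, A ++ [:: i'; j'; k'] ++ B) ->
    exists P0 P1 P2 : 'I_n, [/\ size A = P0, P1 = P0.+1 :> nat & P2 = P1.+1 :> nat].
  move=> e; have sz : n = size A + (size B).+3.
    by rewrite -(size_word w) -(size_ins [::]) e size_cat.
  have l2 : (size A).+2 < n by rewrite sz; clear; lia.
  have l1 := ltnW l2; have l0 := ltnW l1.
  by exists (Ordinal l0), (Ordinal l1), (Ordinal l2).
split=> t1 t2 w1 w2 e1 e2; have [P0 [P1 [P2 [sA e01 e12]]]] := pos _ _ _ _ _ e1.
  have [w1' [e1' s1]] := star_down e01 e12 sA ji ik e1.
  have [w2' [e2' s2]] := star_down e01 e12 sA ji ik e2.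
  by exists w1', w2'; split=> // r sr; apply: Rcoef_starred s1 s2.
have [w1' [e1' s1]] := star_up e01 e12 sA ji ik e1.
have [w2' [e2' s2]] := star_up e01 e12 sA ji ik e2.
by exists w1', w2'; split=> // r sr; symmetry; apply: Rcoef_starred s1 s2.
Qed.

Variable la : seq nat.
Hypothesis la_n : is_partition n la.
Implicit Types T S Q : SYT n la.

Lemma rows_syt T : is_syt n la (rows T).
Proof. by case: T. Qed.

Lemma rowword_perm t : perm_eq (flatten t) (iota 0 n) -> perm_eq (rowword t) (iota 0 n).
Proof. by apply: perm_trans; apply: perm_flatten; rewrite perm_rev. Qed.

(** The representative of [T] used from here on; its recording word [word_steps la] is the same for
    all [T] of shape [la]. By [word_surj] the default is never taken. *)
Definition rowperm T : 'S_n := odflt 1%g [pick w | word w == rowword (rows T)].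

Lemma word_rowperm T : word (rowperm T) = rowword (rows T).
Proof.
rewrite /rowperm; case: pickP => [w /eqP //|no].
have [w ew] := word_surj (rowword_perm (syt_perm (rows_syt T))).
by have := no w; rewrite ew eqxx.
Qed.

Lemma ins_rowperm T : ins [::] (word (rowperm T)) = (rows T, word_steps la).
Proof.
by rewrite word_rowperm ins_rowword ?(syt_shape (rows_syt T)) // (syt_tab la_n (rows_syt T)).
Qed.

Lemma RSK_word w :
  RSK w = ((ins [::] (word w)).1, recording (ins [::] (word w)).2).
Proof. exact: RSK_foldl. Qed.

(** The dual Knuth moves from [word_steps la] to the word of [Q] carry the row reading word of [T]
    to a permutation with tableaux [T] and [Q], so that the default of [RSK_inv] is not taken. *)
Lemma ins_RSK_inv T Q : ins [::] (word (RSK_inv T Q)) = (rows T, yam n (rows Q)).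
Proof.
have [h _] := dualK_linked (dualK_yam la_n (rows_syt Q)).
have [w [_ [ew _ _]]] := h _ _ _ _ (ins_rowperm T) (ins_rowperm T).
have eR : RSK w = (rows T, rows Q) by rewrite RSK_word ew (recording_yam la_n (rows_syt Q)).
rewrite /RSK_inv; case: pickP => [w' /eqP|no] /=; last by have := no w; rewrite eR eqxx.
rewrite RSK_word => -[e1 e2]; rewrite [LHS]surjective_pairing e1; congr (_, _).
apply: recording_inj; first by rewrite size_ins size_word size_map size_iota.
by rewrite e2 (recording_yam la_n (rows_syt Q)).
Qed.

(* The W-graph of the left cell does not depend on the recording tableau. *)
Lemma Rcoef_RSK_inv r T S Q : is_simple r ->
  Rcoef r (RSK_inv T Q) (RSK_inv S Q) = Rcoef r (rowperm T) (rowperm S).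
Proof.
have [h _] := dualK_linked (dualK_yam la_n (rows_syt Q)).
have [w1 [w2 [e1 e2 hr]]] := h _ _ _ _ (ins_rowperm T) (ins_rowperm S).
move=> sr; rewrite hr //; congr (Rcoef _ _ _); apply: ins_word_inj.
  by rewrite e1 ins_RSK_inv.
by rewrite e2 ins_RSK_inv.
Qed.

(** The diagonal entry is 2 at a descent and 0 otherwise; thus whatever preserves [Rcoef] preserves
    descents. *)
Lemma Rcoef_diag r w : is_simple r -> des w r = (Rcoef r w w == 2%:R%R).
Proof.
move=> sr; rewrite /Rcoef eqxx; case: (des w r) => //=.
by rewrite GRing.mul0r.
Qed.

Lemma index_word w (i : 'I_n) : index (i : nat) (word w) = w^-1%g i.
Proof.
rewrite -[X in index X _](_ : nth 0 (word w) (w^-1%g i) = i); last by rewrite nth_word permKV.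
by rewrite index_uniq ?size_word // (perm_uniq (word_perm w)) iota_uniq.
Qed.

(** Rows are read from bottom to top and increase from left to right, so the larger letter comes
    earlier exactly when it lies in a lower row. *)
Lemma index_rowword t a b : uniq (flatten t) -> all (sorted ltn) t ->
  a \in flatten t -> b \in flatten t -> a < b ->
  (index b (rowword t) < index a (rowword t)) = (row_of t a < row_of t b).
Proof.
elim: t => //= r t IH; rewrite cat_uniq => /and3P[_ /hasPn d u] /andP[sr st].
rewrite !mem_cat => ha hb ab; rewrite rowword_cons !index_cat /row_of /=.
have memw x : (x \in rowword t) = (x \in flatten t).
  by apply: perm_mem; apply: perm_flatten; rewrite perm_rev.
rewrite !memw; have [ar|nar] := boolP (a \in r); have [br|nbr] := boolP (b \in r).
- have -> : (a \in flatten t) = false by apply/negP => /d; rewrite ar.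
  have -> : (b \in flatten t) = false by apply/negP => /d; rewrite br.
  rewrite ltn_add2l ltnn; apply/negP => /(sorted_ltn_index ltn_trans sr _ _ br ar).
  by rewrite ltnNge ltnW.
- have -> : (a \in flatten t) = false by apply/negP => /d; rewrite ar.
  by move: hb; rewrite (negbTE nbr) /= => hb; rewrite hb ltn_addr // index_mem memw.
- have -> : (b \in flatten t) = false by apply/negP => /d; rewrite br.
  move: ha; rewrite (negbTE nar) /= => ha; rewrite ha ltn0; apply: negbTE; rewrite -leqNgt.
  by rewrite (leq_trans (index_size _ _)) ?leq_addr.
- move: ha hb; rewrite (negbTE nar) (negbTE nbr) /= => ha hb.
  by rewrite ha hb ltnS; apply: IH.
Qed.

Lemma des_rowperm T (i k : 'I_n) : k = i.+1 :> nat ->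
  des (rowperm T) (tperm i k) = descent T i.
Proof.
move=> ik; rewrite /des des_simple // -!index_word word_rowperm index_rowword ?ik //.
- exact: (syt_uniq (rows_syt T)).
- by case/and4P: (rows_syt T).
- by rewrite (syt_mem (rows_syt T)).
- by rewrite -ik (syt_mem (rows_syt T)).
Qed.

Lemma des_RSK_inv T Q (i k : 'I_n) : k = i.+1 :> nat ->
  des (RSK_inv T Q) (tperm i k) = descent T i.
Proof.
move=> ik; have sr : is_simple (tperm i k) by apply/simpleP; exists i, k.
by rewrite Rcoef_diag // Rcoef_RSK_inv // -Rcoef_diag // des_rowperm.
Qed.

(** The asymmetric descents are those for which [Rcoef] displays the coefficient [mubar], and those
    occurring in the Kazhdan-Lusztig formulas. *)
Lemma mubar_syt_rowperm Q T S (i k : 'I_n) : k = i.+1 :> nat ->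
  ~~ descent T i -> descent S i -> mubar_syt Q T S = mubar (rowperm T) (rowperm S).
Proof.
move=> ik dT dS; have sr : is_simple (tperm i k) by apply/simpleP; exists i, k.
have := Rcoef_RSK_inv T S Q sr.
rewrite /Rcoef !(des_RSK_inv _ _ ik) !(des_rowperm _ ik) (negbTE dT) dS.
by rewrite !GRing.mul1r.
Qed.

End Independence.

(** * Removing the largest entry *)

Section LatticeSyt.

Local Open Scope nat_scope.

Implicit Types (la ys zs s : seq nat) (t : seq (seq nat)) (n r c k : nat).

Lemma count_lt_nth s c k : sorted ltn s -> c < count (fun j => j < k) s -> nth 0 s c < k.
Proof.
elim: s c => // x s IH c sx /=; have sl := path_sorted sx.
have [xk|kx] := ltnP x k; first by case: c => // c; rewrite add1n ltnS; exact: IH.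
rewrite add0n => lt; suff z : count (fun j => j < k) s = 0 by rewrite z in lt.
apply/eqP; rewrite -leqn0 leqNgt -has_count; apply/hasPn => y ys; rewrite -leqNgt.
have /allP/(_ y ys) xy := order_path_min ltn_trans sx.
exact: leq_trans kx (ltnW xy).
Qed.

Lemma nth_lt_count s c : sorted ltn s -> c < size s -> c < count (fun j => j < (nth 0 s c).+1) s.
Proof.
elim: s c => // x s IH [|c] sx /=; first by rewrite ltnSn.
rewrite ltnS => lt; have sl := path_sorted sx.
have /allP/(_ _ (mem_nth 0 lt)) xy := order_path_min ltn_trans sx.
by rewrite (leq_trans xy) // add1n ltnS IH.
Qed.

Lemma count_recording ys k r : k <= size ys ->
  count (fun j => j < k) (nth [::] (recording ys) r) = count_mem r (take k ys).
Proof.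
move=> kn; rewrite nth_recording.
have -> : count_mem r (take k ys) = count (fun j => nth 0 ys j == r) (iota 0 k).
  rewrite -[in LHS](mkseq_nth 0 ys) /mkseq -map_take take_iota (minn_idPl kn) count_map.
  by apply: eq_count.
rewrite -!size_filter; apply/perm_size/uniq_perm; rewrite ?filter_uniq ?iota_uniq //.
move=> j; rewrite !mem_filter !mem_iota !add0n /= andbCA; congr (_ && _).
by case: ltnP => //= jk; rewrite (leq_trans jk kn).
Qed.

Lemma sorted_recording ys r : sorted ltn (nth [::] (recording ys) r).
Proof. by rewrite nth_recording; apply: (sorted_filter ltn_trans _ (iota_ltn_sorted _ _)). Qed.

Lemma size_nth_recording ys r : size (nth [::] (recording ys) r) = count_mem r ys.
Proof.
rewrite -[X in count_mem r X](take_size ys) -count_recording //; apply/esym/eqP.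
rewrite -all_count nth_recording; apply/allP => j.
by rewrite mem_filter mem_iota => /andP[_].
Qed.

(** Converse of [lattice_yam]. When an entry is placed in column c of row r.+1, the lattice
    condition says that row r already reaches beyond column c. *)
Lemma lattice_syt la ys : 0 \notin la -> (forall r, count_mem r ys = nth 0 la r) ->
  lattice ys -> is_syt (size ys) la (recording ys).
Proof.
move=> la0 cnt lat; set t := recording ys.
have nz r : r < size la -> 0 < nth 0 la r.
  by move=> lt; rewrite lt0n; apply: contra la0 => /eqP <-; rewrite mem_nth.
have szt : size t = size la.
  apply/eqP; rewrite eqn_leq size_recording; apply/andP; split.
    apply/allP => y yin; rewrite ltnNge; apply/negP => ge.
    by move: yin; rewrite -has_pred1 has_count cnt nth_default.
  rewrite leqNgt; apply/negP => /nz.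
  by rewrite -cnt -size_nth_recording nth_default.
have sh : shape t = la.
  apply: (@eq_from_nth _ 0); rewrite ?size_map // => r lt.
  by rewrite (nth_map [::]) // size_nth_recording.
have mem j : (j \in flatten t) = (j < size ys).
  apply/flattenP/idP => [[s /(nthP [::])[r _ <-]]|lt].
    by rewrite nth_recording mem_filter mem_iota => /andP[_].
  exists (nth [::] t (nth 0 ys j)); last by rewrite nth_recording mem_filter eqxx mem_iota.
  rewrite mem_nth // szt ltnNge; apply/negP => ge.
  have : nth 0 ys j \in ys by rewrite mem_nth.
  by rewrite -has_pred1 has_count cnt nth_default.
apply/and4P; split; first by rewrite sh.
- have szf : size (flatten t) = size ys by rewrite size_flatten sumn_shape_recording.
  apply: uniq_perm; rewrite ?iota_uniq //; last by move=> j; rewrite mem mem_iota.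
  apply: (@leq_size_uniq _ (iota 0 (size ys))); rewrite ?iota_uniq ?size_iota ?szf //.
  by move=> j; rewrite mem mem_iota.
- by apply/(all_nthP [::]) => r _; apply: sorted_recording.
apply/(sortedP [::]) => r lt; apply/allP => c; rewrite mem_iota add0n /= => lc.
set j := nth 0 (nth [::] t r.+1) c.
have jn : j < size ys.
  rewrite -mem; apply/flattenP; exists (nth [::] t r.+1); rewrite mem_nth //.
have h := nth_lt_count (sorted_recording ys r.+1) lc; rewrite -/j count_recording // in h.
have h2 : c < count (fun i => i < j.+1) (nth [::] t r).
  by rewrite count_recording //; apply: leq_trans h (lat _ _).
have := count_lt_nth (sorted_recording ys r) h2; rewrite ltnS leq_eqVlt => /orP[/eqP e|//].
have : j \in nth [::] t r.
  rewrite -e mem_nth // (leq_trans h2) // count_size.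
  by [].
have : j \in nth [::] t r.+1 by rewrite mem_nth.
by rewrite !nth_recording !mem_filter => /andP[/eqP-> _] /andP[]; rewrite gtn_eqF.
Qed.

Lemma yam_recording la ys : is_syt (size ys) la (recording ys) ->
  yam (size ys) (recording ys) = ys.
Proof.
move=> st; apply: (@eq_from_nth _ 0) => [|j]; rewrite size_map size_iota // => lt.
rewrite (nth_map 0) ?size_iota // nth_iota // add0n.
have : j \in nth [::] (recording ys) (nth 0 ys j).
  by rewrite nth_recording mem_filter eqxx mem_iota.
by rewrite (syt_row_of st) => /andP[_ /eqP].
Qed.

Lemma insub_bseqK n (A : Type) (s : seq A) : size s <= n -> insub_bseq n s = s :> seq A.
Proof. by move=> le; rewrite /insub_bseq val_insubd le. Qed.

(** The type [SYT] bounds the number and the lengths of the rows by n; for a partition of n without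
    zero parts both bounds hold. *)
Lemma syt_exists n la t : is_partition n la -> is_syt n la t -> exists T : SYT n la, rows T = t.
Proof.
move=> /and3P[_ la0 /eqP sla] st; have sh := syt_shape st.
have sz : size t <= n.
  rewrite -sla -sh -(size_map size t) -/(shape t) sh; elim: (la) la0 => //= l s IH.
  rewrite inE negb_or eq_sym -lt0n => /andP[l0 /IH]; rewrite -add1n.
  exact: leq_add.
have szr (x : seq nat) : x \in t -> size x <= n.
  rewrite -sla -sh => /(nthP [::])[i lti <-]; elim: (t) i lti => // y u IH [|i] /=.
    by rewrite leq_addr.
  by rewrite ltnS => /IH h; rewrite (leq_trans h) ?leq_addl.
pose row (x : seq nat) : n.-bseq 'I_n := insub_bseq n (pmap insub x).
have rowE x : x \in t -> [seq val y | y <- row x] = x.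
  move=> xt; have xn y : y \in x -> y < n.
    by move=> yx; rewrite -(syt_mem st); apply/flattenP; exists x.
  have e : map val (pmap (insub : nat -> option 'I_n) x) = x.
    elim: x xn {xt} => //= y x IH h; rewrite insubT; first by apply: h; rewrite mem_head.
    by move=> yn /=; rewrite IH // => z zx; apply: h; rewrite inE zx orbT.
  by rewrite /row insub_bseqK // -(size_map val) e szr.
pose u : n.-bseq (n.-bseq 'I_n) := insub_bseq n [seq row x | x <- t].
have eu : tab_rows u = t.
  rewrite /tab_rows -[val u]/(bseqval u) insub_bseqK ?size_map //.
  by rewrite -map_comp -[RHS]map_id; apply/eq_in_map => x /rowE.
have su : is_syt n la (tab_rows u) by rewrite eu.
by exists (MkSYT su).
Qed.

Lemma rows_inj n la : injective (@rows n la).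
Proof.
move=> T S; rewrite /rows /tab_rows => e; apply/val_inj/val_inj.
apply: (inj_map _ e) => x y /(inj_map val_inj) exy; exact: val_inj.
Qed.

Lemma yam_inj n la (T S : SYT n la) : is_partition n la -> yam n (rows T) = yam n (rows S) -> T = S.
Proof.
move=> la_n e; apply: rows_inj.
by rewrite -(recording_yam la_n (rows_syt T)) e (recording_yam la_n (rows_syt S)).
Qed.

Lemma size_yam n t : size (yam n t) = n.
Proof. by rewrite size_map size_iota. Qed.

(** Tableaux of shape [la] are thus the lattice words of content [la], and deleting the largest
    entry is deleting the last letter. *)
Lemma yam_syt n la ys : is_partition n la -> size ys = n -> lattice ys ->
  (forall r, count_mem r ys = nth 0 la r) -> exists T : SYT n la, yam n (rows T) = ys.
Proof.
move=> la_n sz lat cnt; have la0 : 0 \notin la by case/and3P: la_n.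
have st := lattice_syt la0 cnt lat; move: (st); rewrite sz => /(syt_exists la_n)[T eT].
by exists T; rewrite eT -sz (yam_recording st).
Qed.

End LatticeSyt.

(** * Deleting and adding the largest entry *)

Section Removable.

Local Open Scope nat_scope.

Variables (n : nat) (la : seq nat).
Hypothesis la_n : is_partition n.+1 la.
Implicit Types (T S : SYT n.+1 la) (i r c : nat).

Let la_sorted : sorted geq la. Proof. by case/and3P: la_n. Qed.
Let la0 : 0 \notin la. Proof. by case/and3P: la_n. Qed.

Lemma nth_part_gt0 r : r < size la -> 0 < nth 0 la r.
Proof. by move=> lt; rewrite lt0n; apply: contra la0 => /eqP <-; rewrite mem_nth. Qed.

Lemma nth_decr_row r c : nth 0 (decr_row la c) r = nth 0 la r - (c == r).
Proof.
rewrite nth_set_nth /= eq_sym; case: eqP => [->|_]; last by rewrite subn0.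
by rewrite subn1.
Qed.

Lemma nth_part_geq (s : seq nat) r : sorted geq s -> nth 0 s r.+1 <= nth 0 s r.
Proof.
move=> sl; have [lt|ge] := ltnP r.+1 (size s); last by rewrite nth_default.
exact: (sortedP 0 sl).
Qed.

Lemma mem_removable c : (c \in removable la) = (c < size la) && sorted geq (decr_row la c).
Proof. by rewrite mem_filter mem_iota add0n andbC. Qed.

Lemma removable_sorted : sorted ltn (removable la).
Proof. exact: (sorted_filter ltn_trans _ (iota_ltn_sorted _ _)). Qed.

Definition top_row T := row_of (rows T) n.

Lemma yam_rcons (m : nat) (t : seq (seq nat)) : yam m.+1 t = rcons (yam m t) (row_of t m).
Proof. by rewrite /yam -addn1 iotaD map_cat cats1. Qed.

Lemma count_yam_top T r :
  count_mem r (yam n (rows T)) = nth 0 la r - (top_row T == r).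
Proof.
have := count_yam_all (rows_syt T) r; rewrite yam_rcons count_rcons1 => <-.
by rewrite addnK.
Qed.

Lemma lattice_yam_top T : lattice (yam n (rows T)).
Proof. by have := lattice_yam la_n (rows_syt T); rewrite yam_rcons => /lattice_rcons[]. Qed.

(** The word without its last letter is still a lattice word, so the shape without the box of n is a
    partition. *)
Lemma top_row_removable T : top_row T \in removable la.
Proof.
rewrite mem_removable; apply/andP; split.
  rewrite -(syt_shape (rows_syt T)) size_map /top_row.
  by have := @row_of_lt (rows T) n; rewrite (syt_mem (rows_syt T)) ltnSn => /(_ isT)[].
apply/(sortedP 0) => r _; rewrite /= !nth_decr_row -!count_yam_top.
by have := lattice_yam_top T n r; rewrite take_oversize ?size_yam.
Qed.

Lemma idx_bounds T : 1 <= idx T <= size (removable la).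
Proof. by rewrite /idx ltnS index_mem; exact: top_row_removable. Qed.

Lemma top_rowE T i : idx T = i -> top_row T = nth 0 (removable la) i.-1.
Proof. by move=> <-; rewrite /= nth_index // top_row_removable. Qed.

Lemma idx_nth T i : 1 <= i <= size (removable la) ->
  top_row T = nth 0 (removable la) i.-1 -> idx T = i.
Proof.
case: i => // i lt; rewrite /idx -/(top_row T) => ->; rewrite index_uniq //.
exact: (sorted_uniq ltn_trans ltnn removable_sorted).
Qed.

Lemma leq_idx T S : top_row S <= top_row T -> idx S <= idx T.
Proof.
apply: contraTT; rewrite -!ltnNge /idx ltnS => lt.
by apply: (sorted_ltn_index ltn_trans removable_sorted) lt; exact: top_row_removable.
Qed.

Section Delete.

Variable i : nat.
Hypothesis i_r : 1 <= i <= size (removable la).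

Let rho := nth 0 (removable la) i.-1.
Let mu := delete_removable la i.

Lemma rho_removable : (rho < size la) && sorted geq (decr_row la rho).
Proof. by rewrite -mem_removable mem_nth //; case: i i_r. Qed.

Lemma nth_filter_neq0 (s : seq nat) r : sorted geq s -> nth 0 [seq x <- s | x != 0] r = nth 0 s r.
Proof.
elim: s r => // x s IH r sx; have sl := path_sorted sx.
have [x0|nx0] := eqVneq x 0; last by rewrite /= nx0; case: r => //= r; exact: IH.
have z y : y \in s -> y = 0.
  move=> ys; have /allP/(_ y ys) := order_path_min (@rev_trans _ _ leq_trans) sx.
  by rewrite /= x0 leqn0 => /eqP.
rewrite /= x0 eqxx /=; have -> : [seq y <- s | y != 0] = [::].
  by apply/eqP; rewrite -size_eq0 size_filter -leqn0 leqNgt -has_count; apply/hasPn => y /z->.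
rewrite nth_nil; case: r => //= r; have [lt|ge] := ltnP r (size s); last by rewrite nth_default.
by rewrite (z _ (mem_nth 0 lt)).
Qed.

Lemma nth_delete r : nth 0 mu r = nth 0 la r - (rho == r).
Proof.
have /andP[_ s] := rho_removable.
by rewrite /mu /delete_removable nth_filter_neq0 // nth_decr_row.
Qed.

Lemma delete_partition : is_partition n mu.
Proof.
have /andP[lt s] := rho_removable; apply/and3P; split.
- by apply: sorted_filter s; exact: rev_trans leq_trans.
- by rewrite mem_filter eqxx.
have -> : sumn mu = sumn (decr_row la rho).
  by rewrite /mu /delete_removable; elim: (decr_row _ _) => //= -[|x] u //= ->.
rewrite /decr_row sumn_set_nth lt muln1; have /and3P[_ _ /eqP ->] := la_n.
rewrite (_ : 0 * _ = 0) // addn0; apply/eqP; have := nth_part_gt0 lt.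
have := la_n; case/and3P => _ _ /eqP e.
have : nth 0 la rho <= n.+1.
  rewrite -e; elim: (la) (rho) {lt s} => [|x u IH] [|c] //=; rewrite ?leq_addr //.
  by rewrite (leq_trans (IH c)) // leq_addl.
by case: (nth 0 la rho) => // m; lia.
Qed.

Implicit Types U : SYT n mu.

(* T is obtained from U by adding its largest entry at the end of row rho. *)
Definition extends T U := yam n.+1 (rows T) = rcons (yam n (rows U)) rho.

Lemma extends_idx T U : extends T U -> idx T = i.
Proof.
rewrite /extends yam_rcons => /rcons_inj[_ e]; exact: idx_nth.
Qed.

Lemma exists_delete T : idx T = i -> exists U, extends T U.
Proof.
move=> iT; have eT := top_rowE iT.
have [|||U eU] := @yam_syt n mu (yam n (rows T)) delete_partition.
- by rewrite size_yam.
- exact: lattice_yam_top.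
- by move=> r; rewrite count_yam_top nth_delete eT.
by exists U; rewrite /extends eU yam_rcons -/(top_row T) eT.
Qed.

Lemma exists_extends (ys : seq nat) : size ys = n -> lattice ys ->
  (forall r, count_mem r ys = nth 0 mu r) -> exists T, yam n.+1 (rows T) = rcons ys rho.
Proof.
move=> sz lat cnt; have cnt' r : count_mem r (rcons ys rho) = nth 0 la r.
  rewrite count_rcons1 cnt nth_delete; case: eqP => [<-|_]; last by rewrite subn0 addn0.
  by rewrite subnK // nth_part_gt0 //; case/andP: rho_removable.
apply: yam_syt => //; first by rewrite size_rcons sz.
by apply/lattice_rcons; split=> // r; rewrite !cnt'; exact: nth_part_geq.
Qed.

Lemma exists_add U : exists T, extends T U.
Proof.
apply: exists_extends; rewrite ?size_yam //.
  exact: lattice_yam delete_partition (rows_syt U).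
by move=> r; rewrite (count_yam_all (rows_syt U)).
Qed.

(** Needed for the strictness of the filtration: [word_steps mu] is at hand as a lattice word of
    content [mu]. *)
Lemma exists_idx : exists T, idx T = i.
Proof.
have /and3P[smu _ /eqP sz] := delete_partition.
have [||r|T eT] := @exists_extends (word_steps mu).
- by rewrite size_word_steps.
- exact: lattice_word_steps.
- exact: count_word_steps.
by exists T; apply: idx_nth => //; move: eT; rewrite yam_rcons => /rcons_inj[].
Qed.

End Delete.

End Removable.

(** * The largest letter in the row reading word *)

Section LiftWord.

Local Open Scope nat_scope.

Implicit Types (t : seq (seq nat)) (la s : seq nat).

Lemma size_rowword t : size (rowword t) = sumn (shape t).
Proof. by rewrite size_flatten /shape map_rev sumn_rev. Qed.

Lemma mem_rowword t x : (x \in rowword t) = (x \in flatten t).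
Proof. by apply: perm_mem; apply: perm_flatten; rewrite perm_rev. Qed.

Lemma index_max (s : seq nat) n : sorted ltn s -> n \in s -> (forall j, j \in s -> j <= n) ->
  (index n s).+1 = size s.
Proof.
elim: s => //= x s IH sx; rewrite inE => ns le; have [xn|nxn] := eqVneq x n.
  case: s {IH ns} sx le => // y s /= /andP[xy _] le.
  by have := le y; rewrite !inE eqxx orbT leqNgt -xn xy => /(_ isT).
rewrite IH ?(path_sorted sx) //; first by move: ns; rewrite eq_sym (negbTE nxn).
by move=> j js; apply: le; rewrite inE js orbT.
Qed.

(** The largest entry ends its row, so up to and including it the word contains exactly the boxes of
    this row and of the rows below. *)
Lemma index_rowword_max t n : all (sorted ltn) t -> uniq (flatten t) -> n \in flatten t ->
  (forall j, j \in flatten t -> j <= n) ->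
  (index n (rowword t)).+1 = sumn (drop (row_of t n) (shape t)).
Proof.
elim: t => //= r t IH /andP[sr st]; rewrite cat_uniq => /and3P[_ /hasPn d u].
rewrite mem_cat rowword_cons index_cat mem_rowword /row_of /= => nt le.
have [nr|nnr] := boolP (n \in r).
  have -> : (n \in flatten t) = false by apply/negP => /d; rewrite nr.
  rewrite -addnS index_max //; first by rewrite size_rowword addnC.
  by move=> j jr; apply: le; rewrite mem_cat jr.
move: nt; rewrite (negbTE nnr) /= => nt; rewrite nt IH //.
by move=> j jt; apply: le; rewrite mem_cat jt orbT.
Qed.

Lemma ltn_sumn_drop la a b : 0 \notin la -> a < b -> a < size la ->
  sumn (drop b la) < sumn (drop a la).
Proof.
elim: la a b => //= l la IH [|a] [|b] //=; rewrite inE negb_or eq_sym -lt0n => /andP[l0 la0].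
  move=> _ _; rewrite -[X in _ <= _ + sumn X](cat_take_drop b) sumn_cat.
  by rewrite addnCA; move: l0; clear; lia.
by rewrite !ltnS; exact: IH.
Qed.

Lemma rowword_record t c x : x \notin flatten t ->
  [seq y <- rowword (set_nth [::] t c (rcons (nth [::] t c) x)) | y != x] = rowword t.
Proof.
elim: t c => [|r t IH] [|c] /=; rewrite ?rowword_cons ?filter_cat //=.
- by rewrite eqxx.
- move=> _; rewrite cats0; have -> : rowword (ncons c [::] [:: [:: x]]) = [:: x].
    by elim: c => // c IH; rewrite /= rowword_cons cats0.
  by rewrite /= eqxx.
- rewrite mem_cat negb_or => /andP[xr xt].
  rewrite filter_rcons eqxx /= !(all_filterP _) //; apply/allP => y ys.
    by apply: contraNneq xr => <-.
  by apply: contraNneq xt => <-; rewrite -mem_rowword.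
- rewrite mem_cat negb_or => /andP[xr xt]; rewrite IH //; congr (_ ++ _).
  by apply/all_filterP/allP => y ys; apply: contraNneq xr => <-.
Qed.

Lemma filter_enum_lift n (p : 'I_n.+1) :
  [seq i <- enum 'I_n.+1 | i != p] = [seq lift p i | i <- enum 'I_n].
Proof.
apply: (inj_map val_inj); apply: (irr_sorted_eq ltn_trans ltnn).
- have -> : [seq val i | i <- enum 'I_n.+1 & i != p] =
      [seq j <- iota 0 n.+1 | j != p :> nat].
    by rewrite -val_enum_ord filter_map.
  exact: (sorted_filter ltn_trans _ (iota_ltn_sorted _ _)).
- rewrite -map_comp (eq_map (g := bump p \o val)) // map_comp val_enum_ord.
  apply: (homo_sorted (e := ltn)) (iota_ltn_sorted _ _) => a b /= ab.
  by rewrite /bump; move: (p : nat) ab => q; lia.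
move=> j; apply/mapP/mapP => -[x].
  rewrite mem_filter => /andP[xp _] ->; exists x => //.
  rewrite eq_sym in xp; have [k -> _] := unlift_some xp; by apply: map_f; rewrite mem_enum.
case/mapP => k _ -> ->; exists (lift p k) => //.
by rewrite mem_filter mem_enum andbT eq_sym neq_lift.
Qed.

Lemma word_lift_perm n (p : 'I_n.+1) (y : 'S_n) :
  [seq x <- word (lift_perm p ord_max y) | x != n] = word y.
Proof.
rewrite /word filter_map.
rewrite (eq_filter (a2 := fun i => i != p)); last first.
  move=> i /=; congr (~~ _); rewrite -(inj_eq (@perm_inj _ (lift_perm p ord_max y)) i p).
  by rewrite lift_perm_id -val_eqE.
rewrite filter_enum_lift -map_comp; apply: eq_map => i /=.
by rewrite lift_perm_lift lift_max.
Qed.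

End LiftWord.

(** * Coefficients for the shape and for its deletions *)

Section TopEntry.

Local Open Scope nat_scope.

Variables (n : nat) (la : seq nat).
Hypothesis la_n : is_partition n.+1 la.
Implicit Types (T S : SYT n.+1 la) (i r c : nat).

Lemma rowperm_top T :
  ((rowperm T)^-1%g ord_max).+1 = sumn (drop (top_row T) la).
Proof.
have st := rows_syt T; rewrite -index_word word_rowperm index_rowword_max /=.
- by rewrite (syt_shape st).
- by case/and4P: st.
- exact: syt_uniq st.
- by rewrite (syt_mem st).
- by move=> j; rewrite (syt_mem st).
Qed.

Lemma top_row_lt T : top_row T < size la.
Proof. by have := top_row_removable la_n T; rewrite (mem_removable _) => /andP[]. Qed.

Lemma idx_leq_pos S T :
  (rowperm T)^-1%g ord_max <= (rowperm S)^-1%g ord_max -> idx S <= idx T.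
Proof.
rewrite -ltnS !rowperm_top => le; apply: (leq_idx la_n); rewrite leqNgt; apply/negP => lt.
have la0 : 0 \notin la by case/and3P: la_n.
by move: le; rewrite leqNgt (ltn_sumn_drop la0 lt (top_row_lt T)).
Qed.

(** Tableaux of equal index have reading words in the same coset, which makes [mubar_phi]
    applicable. *)
Lemma idx_eq_pos S T : idx S = idx T ->
  (rowperm S)^-1%g ord_max = (rowperm T)^-1%g ord_max.
Proof.
move=> e; apply: val_inj; apply: succn_inj; rewrite !rowperm_top.
by rewrite (top_rowE la_n e) (top_rowE la_n (erefl (idx T))).
Qed.

Lemma mubar_idx S T (i k : 'I_n.+1) : k = i.+1 :> nat -> k < n ->
  ~~ descent T i -> descent S i -> mubar (rowperm T) (rowperm S) != 0%R -> idx S <= idx T.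
Proof.
move=> ik kn dT dS nz; have sr : is_simple (tperm i k) by apply/simpleP; exists i, k.
have [lt|lt] := mubar_neq0 nz; last first.
  by apply: idx_leq_pos; apply: bruhat_max; case/andP: lt.
have e : rowperm S = (rowperm T * tperm i k)%g.
  by apply: mubar_des lt nz; rewrite ?(des_rowperm _ ik) ?dT.
apply: idx_leq_pos; rewrite e invMg permM tpermV tpermD //.
  by rewrite -val_eqE /= ltn_eqF // ltnW // -ik.
by rewrite -val_eqE /= ltn_eqF.
Qed.

Section Delete.

Variable i : nat.
Hypothesis i_r : 1 <= i <= size (removable la).
Let mu := delete_removable la i.
Implicit Types U V : SYT n mu.

Lemma extends_row_of T U j : extends T U -> j < n -> row_of (rows T) j = row_of (rows U) j.
Proof.
move=> eT jn; have := congr1 (fun s => nth 0 s j) eT.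
rewrite nth_rcons size_yam jn !(nth_map 0) ?size_iota ?nth_iota //; exact: ltnW.
Qed.

Lemma extends_descent T U j : extends T U -> j.+1 < n -> descent T j = descent U j.
Proof.
by move=> eT jn; rewrite /descent !(extends_row_of eT) // ltnW.
Qed.

Lemma extends_rowperm T U : extends T U ->
  rowperm T = lift_perm ((rowperm T)^-1%g ord_max) ord_max (rowperm U).
Proof.
move=> eT; have [y ey] := phi_surj (erefl ((rowperm T)^-1%g ord_max)).
rewrite {1}ey; congr lift_perm; apply: word_inj; rewrite word_rowperm.
have mu_n := delete_partition la_n i_r; have sU := rows_syt U.
rewrite -(word_lift_perm ((rowperm T)^-1%g ord_max)) -ey word_rowperm.
rewrite -(recording_yam la_n (rows_syt T)) eT recording_rcons /record.
rewrite sumn_shape_recording size_yam (recording_yam mu_n sU) rowword_record //.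
by rewrite (syt_mem sU) ltnn.
Qed.

Lemma extends_mubar T S U V : extends T U -> extends S V ->
  mubar (rowperm T) (rowperm S) = mubar (rowperm U) (rowperm V).
Proof.
move=> eT eS; rewrite (extends_rowperm eT) (extends_rowperm eS).
rewrite (@idx_eq_pos S T) ?mubar_phi //.
by rewrite (extends_idx i_r eT) (extends_idx i_r eS).
Qed.

Lemma extends_injr T S U : extends T U -> extends S U -> T = S.
Proof. by rewrite /extends => <- /esym; exact: yam_inj. Qed.

Lemma extends_injl T U V : extends T U -> extends T V -> U = V.
Proof.
rewrite /extends => -> /rcons_inj[]; apply: yam_inj; exact: delete_partition.
Qed.

End Delete.

End TopEntry.

(** * The filtration *)

Section Sections.

Variables (F : fieldType) (gT : finGroupType) (G : {group gT}).
Variables (n m : nat) (rG : mx_representation F G n) (sG : mx_representation F G m).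

Lemma mxmodule_gen (D : {set gT}) (U : 'M_n) : <<D>>%g = G :> {set gT} ->
  (forall x, x \in D -> (U *m rG x <= U)%MS) -> mxmodule rG U.
Proof.
move=> defG stabU; suff : <<D>>%g \subset rstabs rG U by rewrite defG.
rewrite gen_subG.
apply/subsetP=> x Dx; rewrite inE stabU // andbT -defG; exact: mem_gen.
Qed.

(** [A] is a map into V that need only be equivariant modulo U, and this only on generators; it has
    to be injective modulo U and, together with U, to span V. *)
Lemma mx_rsim_section (D : {set gT}) (A : 'M_(m, n)) (U V : 'M_n)
    (modU : mxmodule rG U) (modV : mxmodule rG V) : <<D>>%g = G :> {set gT} ->
  (A <= V)%MS -> (V <= U + A)%MS -> (forall u : 'rV_m, (u *m A <= U)%MS -> u = 0) ->
  (forall x, x \in D -> (A *m rG x - sG x *m A <= U)%MS) ->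
  (U <= V)%MS -> mx_rsim (section_repr modU modV) sG.
Proof.
move=> defG sAV sVUA kerA homA sUV; apply: mx_rsim_sym.
have homAG x : x \in G -> (A *m rG x - sG x *m A <= U)%MS.
  (* The elements for which [A] is equivariant modulo U form a group, because U is a submodule. *)
  move=> Gx; pose K := [set y in G | (A *m rG y - sG y *m A <= U)%MS].
  have gK : group_set K.
    apply/group_setP; split; first by rewrite inE group1 !repr_mx1 mulmx1 mul1mx subrr sub0mx.
    move=> y z /setIdP[Gy Uy] /setIdP[Gz Uz]; rewrite inE groupM //= !repr_mxM //.
    rewrite -(subrK (sG y *m A *m rG z) (_ *m _)) -addrA addmx_sub //.
      by rewrite mulmxA -mulmxBl (submx_trans (submxMr _ Uy)) // (mxmoduleP modU).
    by rewrite -!mulmxA -mulmxBr mulmx_sub.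
  suff /subsetP/(_ x Gx) : G \subset Group gK by rewrite inE => /andP[].
  rewrite -defG gen_subG; apply/subsetP=> y Dy.
  by rewrite inE homA // andbT -defG mem_gen.
set W := (<<in_factmod U V>>)%MS; pose f := in_submod W (in_factmod U A).
have sW k (B : 'M_(k, n)) : (B <= V)%MS -> (in_factmod U B <= W)%MS.
  by move=> sB; rewrite genmxE submxMr.
have free_f : row_free f.
  rewrite -kermx_eq0; apply/rowV0P=> u; rewrite (sameP sub_kermxP eqP) => /eqP uf0.
  apply: kerA; rewrite -in_factmod_eq0; apply/eqP.
  have: val_submod (u *m f) = 0 by rewrite uf0 linear0.
  rewrite /f in_submodE mulmxA -in_submodE in_submodK; last by rewrite mulmx_sub ?sW.
  by rewrite /in_factmod /= -mulmxA.
exists f => // [|x Gx].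
  rewrite -(eqP free_f) mxrank_in_submod ?sW // genmxE.
  apply/eqP; rewrite eqn_leq mxrankS ?submxMr //=.
  by rewrite -(in_factmod_addsK U A) mxrankS ?submxMr.
rewrite {1}/f in_submodE mulmxA -in_submodE -in_submodJ ?sW //.
rewrite -in_factmodJ //; congr (in_submod _ _); apply/eqP.
rewrite in_factmodE mulmxA -in_factmodE eq_sym -subr_eq0 -linearB in_factmod_eq0.
exact: homAG.
Qed.

End Sections.

Section Filtration.

Variables (F : fieldType) (n : nat) (la : seq nat).
Local Notation b := (@KLbasis F n la).
Local Notation S_ := (specht_filt F n la).
Implicit Types (T S : SYT n la) (k : nat).

Lemma KLbasis_filt T k : (idx T <= k)%N -> (b T <= S_ k)%MS.
Proof. by move=> le; rewrite (sumsmx_sup T) // genmxE. Qed.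

Lemma sub_filtP (u : 'rV_#|{: SYT n la}|) k :
  reflect (forall T, (k < idx T)%N -> u 0 (enum_rank T) = 0) (u <= S_ k)%MS.
Proof.
apply: (iffP idP) => [sub T lt|u0].
  have : (S_ k <= kermx (delta_mx (enum_rank T) (0 : 'I_1)))%MS.
    apply/sumsmx_subP => S le; rewrite genmxE; apply/sub_kermxP.
    rewrite mul_delta_mx_cond; case: eqP => [/enum_rank_inj e|_]; last by rewrite mulr0n.
    by move: lt; rewrite -e ltnNge le.
  move/(submx_trans sub)/sub_kermxP; rewrite -colE => /matrixP/(_ 0 0).
  by rewrite !mxE.
rewrite (row_sum_delta u); apply: summx_sub => j _.
have [le|lt] := leqP (idx (enum_val j)) k.
  by rewrite scalemx_sub // -(enum_valK j) KLbasis_filt.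
by rewrite -(enum_valK j) u0 // scale0r sub0mx.
Qed.

Lemma KLbasis_filtE T k : (b T <= S_ k)%MS = (idx T <= k)%N.
Proof.
apply/idP/idP => [/sub_filtP h|]; last exact: KLbasis_filt.
rewrite leqNgt; apply/negP => /h; rewrite mxE !eqxx /=.
by move/eqP; rewrite oner_eq0.
Qed.

Lemma filtS k l : (k <= l)%N -> (S_ k <= S_ l)%MS.
Proof.
by move=> kl; apply/sumsmx_subP => T le; rewrite genmxE KLbasis_filt // (leq_trans le).
Qed.

End Filtration.

(** * Invariance and the subquotients *)

Section Specht.

Variables (F : fieldType) (n : nat) (la : seq nat) (Q0 : SYT n.+1 la).
Hypothesis la_n : is_partition n.+1 la.
Variable rho : mx_representation F [set: 'S_n.+1] #|{: SYT n.+1 la}|.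
Hypothesis rhoP : is_specht Q0 rho.
Local Notation b := (@KLbasis F n.+1 la).
Local Notation S_ := (specht_filt F n.+1 la).
Local Notation r := (size (removable la)).

Lemma filt0 : S_ 0%N = 0.
Proof. by apply: big_pred0 => T; have /andP[] := idx_bounds la_n T; case: (idx T). Qed.

Lemma filt_ltmx k : (k < r)%N -> (S_ k < S_ k.+1)%MS.
Proof.
move=> kr; rewrite /ltmx filtS //=; have [|T iT] := @exists_idx n la la_n k.+1; first exact: kr.
apply/negP => /(submx_trans (KLbasis_filt F (eq_leq iT))).
by rewrite KLbasis_filtE iT ltnn.
Qed.

Lemma filt_full : (S_ r :=: 1%:M)%MS.
Proof.
apply/eqmxP; rewrite submx1; apply/row_subP => j; apply/sub_filtP => T.
by have /andP[_ le] := idx_bounds la_n T; rewrite ltnNge le.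
Qed.

Lemma Sembed_rhoP (a c : 'I_n) T : c = a.+1 :> nat ->
  b T *m res_repr rho (tperm a c) =
    if descent T a then - b T else b T
      + \sum_(S : SYT n.+1 la | descent S a) (mubar_syt Q0 T S)%:~R *: b S.
Proof.
by move=> ac; rewrite /= Sembed_tperm (rhoP (i := lift ord_max a)) !lift_max.
Qed.

Lemma mubar_filt (a c : 'I_n) T S k : c = a.+1 :> nat -> ~~ descent T a -> descent S a ->
  (mubar_syt Q0 T S != 0 -> idx S <= idx T -> idx S <= k)%N ->
  ((mubar_syt Q0 T S)%:~R *: b S <= S_ k)%MS.
Proof.
move=> ac dT dS le; have [->|nz] := eqVneq (mubar_syt Q0 T S) 0.
  by rewrite scale0r sub0mx.
rewrite scalemx_sub // KLbasis_filt // le //.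
have ik : lift ord_max c = (lift ord_max a).+1 :> nat by rewrite !lift_max.
apply: (mubar_idx la_n ik); rewrite ?lift_max //.
by rewrite -(mubar_syt_rowperm la_n Q0 ik) ?lift_max.
Qed.

Lemma filt_module k : mxmodule (res_repr rho) (S_ k).
Proof.
apply: (mxmodule_gen (simple_gen n)) => s; rewrite inE => /simpleP[a [c [ac ->]]].
rewrite -[specht_filt _ _ _ k]/(\sum_(T | _) _)%MS (sumsmxMr _ _ _); apply/sumsmx_subP => T le.
rewrite (eqmxMr _ (genmxE _)) Sembed_rhoP //; case: ifPn => dT.
  by rewrite eqmx_opp KLbasis_filt.
rewrite addmx_sub ?KLbasis_filt //; apply: summx_sub => S dS.
by apply: (mubar_filt ac dT dS) => _ /leq_trans; apply.
Qed.

Lemma section_rsim i (Q1 : SYT n (delete_removable la i))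
    (sigma : mx_representation F [set: 'S_n] #|{: SYT n (delete_removable la i)}|)
    (modU : mxmodule (res_repr rho) (S_ i.-1)) (modV : mxmodule (res_repr rho) (S_ i)) :
  (1 <= i <= r)%N -> is_specht Q1 sigma -> mx_rsim (section_repr modU modV) sigma.
Proof.
move=> i_r sigmaP; have mu_n := delete_partition la_n i_r.
have i_gt0 : (0 < i)%N by case/andP: i_r.
have [ext extP] : exists ext, forall U, extends (ext U) U := fin_all_exists (exists_add la_n i_r).
have idx_ext U : idx (ext U) = i := extends_idx i_r (extP U).
have ext_inj : injective ext.
  by move=> U V e; apply: (extends_injl la_n i_r (extP U)); rewrite e.
have ext_surj T : idx T = i -> exists U, ext U = T.
  move=> iT; have [U eU] := exists_delete la_n i_r iT.
  by exists U; apply: (extends_injr la_n (extP U) eU).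
(* The linear map that sends C_U to C_T, where T is U with n added in the i-th removable box. *)
pose A : 'M[F]_(#|{: SYT n (delete_removable la i)}|, #|{: SYT n.+1 la}|) :=
  \matrix_j b (ext (enum_val j)).
have bA (U : SYT n (delete_removable la i)) : KLbasis F U *m A = b (ext U) by rewrite -rowE rowK enum_rankK.
apply: (mx_rsim_section (A := A) modU modV (simple_gen n)).
- by apply/row_subP => j; rewrite rowK KLbasis_filt // idx_ext.
- apply/sumsmx_subP => T; rewrite leq_eqVlt genmxE => /orP[/eqP/ext_surj[U <-]|lt].
    by rewrite -bA (submx_trans _ (addsmxSr _ _)) // submxMl.
  by rewrite (submx_trans _ (addsmxSl _ _)) // KLbasis_filt // -ltnS prednK.
- move=> u /sub_filtP h; apply/rowP => j; have := h (ext (enum_val j)).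
  rewrite idx_ext prednK // leqnn => /(_ isT).
  rewrite mulmx_sum_row summxE (bigD1 j) //= big1 ?addr0 => [|l lj].
    by rewrite rowK !mxE !eqxx mulr1.
  rewrite rowK !mxE eqxx /= (inj_eq enum_rank_inj) (inj_eq ext_inj) (inj_eq enum_val_inj).
  by rewrite eq_sym (negbTE lj) mulr0.
- move=> s; rewrite inE => /simpleP[a [c [ac ->]]]; apply/row_subP => j.
  set U := enum_val j; set T := ext U; have iT : idx T = i := idx_ext U.
  have dE V : descent (ext V) a = descent V a.
    by apply: (extends_descent (extP V)); rewrite -ac.
  have -> : row j (A *m res_repr rho (tperm a c) - sigma (tperm a c) *m A) =
      b T *m res_repr rho (tperm a c) - KLbasis F U *m sigma (tperm a c) *m A.
    by rewrite linearB /= !row_mul rowK [row j (sigma _)]rowE /KLbasis enum_valK.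
  rewrite Sembed_rhoP // (sigmaP a c ac) dE; case: ifPn => dU.
    by rewrite mulNmx bA subrr sub0mx.
  rewrite mulmxDl bA opprD addrACA subrr add0r mulmx_suml.
  (* An inverse of [ext] on the tableaux of index i; elsewhere U serves as an arbitrary default. *)
  have [del delP] : exists del, forall S, idx S = i -> ext (del S) = S.
    apply: (fin_all_exists (P := fun S V => idx S = i -> ext V = S)) => S.
    by have [/ext_surj[V eV]|ne] := eqVneq (idx S) i; [exists V | exists U => e; rewrite e eqxx in ne].
  (* The terms of index i match those for the smaller shape through [ext]; the others have index
     less than i and vanish modulo the previous step of the filtration. *)
  rewrite (bigID (fun S => idx S == i)) /= (reindex_onto ext del) /=; last first.
    by move=> S /andP[_ /eqP /delP].
  rewrite addrAC; apply: addmx_sub.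
    have ik : lift ord_max c = (lift ord_max a).+1 :> nat by rewrite !lift_max.
    rewrite (eq_big (fun V => descent V a)
      (fun V => (mubar_syt Q1 U V)%:~R *: KLbasis F V *m A)) ?subrr ?sub0mx // => V.
      by rewrite dE idx_ext eqxx andbT (ext_inj _ _ (delP _ (idx_ext V))) eqxx andbT.
    case/andP => /andP[]; rewrite dE => dV _ _; rewrite -scalemxAl bA.
    rewrite (mubar_syt_rowperm la_n Q0 ik) ?lift_max ?dE //.
    rewrite (mubar_syt_rowperm mu_n Q1 ac) //.
    by rewrite (extends_mubar la_n i_r (extP U) (extP V)).
  apply: summx_sub => S /andP[dS ne].
  apply: (mubar_filt ac _ dS); first by rewrite dE.
  by move=> _; rewrite iT => le; rewrite -ltnS prednK // ltn_neqAle ne.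
exact: filtS (leq_pred _).
Qed.

End Specht.

(** The proofs of invariance are bound by an existential because [section_repr] takes them as
    arguments. *)
Theorem theorem2 (R : realType) (n : nat) (la : seq nat)
    (la_n : is_partition n.+1 la) (Q0 : SYT n.+1 la)
    (rho : mx_representation R[i] [set: 'S_n.+1] #|{: SYT n.+1 la}|)
    (rhoP : is_specht Q0 rho) :
  let r := size (removable la) in
  let S := specht_filt R[i] n.+1 la in
  [/\ S 0%N = 0,
      forall k : nat, (k < r)%N -> (S k < S k.+1)%MS,
      (S r :=: 1%:M)%MS &
      exists S_mod : forall k : nat, mxmodule (res_repr rho) (S k),
      forall i : nat, (1 <= i <= r)%N ->
      forall (Q1 : SYT n (delete_removable la i))
        (sigma : mx_representation R[i] [set: 'S_n]
                   #|{: SYT n (delete_removable la i)}|),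
        is_specht Q1 sigma ->
        mx_rsim (section_repr (S_mod i.-1) (S_mod i)) sigma].
Proof.
split.
- exact: filt0.
- exact: filt_ltmx.
- exact: filt_full.
exists (filt_module la_n rhoP) => i i_r Q1 sigma.
exact: (section_rsim la_n rhoP _ _ i_r).
Qed.
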